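(* Let $n\ge 1$, let $p>1$ and let $D\subset\mathbb H^n$ be either a bounded convex domain or a half-space in $\mathbb H^n$. Then $$\int_D|\nabla_{\mathbb H^n}u|^p\,d\xi\ \ge\ \Big(\frac{p-1}{p}\Big)^p\int_D\frac{|u|^p}{d_\rho^{\,p}}\,d\xi\qquad\text{for all }u\in C_c^\infty(D).$$ In the case of the half-space the constant is sharp, i.e. it cannot be replaced by any larger constant.
   Context: The Heisenberg group $\mathbb H^n$ is $\mathbb R^{2n+1}=\{\xi=(x,y,t):x,y\in\mathbb R^n,\ t\in\mathbb R\}$ with group law $\xi\xi'=(x+x',y+y',t+t'+2(x\cdot y'-y\cdot x'))$. The left-invariant horizontal vector fields are $X_i=\partial_{x_i}+2y_i\partial_t$, $Y_i=\partial_{y_i}-2x_i\partial_t$ ($i=1,\dots,n$), and $\nabla_{\mathbb H^n}=(X_1,\dots,X_n,Y_1,\dots,Y_n)$ is the horizontal gradient. The Carnot-Carath\'eodory distance $\rho(\xi,\xi')$ is the infimum of the lengths of horizontal curves joining $\xi$ to $\xi'$, where an absolutely continuous curve $\gamma$ is horizontal if $\dot\gamma=\sum_i(a_iX_i+b_iY_i)(\gamma)$ a.e., its length being $\int(\sum_i a_i^2+b_i^2)^{1/2}$. It is left-invariant; $\rho(\xi)$ denotes the distance from $\xi$ to the origin. For a domain $D\subset\mathbb H^n$, $d_\rho(\xi)=\inf\{\rho((\xi')^{-1}\xi):\xi'\in\partial D\}$, $\xi\in D$, is the Carnot-Carath\'eodory distance to the boundary. Convexity is Euclidean convexity in $\mathbb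 R^{2n+1}$, and ''half-space'' means an open affine half-space of $\mathbb R^{2n+1}$. $d\xi$ is Lebesgue measure.
   Formalization: The group law is taken with t+t'+2(y·x'-x·y') instead of t+t'+2(x·y'-y·x'), since with the printed sign the fields X_i, Y_i and the distance ρ are not left-invariant as stated. *)

(* Defs.v *)
From HB Require Import structures.
From mathcomp Require Import all_boot all_order all_algebra.
From mathcomp Require Import all_classical all_reals all_analysis.
From mathcomp Require Import ring.

Set Implicit Arguments.
Unset Strict Implicit.
Unset Printing Implicit Defensive.

Import Order.TTheory GRing.Theory Num.Theory.
Import numFieldNormedType.Exports.

Local Open Scope classical_set_scope.
Local Open Scope ring_scope.

(* The canonical sigma-finite structure of [product_measure1] is masked in the
   library by the one for subprobability measures. *)
Lemma sigma_finite_product d1 d2 (T1 : measurableType d1)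
    (T2 : measurableType d2) (R : realType)
    (m1 : {sigma_finite_measure set T1 -> \bar R})
    (m2 : {sigma_finite_measure set T2 -> \bar R}) :
  sigma_finite setT (m1 \x m2)%E.
Proof.
have /sigma_finiteP[F [TF ndF Foo]] := sigma_finiteT m1.
have /sigma_finiteP[G [TG ndG Goo]] := sigma_finiteT m2.
exists (fun n => F n `*` G n).
  rewrite -setXTT TF TG predeqE => -[x y]; split.
    move=> [/= [n _ Fnx] [k _ Gky]]; exists (maxn n k) => //; split.
    - by move: x Fnx; exact/subsetPset/ndF/leq_maxl.
    - by move: y Gky; exact/subsetPset/ndG/leq_maxr.
  by move=> [n _ []/= ? ?]; split; exists n.
move=> k; have [? ?] := Foo k; have [? ?] := Goo k.
split; first exact: measurableX.
by rewrite product_measure1E// lte_mul_pinfty// ge0_fin_numE.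
Qed.

Section lebesgue_rV.
Context {R : realType}.

Section measurable_rV.
Variable n : nat.

Let coord (i : 'I_n) (v : 'rV[R]_n) : R := v 0 i.

Let rV_set0 : g_sigma_preimage coord set0.
Proof. exact: sigma_algebra0. Qed.

Let rV_setC A : g_sigma_preimage coord A -> g_sigma_preimage coord (~` A).
Proof. exact: sigma_algebraC. Qed.

Let rV_bigcup (F : _^nat) : (forall i, g_sigma_preimage coord (F i)) ->
  g_sigma_preimage coord (\bigcup_i (F i)).
Proof. exact: sigma_algebra_bigcup. Qed.

(* The product sigma-algebra, which is the Borel one. *)
HB.instance Definition _ := @isMeasurable.Build default_measure_display
  'rV[R]_n (g_sigma_preimage coord) rV_set0 rV_setC rV_bigcup.

Lemma measurable_coord (i : 'I_n) :
  measurable_fun [set: 'rV[R]_n] (fun v : 'rV[R]_n => v 0 i).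
Proof.
move=> _ Y mY; rewrite setTI; apply: sub_sigma_algebra => /=.
rewrite -bigcup_seq/=; exists i => /=; first by rewrite mem_index_enum.
by exists Y => //; rewrite setTI.
Qed.

Lemma measurable_fun_rV d (T : measurableType d) (f : T -> 'rV[R]_n) :
  (forall i, measurable_fun [set: T] (fun x => f x 0 i)) ->
  measurable_fun [set: T] f.
Proof.
move=> mf.
have H : g_sigma_preimage (fun i => coord i \o f) `<=` measurable.
  apply: smallest_sub; first exact: sigma_algebra_measurable.
  elim/big_ind: _ => //.
  - by move=> A B AS BS C [/AS|/BS].
  - by move=> i _ A [B mB <-]; exact: mf.
move=> _ A mA; apply: H.
rewrite /g_sigma_preimage in mA *.
have := g_sigma_preimage_comp coord f.
rewrite /g_sigma_preimage => ->.
by exists A => //.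
Qed.

Lemma measurable_box (A : 'I_n -> set R) :
  (forall i, measurable (A i)) ->
  measurable [set v : 'rV[R]_n | forall i, A i (v 0 i)].
Proof.
move=> mA; rewrite [X in measurable X](_ : _ =
  \bigcap_(i in setT) [set v : 'rV[R]_n | A i (v 0 i)]).
  apply: fin_bigcap_measurable => // i _.
  by rewrite -[X in measurable X]setTI; exact: measurable_coord.
by apply/seteqP; split => v /= Av i; [move=> _|]; exact: Av.
Qed.

End measurable_rV.

Section cons_measure.
Variable n : nat.
Variable mu : {sigma_finite_measure set 'rV[R]_n -> \bar R}.

Definition consrV (z : measurableTypeR R * 'rV[R]_n) : 'rV[R]_n.+1 :=
  row_mx (z.1 : R)%:M z.2.

Lemma consrVl z : consrV z 0 0 = z.1.
Proof.
rewrite /consrV (_ : 0 = lshift n (0 : 'I_1)); last exact/val_inj.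
by rewrite (@row_mxEl _ 1 1 n) mxE eqxx mulr1n.
Qed.

Lemma consrVr z (j : 'I_n) : consrV z 0 (lift ord0 j) = z.2 0 j.
Proof.
rewrite /consrV (_ : lift ord0 j = rshift 1 j); last exact/val_inj.
by rewrite (@row_mxEr _ 1 1 n).
Qed.

Lemma measurable_consrV : measurable_fun setT consrV.
Proof.
apply: measurable_fun_rV => i.
case: (unliftP ord0 i) => [j|] ->.
  under eq_fun do rewrite consrVr.
  exact: (measurableT_comp (measurable_coord j) measurable_snd).
under eq_fun do rewrite consrVl.
exact: measurable_fst.
Qed.

Definition cons_measure : set 'rV[R]_n.+1 -> \bar R :=
  pushforward (lebesgue_measure \x mu)%E consrV.

Let cons_measure0 : cons_measure set0 = 0%E.
Proof. by rewrite /cons_measure /pushforward preimage_set0 measure0. Qed.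

Let cons_measure_ge0 A : (0 <= cons_measure A)%E.
Proof. by rewrite /cons_measure /pushforward measure_ge0. Qed.

Let cons_measure_sigma_additive : semi_sigma_additive cons_measure.
Proof.
move=> F mF tF mUF; rewrite /cons_measure /pushforward preimage_bigcup.
have mF' i : measurable (consrV @^-1` F i).
  by rewrite -[X in measurable X]setTI; exact: measurable_consrV.
apply: measure_semi_sigma_additive => //.
- apply/trivIsetP => /= i j _ _ ij; rewrite -preimage_setI.
  by move/trivIsetP : tF => /(_ _ _ _ _ ij) ->//; rewrite preimage_set0.
- exact: bigcup_measurable.
Qed.

HB.instance Definition _ := isMeasure.Build _ _ _ cons_measure
  cons_measure0 cons_measure_ge0 cons_measure_sigma_additive.

Let cons_measure_sigma_finite : sigma_finite setT cons_measure.
Proof.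
have [F FT Foo] := sigma_finite_product (@lebesgue_measure R) mu.
pose g (v : 'rV[R]_n.+1) : measurableTypeR R * 'rV[R]_n :=
  (v 0 0, \row_j v 0 (lift ord0 j)).
have gK : cancel consrV g.
  move=> [a v]; rewrite /g consrVl /=; congr pair; apply/rowP => j.
  by rewrite mxE consrVr.
have mg : measurable_fun setT g.
  apply: measurable_fun_pair; first exact: measurable_coord.
  apply: measurable_fun_rV => j; under eq_fun do rewrite mxE.
  exact: measurable_coord.
exists (fun k => g @^-1` F k).
  by rewrite -preimage_bigcup -FT preimage_setT.
move=> k; have [mFk Fk] := Foo k; split.
  by rewrite -[X in measurable X]setTI; exact: mg.
rewrite /cons_measure /pushforward -comp_preimage.
by rewrite (_ : g \o consrV = id)//; apply/funext => z /=; rewrite gK.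
Qed.

HB.instance Definition _ := Measure_isSigmaFinite.Build _ _ _ cons_measure
  cons_measure_sigma_finite.

Lemma cons_measureE (A : 'I_n.+1 -> set R)
    (B := fun j : 'I_n => A (lift ord0 j)) :
  measurable (A ord0) ->
  measurable [set v : 'rV[R]_n | forall j, B j (v 0 j)] ->
  cons_measure [set v : 'rV[R]_n.+1 | forall i, A i (v 0 i)] =
  (lebesgue_measure (A ord0) *
   mu [set v : 'rV[R]_n | forall j, B j (v 0%R j)])%E.
Proof.
move=> mA mB; rewrite -product_measure1E//.
congr (product_measure1 _ _ _); apply/seteqP; split => z /=.
  by move=> Az; split => [|j]; [rewrite -consrVl|rewrite /B -consrVr]; exact: Az.
move=> [A0 AB] i; case: (unliftP ord0 i) => [j|] ->.
  by rewrite consrVr; exact: AB.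
by rewrite consrVl.
Qed.

End cons_measure.

(* Characterized by its value on boxes, see [lebesgue_rV_box]. *)
Fixpoint lebesgue_rV n : {sigma_finite_measure set 'rV[R]_n -> \bar R} :=
  if n is m.+1 then cons_measure (lebesgue_rV m) else \d_ (0 : 'rV[R]_0).

Lemma lebesgue_rV_box n (A : 'I_n -> set R) :
  (forall i, measurable (A i)) ->
  lebesgue_rV n [set v : 'rV[R]_n | forall i, A i (v 0 i)] =
  (\prod_(i < n) lebesgue_measure (A i))%E.
Proof.
elim: n A => [A _|n IHn A mA].
  rewrite big_ord0 /= diracE mem_set//.
  by case.
rewrite big_ord_recl /= cons_measureE//.
  by rewrite (IHn (fun j => A (lift ord0 j))).
by apply: (@measurable_box n (fun j => A (lift ord0 j))).
Qed.

End lebesgue_rV.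

Notation heis R n := ('rV[R]_n * 'rV[R]_n * R)%type.

Section volume.
Context {R : realType} {n : nat}.

Definition volume : set ('rV[R]_n * 'rV[R]_n * measurableTypeR R) -> \bar R :=
  ((lebesgue_rV n \x lebesgue_rV n) \x lebesgue_measure)%E.

HB.instance Definition _ := Measure.on volume.

Let volume_sigma_finite : sigma_finite setT volume.
Proof.
pose sf := Measure_isSigmaFinite.Build _ _ R
  (@lebesgue_rV R n \x @lebesgue_rV R n)%E
  (sigma_finite_product (@lebesgue_rV R n) (@lebesgue_rV R n)).
pose m : {sigma_finite_measure set ('rV[R]_n * 'rV[R]_n)%type -> \bar R} :=
  HB.pack (@lebesgue_rV R n \x @lebesgue_rV R n)%E sf.
exact: (sigma_finite_product m (@lebesgue_measure R)).
Qed.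

HB.instance Definition _ := Measure_isSigmaFinite.Build _ _ _ volume
  volume_sigma_finite.

Lemma volume_box (A B : set 'rV[R]_n) (C : set (measurableTypeR R)) :
  measurable A -> measurable B -> measurable C ->
  volume (A `*` B `*` C) =
  (lebesgue_rV n A * lebesgue_rV n B * lebesgue_measure C)%E.
Proof.
move=> mA mB mC; rewrite /volume product_measure1E//; last exact: measurableX.
by rewrite [X in (X * _)%E](product_measure1E _ _ mA mB).
Qed.

End volume.

Section heisenberg.
Context {R : realType} {n : nat}.
Local Notation H := (heis R n).
Implicit Types (xi zeta : H) (x y : 'rV[R]_n) (D : set H) (u : H -> R).

Definition dotv x y : R := \sum_(i < n) x 0 i * y 0 i.

(* The sign of the commutator term is the one for which the fields [hX] and
   [hY] below are left-invariant (lemmas [hmul_hX] and [hmul_hY]); with the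
   opposite sign they would be right-invariant. *)
Definition hmul xi zeta : H :=
  let: (x, y, t) := xi in let: (x', y', t') := zeta in
  (x + x', y + y', t + t' + 2 * (dotv y x' - dotv x y')).

Definition hinv xi : H := - xi.

Definition hX (i : 'I_n) xi : H := (delta_mx 0 i, 0, 2 * xi.1.2 0 i).

Definition hY (i : 'I_n) xi : H := (0, delta_mx 0 i, - (2 * xi.1.1 0 i)).

Lemma dotvDl x x' y : dotv (x + x') y = dotv x y + dotv x' y.
Proof. by rewrite -big_split; apply: eq_bigr => i _; rewrite mxE mulrDl. Qed.

Lemma dotvDr x y y' : dotv x (y + y') = dotv x y + dotv x y'.
Proof. by rewrite -big_split; apply: eq_bigr => i _; rewrite mxE mulrDr. Qed.

Lemma dotvNl x y : dotv (- x) y = - dotv x y.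
Proof. by rewrite -sumrN; apply: eq_bigr => i _; rewrite mxE mulNr. Qed.

Lemma dotvC x y : dotv x y = dotv y x.
Proof. by apply: eq_bigr => i _; rewrite mulrC. Qed.

Lemma dotv0 x : dotv x 0 = 0.
Proof. by rewrite /dotv big1// => i _; rewrite mxE mulr0. Qed.

Lemma dotv_delta x (s : R) i : dotv x (s *: delta_mx 0 i) = s * x 0 i.
Proof.
rewrite /dotv (bigD1 i)//= big1 => [|j ji].
  by rewrite !mxE !eqxx mulr1 addr0 mulrC.
by rewrite !mxE (negbTE ji) andbF !mulr0.
Qed.

Lemma hmulA : associative hmul.
Proof.
move=> [[x y] t] [[x' y'] t'] [[x'' y''] t''] /=.
by rewrite !addrA !(dotvDl, dotvDr); congr (_, _, _); ring.
Qed.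

Lemma hmulx0 xi : hmul xi 0 = xi.
Proof. by case: xi => [[x y] t] /=; rewrite !dotv0 subrr mulr0 !addr0. Qed.

Lemma hmulVx xi : hmul (hinv xi) xi = 0.
Proof.
case: xi => [[x y] t] /=; rewrite !dotvNl (dotvC y) subrr mulr0 addr0.
by rewrite !addNr.
Qed.

Lemma hmul_hX zeta xi i (s : R) :
  hmul zeta (xi + s *: hX i xi) = hmul zeta xi + s *: hX i (hmul zeta xi).
Proof.
case: zeta xi => [[x y] t] [[x' y'] t'] /=.
rewrite /hX /= !dotvDr dotv_delta scaler0 dotv0 mxE.
congr (_, _, _) => /=.
- by apply: addrA.
- by rewrite scaler0; apply: addrA.
- by rewrite /GRing.scale /=; ring.
Qed.

Lemma hmul_hY zeta xi i (s : R) :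
  hmul zeta (xi + s *: hY i xi) = hmul zeta xi + s *: hY i (hmul zeta xi).
Proof.
case: zeta xi => [[x y] t] [[x' y'] t'] /=.
rewrite /hY /= !dotvDr dotv_delta scaler0 dotv0 mxE.
congr (_, _, _) => /=.
- by rewrite scaler0; apply: addrA.
- by apply: addrA.
- by rewrite /GRing.scale /=; ring.
Qed.

Definition hnorm (v : 'rV[R]_n * 'rV[R]_n) : R :=
  Num.sqrt (\sum_(i < n) (v.1 0 i ^+ 2 + v.2 0 i ^+ 2)).

Definition hgrad u xi : 'rV[R]_n * 'rV[R]_n :=
  (\row_i 'D_(hX i xi) u xi, \row_i 'D_(hY i xi) u xi).

Definition abs_continuous (V : normedModType R) (s0 s1 : R) (g : R -> V) :=
  forall e, 0 < e -> exists2 d, 0 < d & forall I : seq (R * R),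
    all [pred i | s0 <= i.1 <= i.2 & i.2 <= s1] I ->
    pairwise [rel i j | (i.2 <= j.1) || (j.2 <= i.1)] I ->
    \sum_(i <- I) (i.2 - i.1) < d ->
    \sum_(i <- I) `|g i.2 - g i.1| < e.

(* Length is invariant under reparametrization, so all curves are
   parametrized by [0, 1]. *)
Definition horizontal (g : R -> H) (a b : R -> 'rV[R]_n) :=
  abs_continuous 0 1 g /\
  {ae lebesgue_measure, forall s : R, 0 < s < 1 ->
    is_derive s 1 g
      (\sum_(i < n) (a s 0 i *: hX i (g s) + b s 0 i *: hY i (g s)))}.

Definition hlength (a b : R -> 'rV[R]_n) : \bar R :=
  \int[lebesgue_measure]_(s in `[0, 1]) (hnorm (a s, b s))%:E.

Definition ccdist xi zeta : \bar R :=
  ereal_inf [set l | exists g a b,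
    [/\ horizontal g a b, g 0 = xi, g 1 = zeta & l = hlength a b]].

Definition ccnorm xi : \bar R := ccdist xi 0.

Definition boundary D : set H := closure D `\` D°.

Definition bdist D xi : \bar R :=
  ereal_inf [set ccnorm (hmul (hinv zeta) xi) | zeta in boundary D].

(* All iterated directional derivatives exist and are continuous. *)
Definition smooth u := forall vs : seq H,
  let w := foldr (fun v f xi => 'D_v f xi) u vs in
  continuous w /\ forall xi v, derivable w xi v.

Definition tsupport u : set H := closure [set xi | u xi != 0].

Definition Ccinfty D u :=
  [/\ smooth u, compact (tsupport u) & tsupport u `<=` D].

Definition domain D := [/\ open D, connected D & D !=set0].

Definition half_space D := exists (a b : 'rV[R]_n) (c k : R),
  (a, b, c) != 0 /\
  D = [set xi | k < dotv a xi.1.1 + dotv b xi.1.2 + c * xi.2].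

(* The quotient is taken in the extended reals: [r%:E / 0 = +oo] for [r > 0],
   so a vanishing distance is not discarded. *)
Definition hardy (p : R) D (C : R) := forall u, Ccinfty D u ->
  (C%:E * \int[volume]_(xi in D) ((`|u xi| `^ p)%:E / bdist D xi `^ p) <=
   \int[volume]_(xi in D) (hnorm (hgrad u xi) `^ p)%:E)%E.

End heisenberg.

(* Main.v *)
Require Import Defs.
From HB Require Import structures.
From mathcomp Require Import all_boot all_order all_algebra.
From mathcomp Require Import all_classical all_reals all_analysis.
From mathcomp Require Import measurable_realfun.
From mathcomp Require Import ring lra.

Set Implicit Arguments.
Unset Strict Implicit.
Unset Printing Implicit Defensive.

Import Order.TTheory GRing.Theory Num.Theory.
Import numFieldNormedType.Exports.

Local Open Scope classical_set_scope.
Local Open Scope ring_scope.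

(** Let N be the horizontal gradient of an affine function l with half-space
    {l > 0}.  For c <> 0, regularise the distance to {l = 0} by
    delta = sqrt (Q (1 + v^2)) atan v, with T = l / |c|,
    Q = |N|^2 / (4 c^2) + eps^2 and T = Q ((1 + v^2) atan v + v).  Then
    |grad_H delta|^2 = 1 - eps^2 / Q <= 1 and - delta (sub-Laplacian delta) >= 0
    in the half-space, so delta is a supersolution and, acting as a calibration
    along horizontal curves, a lower bound for Carnot-Caratheodory distances.

    For finitely many half-spaces containing D, with functions d_i, the field
    V = S^(-r) sum_i d_i^(-q-1) grad_H d_i, with S = sum_i d_i^(-q) and
    r = (q + 2 - p) / q, satisfies |V| <= S^((p-1)/q) and
    - div V >= (p - 1) (1 - eta) (number of half-spaces)^(-2/q) S^(p/q), by
    Cauchy-Schwarz.  Integrating div (|u|^p V) and using Young's inequality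
    bounds int |u|^p / (min_i d_i)^p as q tends to infinity.  A bounded convex D
    is approximated by a countable family of half-spaces, separating D from a
    dense sequence of exterior points.

    For the sharpness, l / |N| dominates the distance to the boundary, since
    a horizontal line of that length reaches the hyperplane.  For test functions F(l) psi, with F a
    regularisation at scale s of r^((p-1)/p) and psi a cut-off invariant in a
    direction w transversal to {l = 0} along which N is constant, the measure
    |N|^p psi^p d xi is translation invariant in the variable l; counting dyadic
    strips shows that both sides diverge like log (1 / s), with ratio
    tending to ((p - 1) / p)^p. *)

(** * Lebesgue measure and horizontal integration by parts *)

(** For c <> 0, N vanishes exactly on a vertical line. A left translation moves that line to the
    t-axis and the hyperplane to {t = 0}; then |T| is the height and |N| / (2 |c|) the distance to
    the axis in the variables (x, y). Rotational symmetry forces a C^1 candidate to have zero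
    horizontal gradient on the axis, so the exact distance, whose gradient has length one elsewhere,
    is not smooth there: this is what eps repairs. The price is the loss eps^2 / Q in |grad_H
    delta|^2. Where it exceeds eta, Q is so small that v is large, and the strict positivity of -
    delta (sub-Laplacian delta) pays for it. Hence on a compact support every barrier satisfies - d
    (sub-Laplacian d) + (p - 1) |grad_H d|^2 >= (p - 1) (1 - eta), and this inequality drives the
    whole estimate.

    A minimum of barriers is not differentiable; S^(-1/q) is its smooth substitute. The loss (number
    of half-spaces)^(-2/q) is removed by letting q depend on that number, so the constant survives
    the passage to countably many half-spaces. *)

Section volume_theory.
Context {R : realType}.

(** By disintegration along the first factor: the section at [x] of the preimage is the preimage
    under [g x] of the section at [f x], so invariance of [m2] removes [g] and invariance of [m1]
    removes [f]. Skew maps are allowed because the flows of the horizontal fields shift t by an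
    amount depending on x and y. *)
Lemma product_measure_skew d1 d2 (T1 : measurableType d1)
    (T2 : measurableType d2) (m1 : {measure set T1 -> \bar R})
    (m2 : {sigma_finite_measure set T2 -> \bar R})
    (f : T1 -> T1) (g : T1 -> T2 -> T2) :
  measurable_fun setT f -> measurable_fun setT (fun z => g z.1 z.2) ->
  (forall A, measurable A -> m1 (f @^-1` A) = m1 A) ->
  (forall x A, measurable A -> m2 (g x @^-1` A) = m2 A) ->
  forall A, measurable A ->
    (m1 \x m2)%E ((fun z => (f z.1, g z.1 z.2)) @^-1` A) = (m1 \x m2)%E A.
Proof.
move=> mf mg fm1 gm2 A mA; rewrite /product_measure1 /=.
transitivity (\int[m1]_x (m2 (xsection A (f x))))%E.
  apply: eq_integral => x _ /=.
  rewrite -(gm2 x (xsection A (f x))); last exact: measurable_xsection.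
  congr (m2 _); apply/seteqP; split => y /=; by rewrite /xsection /= !inE.
have mxs : measurable_fun setT (fun x => m2 (xsection A x)).
  exact: measurable_fun_xsection.
have -> : (\int[m1]_x (m2 (xsection A (f x))) =
    \int[m1]_(x in f @^-1` setT) ((fun x => m2 (xsection A x)) \o f) x)%E.
  by rewrite preimage_setT.
rewrite -(ge0_integral_pushforward mf)//.
by apply: eq_measure_integral => B mB _; exact: fm1.
Qed.

Lemma lebesgue_measureD (h : R) (A : set (measurableTypeR R)) : measurable A ->
  lebesgue_measure ((fun x : measurableTypeR R => x + h) @^-1` A) =
  lebesgue_measure A.
Proof.
move=> mA.
have mh : measurable_fun setT (fun x : measurableTypeR R => (x + h : measurableTypeR R)).
  exact: measurable_funD.
pose mixin := isMeasurableFun.Build _ _ _ _ _ mh.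
pose mh' : {mfun _ >-> _} := HB.pack (fun x : measurableTypeR R => (x + h : measurableTypeR R)) mixin.
have /= H := @lebesgue_measure_unique R (pushforward lebesgue_measure mh').
rewrite [RHS]H// => _ [[a b]] _ <-.
rewrite /pushforward/=.
rewrite (_ : _ @^-1` _ = `]a - h, b - h]%classic); last first.
  by apply/seteqP; split => x /=; rewrite !in_itv/= ltrBlDr lerBrDr.
by rewrite !lebesgue_measure_itv/= !lte_fin ltrD2r -!EFinB opprB addrA subrK.
Qed.

Lemma measurable_addrV n (v : 'rV[R]_n) :
  measurable_fun setT (fun x : 'rV[R]_n => x + v).
Proof.
apply: measurable_fun_rV => i; under eq_fun do rewrite mxE.
by apply: measurable_funD => //; exact: measurable_coord.
Qed.

Lemma lebesgue_rVD n (v : 'rV[R]_n) (A : set 'rV[R]_n) : measurable A ->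
  lebesgue_rV n ((fun x => x + v) @^-1` A) = lebesgue_rV n A.
Proof.
elim: n v A => [v A _|n IHn v A mA].
  congr (lebesgue_rV 0 _); apply/seteqP; split => x /=;
  by rewrite (_ : x + v = x)//; apply/rowP; case.
rewrite /= /cons_measure /pushforward.
pose w : 'rV[R]_n := \row_j v 0 (lift ord0 j).
have -> : @consrV R n @^-1` ((fun x => x + v) @^-1` A) =
  (fun z : measurableTypeR R * 'rV[R]_n => ((z.1 + v 0 0 : measurableTypeR R), z.2 + w)) @^-1`
    (@consrV R n @^-1` A).
  rewrite -comp_preimage -[RHS]comp_preimage.
  congr (_ @^-1` A); apply/funext => z /=; apply/rowP => i; rewrite mxE.
  case: (unliftP ord0 i) => [j|] ->.
    by rewrite !consrVr !mxE.
  by rewrite !consrVl.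
have := @product_measure_skew _ _ _ _ (@lebesgue_measure R) (lebesgue_rV n)
  (fun x : measurableTypeR R => (x + v 0 0 : measurableTypeR R))
  (fun=> (fun y => y + w)).
apply.
- exact: measurable_funD.
- exact: (measurableT_comp (measurable_addrV w) measurable_snd).
- by move=> B mB; exact: lebesgue_measureD.
- by move=> _ B mB; exact: IHn.
- by rewrite -[X in measurable X]setTI; exact: measurable_consrV.
Qed.

End volume_theory.

Notation heism R n := ('rV[R]_n * 'rV[R]_n * measurableTypeR R)%type.

Section volume_heis.
Context {R : realType} {n : nat}.
Local Notation H := (heis R n).
Local Notation HM := (heism R n).

(** Covers both kinds of motions used later: the flows of the horizontal fields, with [phi] linear,
    and Euclidean translations, with [phi] constant. *)
Lemma volume_shear (a b : 'rV[R]_n) (phi : 'rV[R]_n * 'rV[R]_n -> R) :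
  measurable_fun setT phi -> forall A : set HM, measurable A ->
  volume ((fun z : HM => (z.1.1 + a, z.1.2 + b, (z.2 + phi z.1 : measurableTypeR R))) @^-1` A) =
  volume A.
Proof.
move=> mphi A mA; rewrite /volume.
apply: (@product_measure_skew R _ _ _ _ (@lebesgue_rV R n \x @lebesgue_rV R n)%E (@lebesgue_measure R)
  (fun z : 'rV[R]_n * 'rV[R]_n => (z.1 + a, z.2 + b)) 
  (fun z => (fun t : measurableTypeR R => (t + phi z : measurableTypeR R)))).
- apply: measurable_fun_pair => /=.
  + exact: (measurableT_comp (measurable_addrV a) measurable_fst).
  + exact: (measurableT_comp (measurable_addrV b) measurable_snd).
- apply: measurable_funD => //.
  exact: (measurableT_comp mphi measurable_fst).
- move=> B mB; apply: (@product_measure_skew R _ _ _ _ (lebesgue_rV n) (lebesgue_rV n)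
    (fun x => x + a) (fun=> (fun y => y + b))) => //.
  + exact: measurable_addrV.
  + exact: (measurableT_comp (measurable_addrV b) measurable_snd).
  + by move=> C mC; exact: lebesgue_rVD.
  + by move=> _ C mC; exact: lebesgue_rVD.
- by move=> z B mB; exact: lebesgue_measureD.
- by [].
Qed.

(** A countable dense set, used to write open sets as countable unions of balls and, for a convex
    domain, to enumerate exterior points. *)
Definition rat_point (q : 'rV[rat]_n * 'rV[rat]_n * rat) : H :=
  (map_mx ratr q.1.1, map_mx ratr q.1.2, ratr q.2).

Lemma rat_approx (x e : R) : 0 < e -> exists q : rat, `|x - ratr q| < e.
Proof.
move=> e0; have xe : x - e < x + e by lra.
have [q] := rat_in_itvoo xe; rewrite in_itv/= => /andP[q1 q2].
by exists q; rewrite ltr_norml; lra.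
Qed.

Lemma rat_approx_rV (x : 'rV[R]_n) (e : R) : 0 < e ->
  exists q : 'rV[rat]_n, ball x e (map_mx ratr q).
Proof.
move=> e0; have H i : exists q : rat, `|x 0 i - ratr q| < e by exact: rat_approx.
pose q : 'rV[rat]_n := \row_i sval (cid (H i)).
exists q; split => // i j; rewrite !mxE ord1 /=.
exact: svalP (cid (H j)).
Qed.

Lemma rat_point_dense (xi : H) (e : R) : 0 < e -> exists q, ball xi e (rat_point q).
Proof.
case: xi => [[x y] t] e0.
have [qx hx] := rat_approx_rV x e0; have [qy hy] := rat_approx_rV y e0.
have [qt ht] := rat_approx t e0.
by exists (qx, qy, qt); split => //; split.
Qed.

Lemma measurable_ball_rV (x : 'rV[R]_n) (e : R) : measurable (ball x e).
Proof.
have [e0|e0] := ltP 0 e; last first.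
  rewrite (_ : ball x e = set0)//; apply/seteqP; split => // y /=.
  by case=> /lt_geF; rewrite e0.
rewrite (_ : ball x e = [set v | forall i, (ball (x 0 i) e : set R) (v 0 i)]).
  by apply: (@measurable_box R n (fun i => ball (x 0 i) e)) => i; exact: measurable_ball.
apply/seteqP; split => v /=; first by move=> [_ xv] i; exact: xv.
by move=> xv; split => // i j; rewrite ord1.
Qed.

Lemma measurable_ball_heis (xi : H) (e : R) : measurable (ball xi e : set HM).
Proof.
case: xi => [[x y] t].
rewrite (_ : ball _ e = (ball x e `*` ball y e) `*` ball t e); last first.
  by apply/seteqP; split => -[[? ?] ?] /=; [move=> [[? ?] ?]|move=> [[? ?] ?]].
apply: measurableX; first by apply: measurableX; exact: measurable_ball_rV.
exact: measurable_ball.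
Qed.

(** Measurability refers to the product sigma-algebra; an open set is the union of those balls with
    centre in [rat_point] and radius 1 / (k + 1) that it contains, and such balls are products of
    intervals. *)
Lemma open_measurable_heis (U : set H) : open U -> measurable (U : set HM).
Proof.
move=> oU.
pose I := ('rV[rat]_n * 'rV[rat]_n * rat * nat)%type.
pose B (i : I) : set HM := ball (rat_point i.1) (i.2.+1%:R^-1).
have -> : U = \bigcup_(i in [set i : I | B i `<=` U]) B i.
  apply/seteqP; split => [xi Uxi|xi [i /= BU Bi]]; last exact: BU.
  have /nbhs_ballP[e /= e0 eU] := open_nbhs_nbhs (conj oU Uxi).
  have [k hk] : exists k : nat, k.+1%:R^-1 < e / 2.
    exists (Num.truncn (2 / e)).
    rewrite invf_plt ?posrE//; last by rewrite divr_gt0.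
    by rewrite invf_div; exact: truncnS_gt.
  have k0 : 0 < k.+1%:R^-1 :> R by [].
  have [q qxi] := rat_point_dense xi k0.
  exists (q, k); last exact: ball_sym.
  move=> z /= qz; apply: eU; apply: (@le_ball _ _ _ (k.+1%:R^-1 + k.+1%:R^-1)); first by move: hk; set r := _^-1; lra.
  exact: ball_triangle qxi qz.
rewrite bigcup_mkcond; apply: (@countable_bigcupT_measurable _ _ I) => [|i].
  exact: countableP.
by case: ifPn => // _; exact: measurable_ball_heis.
Qed.

Lemma continuous_measurable_heis (f : H -> R) : continuous f ->
  measurable_fun setT (f : HM -> R).
Proof.
move=> cf; apply: (measurability _ (RGenOInfty.measurableE R)).
move=> /= _ [_ [a ->]] <-; rewrite setTI; apply: open_measurable_heis.
by move/continuousP : cf; apply; rewrite set_itv_o_infty; exact: open_gt.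
Qed.

End volume_heis.

Section heis_topology.
Context {R : realType} {n : nat}.
Local Notation H := (heis R n).

Lemma rV_norm_le (v : 'rV[R]_n) (M : R) : 0 <= M ->
  (`|v| <= M) <-> (forall i, `|v 0 i| <= M).
Proof.
move=> M0; rewrite /Num.norm/= mx_normrE; split.
  move=> vM i; apply: le_trans vM.
  by rewrite (le_bigmax _ (fun ij => `|v ij.1 ij.2|) (0, i)).
move=> vM; apply: bigmax_le => // -[i j] _ /=; rewrite ord1; exact: vM.
Qed.

Lemma rV_coord_le (v : 'rV[R]_n) i : `|v 0 i| <= `|v|.
Proof. by have /rV_norm_le := lexx `|v|; apply. Qed.

Lemma heis_norm_le (xi : H) (M : R) :
  (`|xi| <= M) = [&& `|xi.1.1| <= M, `|xi.1.2| <= M & `|xi.2| <= M].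
Proof. by rewrite !prod_normE !ge_max andbA. Qed.

Lemma compact_heis_box (M : R) : compact [set xi : H | `|xi| <= M].
Proof.
have cb : compact [set x : 'rV[R]_n | `|x| <= M].
  apply: bounded_closed_compact.
    by exists M; split; [exact: num_real|move=> r Mr x /= xM; exact: le_trans xM (ltW Mr)].
  have := @closed_le R M => /(@closed_comp _ _ (fun x : 'rV[R]_n => `|x|)); apply.
  by move=> x _; exact: norm_continuous.
have cR : compact [set t : R | `|t| <= M].
  rewrite (_ : [set _ | _] = `[- M, M]%classic); first exact: segment_compact.
  by apply/seteqP; split => x /=; rewrite in_itv/= ler_norml.
rewrite (_ : [set _ | _] = ([set x : 'rV[R]_n | `|x| <= M] `*` [set x : 'rV[R]_n | `|x| <= M])
   `*` [set t : R | `|t| <= M]).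
  by apply: compact_setX => //; exact: compact_setX.
apply/seteqP; split => xi /=; rewrite heis_norm_le; first by move=> /and3P[].
by move=> [[-> ->] ->].
Qed.

Lemma continuous_bounded (f : H -> R) (M : R) : continuous f ->
  exists2 C, 0 <= C & forall xi : H, `|xi| <= M -> `|f xi| <= C.
Proof.
move=> cf.
have : compact [set f xi | xi in [set xi : H | `|xi| <= M]].
  apply: continuous_compact; last exact: compact_heis_box.
  exact: continuous_subspaceT.
move/compact_bounded => -[C [_ hC]].
exists (`|C| + 1) => // xi xiM.
by apply: (hC (`|C| + 1)); [rewrite ltr_pwDr// ler_norm|exists xi].
Qed.

Lemma volume_box_fin (M : R) :
  (volume ([set xi : H | (`|xi| <= M)%R] : set (heism R n)) < +oo)%E.
Proof.
have [M0|M0] := ltP M 0.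
  rewrite (_ : [set _ | _] = set0) ?measure0//.
  by apply/seteqP; split => x //= xM; have := le_lt_trans (le_trans (normr_ge0 _) xM) M0; rewrite ltxx.
have mb : measurable (`[- M, M]%classic : set R) by [].
pose B : set 'rV[R]_n := [set v | forall i : 'I_n, (`[- M, M]%classic : set R) (v 0 i)].
have mB : measurable B by exact: (@measurable_box R n (fun=> `[- M, M]%classic)).
have lB : (lebesgue_rV n B < +oo)%E.
  rewrite (@lebesgue_rV_box R n (fun=> `[- M, M]%classic))//.
  rewrite -ge0_fin_numE; last by apply: prode_ge0 => i _; exact: measure_ge0.
  apply: prode_fin_num => i _.
  by rewrite lebesgue_measure_itv/=; case: ifP => // _.
rewrite (_ : [set _ | _] = (B `*` B `*` (`[- M, M]%classic : set (measurableTypeR R)))).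
  rewrite volume_box//.
  rewrite lte_mul_pinfty//.
  - by rewrite mule_ge0.
  - by rewrite ge0_fin_numE ?mule_ge0// lte_mul_pinfty// ge0_fin_numE.
  - by rewrite lebesgue_measure_itv/=; case: ifP => // _; rewrite -EFinB ltry.
apply/seteqP; split => -[[x y] t] /=; rewrite heis_norm_le/= /B/= in_itv/=.
  move=> /and3P[/rV_norm_le hx /rV_norm_le hy ht]; split; last by rewrite -ler_norml.
  by split => i; rewrite in_itv/= -ler_norml; [exact: hx|exact: hy].
move=> [[hx hy] ht]; rewrite ler_norml ht andbT.
by apply/andP; split; apply/rV_norm_le => // i; rewrite ler_norml; [have := hx i|have := hy i];
  rewrite in_itv.
Qed.

Lemma measurable_heis_box (M : R) : measurable ([set xi : H | `|xi| <= M] : set (heism R n)).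
Proof.
rewrite -[X in measurable X]setCK; apply: measurableC; apply: open_measurable_heis.
rewrite openC; have := @closed_le R M => /(@closed_comp _ _ (fun x : H => `|x|)); apply.
by move=> x _; exact: norm_continuous.
Qed.

Lemma integrable_compact_support (f : H -> R) (M : R) : continuous f ->
  (forall xi : H, M < `|xi| -> f xi = 0) ->
  volume.-integrable [set: heism R n] (EFin \o f).
Proof.
move=> cf f0.
have -> : EFin \o f = (EFin \o f) \_ [set xi : H | `|xi| <= M].
  apply/funext => xi; rewrite patchE; case: ifPn => //.
  by rewrite notin_setE/= => /negP; rewrite -ltNge => /f0 ->.
apply/(@integrable_mkcond _ _ _ _ _ (EFin \o (f : heism R n -> R)) (measurable_heis_box M)).
apply: measurable_bounded_integrable => //.
- exact: measurable_heis_box.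
- exact: volume_box_fin.
- by apply: measurable_funTS; exact: continuous_measurable_heis.
- have [C C0 hC] := continuous_bounded M cf.
  exists C; split; first exact: num_real.
  by move=> r Cr xi /= /hC /le_trans; apply; exact: ltW.
Qed.

End heis_topology.

Section horizontal_derivatives.
Context {R : realType} {n : nat}.
Local Notation H := (heis R n).

(** One finite index type for the fields X_i ([true]) and Y_i ([false]), so that gradients,
    divergences and Cauchy-Schwarz are single sums. *)
Definition hE (e : 'I_n * bool) (xi : H) : H :=
  if e.2 then hX e.1 xi else hY e.1 xi.

(** The t-component of X_i depends on y_i only and that of Y_i on x_i only, which do not change
    along the field itself. Hence the integral curves are straight lines, and derivatives along them
    are ordinary one-variable derivatives. *)
Lemma hE_line e (xi : H) (s : R) : hE e (xi + s *: hE e xi) = hE e xi.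
Proof.
case: e xi => [i []] [[x y] t]; rewrite /hE /hX /hY /=; congr (_, _, _);
by rewrite !mxE mulr0 addr0.
Qed.

Lemma is_derive_line (V : normedModType R) (f : V -> R) (xi v : V) (s df : R) :
  is_derive (xi + s *: v) v f df <-> is_derive s 1 (fun r => f (xi + r *: v)) df.
Proof.
have E : (fun h : R => h^-1 *: ((f \o shift (xi + s *: v)) (h *: v) - f (xi + s *: v))) =
  (fun h : R => h^-1 *: (((fun r : R => f (xi + r *: v)) \o shift s) (h *: (1 : R)) - f (xi + s *: v))).
  apply/funext => h /=; rewrite /shift/=; congr (_ *: (f _ - _)).
  by rewrite scalerDl [h *: 1]mulr1 addrCA.
by split => -[d1 d2]; split; [move: d1|move: d2|move: d1|move: d2];
  rewrite /derivable /derive E.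
Qed.

Lemma is_derive_line0 (V : normedModType R) (f : V -> R) (xi v : V) (df : R) :
  is_derive xi v f df <-> is_derive (0 : R) 1 (fun r => f (xi + r *: v)) df.
Proof. by rewrite -is_derive_line scale0r addr0. Qed.

Lemma is_derive_hE_line e (f f' : H -> R) (xi : H) :
  (forall xi, is_derive xi (hE e xi) f (f' xi)) ->
  forall s : R, is_derive s 1 (fun r : R => f (xi + r *: hE e xi)) (f' (xi + s *: hE e xi)).
Proof.
move=> df s; apply/(is_derive_line f xi (hE e xi) s).
by have := df (xi + s *: hE e xi); rewrite hE_line.
Qed.

Lemma hE_norm e (xi : H) : `|hE e xi| <= 1 + 2 * `|xi|.
Proof.
have d1 i : `|delta_mx 0 i : 'rV[R]_n| <= 1.
  apply/rV_norm_le => // j; rewrite mxE.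
  by case: (_ && _) => /=; rewrite ?normr1// normr0.
have x0 := normr_ge0 xi.
have /and3P[h1 h2 h3] : [&& `|xi.1.1| <= `|xi|, `|xi.1.2| <= `|xi| & `|xi.2| <= `|xi|].
  by rewrite -heis_norm_le.
rewrite /hE; case: e.2; rewrite heis_norm_le /= ?normrN normrM normr0;
  rewrite (le_trans (d1 _)) ?lerDl ?mulr_ge0// (ger0_norm (_ : 0 <= 2)) //=;
  rewrite addr_ge0 ?mulr_ge0//=.
- apply: (@le_trans _ _ (2 * `|xi|)); last by lra.
  by rewrite ler_pM2l// (le_trans _ h2)// rV_coord_le.
- apply: (@le_trans _ _ (2 * `|xi|)); last by lra.
  by rewrite ler_pM2l// (le_trans _ h1)// rV_coord_le.
Qed.

(** Flowing back from the endpoint with the same field expands norms at most linearly; so a shifted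
    function still vanishes outside a fixed box. *)
Lemma hE_line_norm e (xi : H) (s : R) : `|s| <= 1 ->
  `|xi| <= 1 + 3 * `|xi + s *: hE e xi|.
Proof.
move=> s1; set z := xi + _.
have -> : xi = z - s *: hE e z by rewrite /z hE_line addrK.
have := ler_normB z (s *: hE e z); rewrite normrZ.
have := hE_norm e z; set N := `|z|; set Q := `|hE e z|.
have N0 : 0 <= N by exact: normr_ge0.
have Q0 : 0 <= Q by exact: normr_ge0.
have := ler_wpM2r Q0 s1; rewrite mul1r.
move=> h1 h2 h3; lra.
Qed.

Lemma hE_shear e (s : R) : exists a b : 'rV[R]_n, exists2 phi : 'rV[R]_n * 'rV[R]_n -> R,
  measurable_fun setT phi &
  forall xi : H, xi + s *: hE e xi = (xi.1.1 + a, xi.1.2 + b, xi.2 + phi xi.1).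
Proof.
case: e => i [].
- exists (s *: delta_mx 0 i), 0, (fun z : 'rV[R]_n * 'rV[R]_n => s * (2 * z.2 0 i)).
    apply: measurable_funM => //; apply: measurable_funM => //.
    exact: (measurableT_comp (measurable_coord i) measurable_snd).
  by move=> [[x y] t]; rewrite /hE /hX /=; congr (_, _, _); rewrite /= ?scaler0.
- exists 0, (s *: delta_mx 0 i), (fun z : 'rV[R]_n * 'rV[R]_n => s * (- (2 * z.1 0 i))).
    apply: measurable_funM => //; apply: measurableT_comp => //; apply: measurable_funM => //.
    exact: (measurableT_comp (measurable_coord i) measurable_fst).
  by move=> [[x y] t]; rewrite /hE /hY /=; congr (_, _, _); rewrite /= ?scaler0.
Qed.

Lemma continuous_coordx i : continuous (fun xi : H => xi.1.1 0 i).
Proof.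
move=> xi; apply: (@continuous_comp _ _ _ (fun xi : H => xi.1.1) (fun v : 'rV[R]_n => v 0 i)).
  by apply: continuous_comp; exact: cvg_fst.
exact: coord_continuous.
Qed.

Lemma continuous_coordy i : continuous (fun xi : H => xi.1.2 0 i).
Proof.
move=> xi; apply: (@continuous_comp _ _ _ (fun xi : H => xi.1.2) (fun v : 'rV[R]_n => v 0 i)).
  by apply: continuous_comp; [exact: cvg_fst|exact: cvg_snd].
exact: coord_continuous.
Qed.

Lemma continuous_coordt : continuous (fun xi : H => xi.2).
Proof. by move=> xi; exact: cvg_snd. Qed.

Lemma continuous_pair (T U V : topologicalType) (f : T -> U) (g : T -> V) (t : T) :
  {for t, continuous f} -> {for t, continuous g} ->
  {for t, continuous (fun x => (f x, g x))}.
Proof. by move=> cf cg; exact: (cvg_pair cf cg). Qed.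

Lemma continuous_hE e : continuous (hE e).
Proof.
case: e => i [] xi.
- change (continuous_at xi (fun z : H => ((delta_mx 0 i, 0), 2 * z.1.2 0 i) : H)).
  apply: (@continuous_pair _ _ _ (fun _ : H => (delta_mx 0 i, 0) : 'rV[R]_n * 'rV[R]_n) (fun z : H => 2 * z.1.2 0 i)).
    exact: cvg_cst.
  by apply: cvgM; [exact: cvg_cst|exact: continuous_coordy].
- change (continuous_at xi (fun z : H => ((0, delta_mx 0 i), - (2 * z.1.1 0 i)) : H)).
  apply: (@continuous_pair _ _ _ (fun _ : H => (0, delta_mx 0 i) : 'rV[R]_n * 'rV[R]_n) (fun z : H => - (2 * z.1.1 0 i))).
    exact: cvg_cst.
  by apply: cvgN; apply: cvgM; [exact: cvg_cst|exact: continuous_coordx].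
Qed.

Lemma continuous_hE_line e (s : R) : continuous (fun xi : H => xi + s *: hE e xi).
Proof.
move=> xi; apply: cvgD; first exact: cvg_id.
by apply: cvgZ; [exact: cvg_cst|exact: continuous_hE].
Qed.

Lemma continuous_comp_hE_line e (s : R) (f : H -> R) : continuous f ->
  continuous (fun xi : H => f (xi + s *: hE e xi)).
Proof.
move=> cf xi; apply: (@continuous_comp _ _ _ (fun xi : H => xi + s *: hE e xi) f).
  exact: continuous_hE_line.
exact: cf.
Qed.

Lemma integral_hE_shift e (s : R) (f : H -> R) (M : R) : continuous f ->
  (forall xi : H, M < `|xi| -> f xi = 0) -> `|s| <= 1 ->
  (\int[volume]_(xi in [set: heism R n]) (f (xi + s *: hE e xi))%:E =
   \int[volume]_(xi in [set: heism R n]) (f xi)%:E)%E.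
Proof.
move=> cf f0 s1; have [a [b [phi mphi E]]] := hE_shear e s.
pose Phi : heism R n -> heism R n :=
  fun z => (z.1.1 + a, z.1.2 + b, (z.2 + phi z.1 : measurableTypeR R)).
have mPhi : measurable_fun setT Phi.
  apply: measurable_fun_pair => /=; last first.
    by apply: measurable_funD => //; exact: (measurableT_comp mphi measurable_fst).
  apply: measurable_fun_pair => /=.
    apply: (measurableT_comp (measurable_addrV a)).
    exact: (measurableT_comp measurable_fst measurable_fst).
  apply: (measurableT_comp (measurable_addrV b)).
  exact: (measurableT_comp measurable_snd measurable_fst).
have fE : (fun xi : heism R n => (f (xi + s *: hE e xi))%:E) = (EFin \o f) \o Phi.
  by apply/funext => xi /=; rewrite E.
transitivity (\int[pushforward volume Phi]_(y in setT) (EFin \o f) y)%E; last first.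
  by apply: eq_measure_integral => A mA _; exact: volume_shear.
rewrite (integral_pushforward mPhi)//.
- by rewrite preimage_setT -fE.
- by apply/measurable_EFinP; exact: continuous_measurable_heis.
- rewrite preimage_setT -fE.
  apply: (@integrable_compact_support R n (fun xi : H => f (xi + s *: hE e xi)) (1 + 3 * M)).
    exact: continuous_comp_hE_line.
  move=> xi Mxi; apply: f0; have := hE_line_norm e xi s1; lra.
Qed.

(** The difference quotients along the flow have integral zero because the flow preserves volume.
    The mean value theorem bounds them by a constant on a fixed box, so dominated convergence passes
    to the derivative. *)
Theorem integral_hE_eq0 e (f f' : H -> R) (M : R) :
  continuous f -> continuous f' ->
  (forall xi : H, M < `|xi| -> f xi = 0) ->
  (forall xi, is_derive xi (hE e xi) f (f' xi)) ->
  (\int[volume]_(xi in [set: heism R n]) (f' xi)%:E = 0)%E.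
Proof.
move=> cf cf' f0 df.
pose h (k : nat) : R := k.+1%:R^-1.
have h0 k : 0 < h k by rewrite invr_gt0.
have h1 k : `|h k| <= 1 by rewrite gtr0_norm// invf_le1// ler1n.
pose F k (xi : H) : R := (h k)^-1 * (f (xi + h k *: hE e xi) - f xi).
have cfl k := continuous_comp_hE_line cf (e := e) (s := h k).
have cF k : continuous (F k).
  by move=> xi; apply: cvgM; [exact: cvg_cst|apply: cvgB; [exact: cfl|exact: cf]].
have f'0 xi : M < `|xi| -> f' xi = 0.
  move=> Mxi; have [_ <-] := df xi.
  have : \forall z \near xi, f z = 0.
    have : \forall z \near xi, M < `|z|.
      by have /cvgr_gt := @norm_continuous _ _ xi; apply.
    by apply: filterS => z; exact: f0.
  move=> nf; have [->|v0] := eqVneq (hE e xi) 0; first by rewrite derive0.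
  have -> : 'D_(hE e xi) f xi = 'D_(hE e xi) (cst 0) xi by exact: near_eq_derive.
  exact: derive_cst.
have [C C0 hC] := continuous_bounded (2 * `|M| + 1 + (1 + 3 * `|M|) * 3) cf'.
have dF k xi : `|F k xi| <= C.
  have [c _ hc] : exists2 c, c \in `]0, h k[ &
      f (xi + h k *: hE e xi) - f (xi + 0 *: hE e xi) = f' (xi + c *: hE e xi) * (h k - 0).
    apply: (@MVT R (fun r => f (xi + r *: hE e xi)) (fun r => f' (xi + r *: hE e xi))) => //.
      by move=> x _; exact: is_derive_hE_line.
    apply: continuous_subspaceT => x.
    apply: differentiable_continuous; apply/derivable1_diffP.
    by have [] := @is_derive_hE_line e f f' xi df x.
  move: hc; rewrite scale0r addr0 subr0 /F => ->.
  rewrite mulrCA mulVf ?mulr1 ?gt_eqF//.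
  set z := xi + _; have [zM|zM] := leP `|z| `|M|.
    by apply: hC; have := normr_ge0 M; lra.
  by rewrite f'0 ?normr0//; apply: le_lt_trans zM; exact: ler_norm.
have F0 k xi : 1 + 3 * `|M| < `|xi| -> F k xi = 0.
  move=> Mxi; rewrite /F !f0 ?subrr ?mulr0//.
    apply: le_lt_trans (ler_norm M) _; have := normr_ge0 M; lra.
  apply: le_lt_trans (ler_norm M) _; have := hE_line_norm e xi (h1 k); lra.
pose g : heism R n -> \bar R := EFin \o (cst C) \_ [set xi : H | `|xi| <= 1 + 3 * `|M|].
have := @dominated_convergence _ _ R (@volume R n) setT measurableT
  (fun k xi => (F k xi)%:E) (fun xi => (f' xi)%:E) g.
case.
- by move=> k; apply/measurable_EFinP; exact: continuous_measurable_heis.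
- by apply/measurable_EFinP; exact: continuous_measurable_heis.
- apply: aeW => xi _; apply: cvg_EFin; first exact: nearW.
  have [d1 d2] := df xi; rewrite -d2.
  move: d1; rewrite /derivable /derive => /cvg_ex[/= l cl].
  have lE := cvg_lim (@Rhausdorff R) cl; rewrite lE.
  have hh : h @ \oo --> (0 : R)^'.
    move=> P /= nP.
    have hP : \forall k \near \oo, h k != 0 -> P (h k) by exact: (@cvg_harmonic R _ nP).
    have : \forall k \near \oo, P (h k).
      by apply: filterS hP => k; apply; rewrite gt_eqF// h0.
    exact.
  have := cvg_comp _ _ hh cl.
  rewrite (_ : _ \o h = fine \o (fun k => (F k xi)%:E))//.
  apply/funext => k /=; rewrite /F; congr (_ * (f _ - _)); exact: addrC.
- rewrite /g (_ : EFin \o _ = (EFin \o cst C) \_ [set xi : H | `|xi| <= 1 + 3 * `|M|]).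
    apply/(@integrable_mkcond _ (heism R n) _ _ _ (EFin \o cst C) (measurable_heis_box (1 + 3 * `|M|))).
    apply: measurable_bounded_integrable => //.
    - exact: measurable_heis_box.
    - exact: volume_box_fin.
    - by exists C; split; [exact: num_real|move=> r Cr x _ /=; rewrite ger0_norm// ltW].
  by apply/funext => x; rewrite /= !patchE; case: ifP.
- apply: aeW => xi k _; rewrite /g /= lee_fin patchE; case: ifPn => // .
  by rewrite notin_setE/= => /negP; rewrite -ltNge => /F0 ->; rewrite normr0.
- move=> _ _; rewrite (_ : [sequence _]_k = cst 0%E).
    by move=> /cvg_lim <-//; rewrite lim_cst.
  apply/funext => k /=.
  have M13 : 1 + 3 * `|M| >= M by have := ler_norm M; have := normr_ge0 M; lra.
  have i1 : volume.-integrable [set: heism R n] (EFin \o f) by exact: integrable_compact_support f0.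
  have i2 : volume.-integrable [set: heism R n] (EFin \o (fun xi : H => f (xi + h k *: hE e xi))).
    apply: (@integrable_compact_support R n _ (1 + 3 * `|M|)) => // xi Mxi; apply: f0.
    apply: le_lt_trans (ler_norm M) _; have := hE_line_norm e xi (h1 k); lra.
  under eq_integral do rewrite /F EFinM EFinB.
  rewrite integralZl//; last exact: integrableB.
  rewrite integralB_EFin//.
  rewrite (integral_hE_shift e cf f0 (h1 k)) subee ?mule0//.
  exact: integrable_fin_num.
Qed.

End horizontal_derivatives.

(** * The barrier function of a half-space *)

Section derive_rules.
Context {R : realType} {V : normedModType R}.
Implicit Types (f g : V -> R) (x v : V) (df dg : R).

(** Lets a derivative be built by the rules below and its value be normalised afterwards. *)
Lemma isd_eq f x v df df' : is_derive x v f df -> df = df' -> is_derive x v f df'.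
Proof. by move=> ? <-. Qed.

Lemma isd_add f g x v df dg : is_derive x v f df -> is_derive x v g dg ->
  is_derive x v (fun y => f y + g y) (df + dg).
Proof. by move=> hf hg; exact: is_deriveD. Qed.

Lemma isd_opp f x v df : is_derive x v f df -> is_derive x v (fun y => - f y) (- df).
Proof. by move=> hf; exact: is_deriveN. Qed.

Lemma isd_sub f g x v df dg : is_derive x v f df -> is_derive x v g dg ->
  is_derive x v (fun y => f y - g y) (df - dg).
Proof. by move=> hf hg; apply: isd_add => //; exact: isd_opp. Qed.

Lemma isd_cst (c : R) x v : is_derive x v (fun=> c) 0.
Proof. exact: is_derive_cst. Qed.

Lemma isd_mul f g x v df dg : is_derive x v f df -> is_derive x v g dg ->
  is_derive x v (fun y => f y * g y) (df * g x + f x * dg).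
Proof.
move=> hf hg; have h := is_deriveM hf hg.
apply: isd_eq h _.
by rewrite addrC [g x *: df]mulrC.
Qed.

Lemma isd_sqr f x v df : is_derive x v f df ->
  is_derive x v (fun y => f y ^+ 2) (2 * f x * df).
Proof.
move=> hf; apply: (@isd_eq _ _ _ (df * f x + f x * df)); last by ring.
by have := isd_mul hf hf.
Qed.

Lemma isd_sum (I : finType) (F : I -> V -> R) (dF : I -> R) x v :
  (forall i, is_derive x v (F i) (dF i)) ->
  is_derive x v (fun y => \sum_i F i y) (\sum_i dF i).
Proof.
move=> h; rewrite /index_enum; elim: (Finite.enum I) => [|i s IHs].
  by under eq_fun do rewrite big_nil; rewrite big_nil; exact: isd_cst.
by under eq_fun do rewrite big_cons; rewrite big_cons; exact: isd_add.
Qed.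

Lemma isd_comp (F : R -> R) f x v (dF df : R) : is_derive (f x) 1 F dF ->
  is_derive x v f df -> is_derive x v (fun y => F (f y)) (dF * df).
Proof.
move=> hF hf; apply/is_derive_line0; apply: (@is_derive1_comp R F (fun r => f (x + r *: v))).
  by rewrite scale0r addr0.
exact: (is_derive_line0 f x v df).1.
Qed.

Lemma isd_inv f x v df : f x != 0 -> is_derive x v f df ->
  is_derive x v (fun y => (f y)^-1) (- df / f x ^+ 2).
Proof.
move=> f0 hf; apply: (@isd_eq _ _ _ (- (f x) ^- 2 *: df)).
  split; first by apply: derivableV => //; case: hf.
  by rewrite deriveV//; case: hf => // _ ->.
by rewrite /GRing.scale /= mulrC mulrN mulNr.
Qed.

Lemma isd_div f g x v df dg : g x != 0 -> is_derive x v f df -> is_derive x v g dg ->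
  is_derive x v (fun y => f y / g y) ((df * g x - f x * dg) / g x ^+ 2).
Proof.
move=> g0 hf hg; apply: isd_eq (isd_mul hf (isd_inv g0 hg)) _.
by field.
Qed.

Lemma isd_sqrt f x v df : 0 < f x -> is_derive x v f df ->
  is_derive x v (fun y => Num.sqrt (f y)) (df / (2 * Num.sqrt (f x))).
Proof.
move=> f0 hf; apply: isd_eq (isd_comp (is_derive1_sqrt f0) hf) _.
by rewrite mulrC.
Qed.

Lemma isd_powR f x v df p : 0 < f x -> is_derive x v f df ->
  is_derive x v (fun y => f y `^ p) (p * f x `^ (p - 1) * df).
Proof. by move=> f0 hf; exact: isd_comp (is_derive1_powR p f0) hf. Qed.

Lemma isd_continuous (f : R -> R) (x df : R) : is_derive x 1 f df -> {for x, continuous f}.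
Proof.
by move=> [h _]; apply: differentiable_continuous; apply/derivable1_diffP.
Qed.

End derive_rules.

(** * The arc-length profile of the distance to a plane *)

Section profile.
Context {R : realType}.
Implicit Types (v t : R).

Lemma atan_ge0 v : 0 <= v -> 0 <= atan v.
Proof. by move=> v0; rewrite -(@atan0 R); exact: le_atan. Qed.

Lemma atan_gt0 v : 0 < v -> 0 < atan v.
Proof. by move=> v0; rewrite -(@atan0 R); exact: lt_atan. Qed.

Lemma atan_le v : 0 <= v -> atan v <= v.
Proof.
move=> v0; rewrite -subr_ge0.
have D (x : R) : is_derive x 1 (fun r : R => r - atan r) (1 - (1 + x ^+ 2)^-1).
  exact: isd_sub (is_derive_id x 1) (is_derive1_atan x).
suff : 0 - atan 0 <= v - atan v by rewrite atan0 subr0.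
apply: (@ger0_derive1_ndecr R (fun r => r - atan r) 0 v) => //.
- move=> x _; rewrite derive1E; have [_ ->] := D x.
  by rewrite subr_ge0 invf_le1 ?lerDl ?sqr_ge0// ltr_pwDl// sqr_ge0.
- apply: continuous_subspaceT => x; exact: isd_continuous (D x).
Qed.

Lemma mul_atan_ge0 v : 0 <= v * atan v.
Proof.
have [v0|v0] := leP 0 v; first by rewrite mulr_ge0// atan_ge0.
rewrite -mulrNN mulr_ge0//; first by rewrite oppr_ge0 ltW.
by rewrite -atanN atan_ge0// oppr_ge0 ltW.
Qed.

(* [v] is the tangent of the angle swept by the projected geodesic: a point at
   distance [rho] from the axis and height [rho^2 * prof v] is reached from the
   plane [t = 0] by an arc of length [rho * sqrt (1 + v^2) * atan v]. *)
Definition prof v : R := (1 + v ^+ 2) * atan v + v.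

Lemma is_derive_prof v : is_derive v 1 prof (2 * (1 + v * atan v)).
Proof.
have h : is_derive v 1 (fun r : R => 1 + r ^+ 2) (0 + 2 * v * 1).
  exact: isd_add (isd_cst 1 v 1) (isd_sqr (is_derive_id v 1)).
have ha : is_derive v 1 (@atan R) (1 + v ^+ 2)^-1 by exact: is_derive1_atan.
have hv : is_derive v 1 (@id R) 1 by exact: is_derive_id.
apply: isd_eq (isd_add (isd_mul h ha) hv) _.
have : 1 + v ^+ 2 != 0 by rewrite gt_eqF// ltr_pwDl// sqr_ge0.
by move=> ?; rewrite /=; field.
Qed.

Lemma prof_cont v : {for v, continuous prof}.
Proof. exact: isd_continuous (is_derive_prof v). Qed.

Lemma prof_lt : {homo prof : v w / v < w}.
Proof.
move=> v w vw.
apply: (@gtr0_derive1_incr R prof v w) => //; rewrite ?lexx ?ltW//.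
- move=> x _; rewrite derive1E; have [_ ->] := is_derive_prof x.
  by rewrite mulr_gt0// ltr_pwDl// mul_atan_ge0.
- by apply: continuous_subspaceT => x; exact: prof_cont.
Qed.

Lemma prof_le : {mono prof : v w / v <= w}.
Proof. exact: le_mono prof_lt. Qed.

Lemma prof0 : prof 0 = 0. Proof. by rewrite /prof atan0 mulr0 addr0. Qed.

Lemma profN v : prof (- v) = - prof v.
Proof. by rewrite /prof atanN sqrrN mulrN opprD. Qed.

Lemma prof_ge v : 0 <= v -> v <= prof v.
Proof. by move=> v0; rewrite /prof lerDr mulr_ge0 ?atan_ge0// addr_ge0// sqr_ge0. Qed.

Lemma prof_surj t : exists v, prof v == t.
Proof.
have t0 := normr_ge0 t; have h := prof_ge t0.
have [v _ <-] : exists2 v, v \in `[- `|t|, `|t|] & prof v = t.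
  apply: IVT; first by lra.
    by apply: continuous_subspaceT => x; exact: prof_cont.
  rewrite profN; have := ler_norm t; have := ler_norm (- t); rewrite normrN.
  by rewrite ge_min le_max => *; apply/andP; split; apply/orP; [left|right]; lra.
by exists v.
Qed.

Definition prof_inv t : R := xchoose (prof_surj t).

Lemma prof_invK : cancel prof_inv prof.
Proof. by move=> t; apply/eqP; exact: (xchooseP (prof_surj t)). Qed.

Lemma profK : cancel prof prof_inv.
Proof. by move=> v; apply: (inc_inj prof_le); rewrite prof_invK. Qed.

Lemma is_derive_prof_inv t :
  is_derive t 1 prof_inv (2 * (1 + prof_inv t * atan (prof_inv t)))^-1.
Proof.
rewrite -{1}[t]prof_invK; apply: (@is_derive_inverse R prof).
- by apply: filterE => x; exact: profK.
- by apply: filterE => x; exact: prof_cont.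
- exact: is_derive_prof.
- by rewrite gt_eqF// mulr_gt0// ltr_pwDl// mul_atan_ge0.
Qed.

Lemma prof_inv_le : {mono prof_inv : s t / s <= t}.
Proof. by move=> s t; rewrite -prof_le !prof_invK. Qed.

Lemma prof_inv0 : prof_inv 0 = 0.
Proof. by rewrite -{1}prof0 profK. Qed.

Lemma prof_inv_norm t : `|prof_inv t| <= `|t|.
Proof.
have [t0|t0] := leP 0 t.
  have v0 : 0 <= prof_inv t by rewrite -prof_inv0 prof_inv_le.
  by rewrite !ger0_norm// -[leRHS]prof_invK prof_ge.
have v0 : prof_inv t <= 0 by rewrite -prof_inv0 prof_inv_le ltW.
rewrite ler0_norm// ltr0_norm// -[in leRHS](prof_invK t) -profN.
by apply: prof_ge; rewrite oppr_ge0.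
Qed.

(** The length described at [prof], with [Q] for the squared distance to the axis and [T] for the
    height. It is differentiable in ([T], [Q]) as long as [Q] is positive. *)
Definition arc (T Q : R) : R :=
  let v := prof_inv (T / Q) in Num.sqrt (Q * (1 + v ^+ 2)) * atan v.

Section along.
Variables (V : normedModType R) (T Q : V -> R) (x w : V) (dT dQ : R).
Hypotheses (Q0 : 0 < Q x) (hT : is_derive x w T dT) (hQ : is_derive x w Q dQ).

Let v y := prof_inv (T y / Q y).
Let z y := Num.sqrt (Q y * (1 + v y ^+ 2)).
Let dv := (2 * (1 + v x * atan (v x)))^-1 * ((dT * Q x - T x * dQ) / Q x ^+ 2).

Let sq1 (r : R) : 0 < 1 + r ^+ 2. Proof. by rewrite ltr_pwDl// sqr_ge0. Qed.
Let P0 : 0 < 1 + v x * atan (v x). Proof. by rewrite ltr_pwDl// mul_atan_ge0. Qed.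

Let hv : is_derive x w v dv.
Proof.
apply: isd_comp; first exact: is_derive_prof_inv.
by apply: isd_div => //; rewrite gt_eqF.
Qed.

Let z0 : 0 < z x. Proof. by rewrite sqrtr_gt0 mulr_gt0. Qed.
Let zz : z x ^+ 2 = Q x * (1 + v x ^+ 2).
Proof. by rewrite sqr_sqrtr// mulr_ge0 ?ltW. Qed.

Let TE : T x = Q x * ((1 + v x ^+ 2) * atan (v x) + v x).
Proof. by rewrite -[_ + v x]/(prof (v x)) prof_invK mulrC divfK// gt_eqF. Qed.

Let hz : is_derive x w z ((dQ * (1 + v x ^+ 2) + Q x * (2 * v x * dv)) / (2 * z x)).
Proof.
apply: isd_sqrt; first exact: mulr_gt0.
apply: isd_mul => //; apply: isd_eq (isd_add (isd_cst 1 x w) (isd_sqr hv)) _.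
by rewrite add0r.
Qed.

(** The factor 1 + v atan v in the derivative of v cancels, leaving the partial derivatives 1 / (2
    z) in T and - v / (2 z) in Q. The space [V] is arbitrary because the rule is applied along
    horizontal fields, along curves and along segments in the (T, Q) plane. *)
Lemma is_derive_arc : is_derive x w (fun y => arc (T y) (Q y)) ((dT - v x * dQ) / (2 * z x)).
Proof.
have ha : is_derive x w (fun y => atan (v y)) ((1 + v x ^+ 2)^-1 * dv).
  by apply: isd_comp => //; exact: is_derive1_atan.
apply: isd_eq (isd_mul hz ha) _.
have z1 : z x != 0 by rewrite gt_eqF.
have P1 : 1 + v x * atan (v x) != 0 by rewrite gt_eqF.
have Q1 : Q x != 0 by rewrite gt_eqF.
have s1 : 1 + v x ^+ 2 != 0 by rewrite gt_eqF.
(* Makes z appear squared in the numerator, where it can be replaced by Q (1 + v^2). *)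
have -> : z x * ((1 + v x ^+ 2)^-1 * dv) = (2 * (z x ^+ 2) * (1 + v x ^+ 2)^-1 * dv) / (2 * z x).
  by field; rewrite z1 s1.
rewrite zz /dv TE.
by field; rewrite z1 P1 Q1 s1.
Qed.

(** [T1] and [Q1] play the first derivatives of T and Q as functions, so this is the second
    derivative of the arc in direction [w]. *)
Lemma is_derive2_arc (T1 Q1 : V -> R) (ddT ddQ : R) :
  is_derive x w T1 ddT -> is_derive x w Q1 ddQ -> T1 x = dT -> Q1 x = dQ ->
  is_derive x w (fun y => (T1 y - v y * Q1 y) / (2 * z y))
    ((ddT - dv * dQ - v x * ddQ) / (2 * z x)
     - (dT - v x * dQ) * (dQ * (1 + v x ^+ 2) + 2 * Q x * v x * dv) / (4 * z x ^+ 3)).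
Proof.
move=> hT1 hQ1 T1x Q1x.
have h2 := isd_mul (isd_cst 2 x w) hz.
have z1 : z x != 0 by rewrite gt_eqF.
have z2 : 2 * z x != 0 by rewrite mulf_neq0.
apply: isd_eq (@isd_div _ _ (fun y => T1 y - v y * Q1 y) (fun y => 2 * z y) _ _ _ _ z2 (isd_sub hT1 (isd_mul hv hQ1)) h2) _.
by rewrite T1x Q1x; field.
Qed.

End along.

End profile.

Lemma cvg_sumr (R : realType) (T : Type) (F : set_system T) (FF : Filter F) (I : finType)
    (f : I -> T -> R) (l : I -> R) :
  (forall i, f i x @[x --> F] --> l i) -> \sum_i f i x @[x --> F] --> \sum_i l i.
Proof.
move=> h; rewrite /index_enum; elim: (Finite.enum I) => [|i s IHs].
  by under eq_fun do rewrite big_nil; rewrite big_nil; exact: cvg_cst.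
by under eq_fun do rewrite big_cons; rewrite big_cons; exact: cvgD.
Qed.

Section halfspace_functions.
Context {R : realType} {n : nat}.
Local Notation H := (heis R n).
Local Notation E := ('I_n * bool)%type.

(** Exchanges X_i and Y_i, the only pairs of fields that do not commute; [hsign] carries the sign
    with which one changes along the other. *)
Definition hconj (e : E) : E := (e.1, ~~ e.2).
Definition hsign (e : E) : R := if e.2 then -1 else 1.

Lemma hconjK : involutive hconj.
Proof. by case=> i b; rewrite /hconj /= negbK. Qed.

Lemma hsign_conj e : hsign (hconj e) = - hsign e.
Proof. by case: e => i []; rewrite /hsign /= ?opprK. Qed.

Lemma hsign_sqr e : hsign e ^+ 2 = 1.
Proof. by case: e => i []; rewrite /hsign /= ?sqrrN expr1n. Qed.

Lemma hconj_neq e : (e == hconj e) = false.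
Proof. by case: e => i []; rewrite /hconj /= xpair_eqE eqxx. Qed.

Lemma sum_hE (F : E -> R) : \sum_e F e = \sum_(i < n) (F (i, true) + F (i, false)).
Proof.
rewrite (eq_bigr (fun e => F (e.1, e.2))); last by case.
rewrite -(pair_bigA _ (fun i b => F (i, b))) /=.
by apply: eq_bigr => i _; rewrite big_bool.
Qed.

Lemma sum_hconj (F : E -> R) : \sum_e F (hconj e) = \sum_e F e.
Proof. by rewrite [RHS](reindex_inj (inv_inj hconjK)). Qed.

Lemma sum_hE_pick e (F : E -> R) : \sum_e' F e' * (e' == e)%:R = F e.
Proof.
rewrite (bigD1 e)//= eqxx mulr1 big1 ?addr0// => e' /negbTE ->.
by rewrite mulr0.
Qed.

Definition hlin (a b : 'rV[R]_n) (c : R) (xi : H) : R :=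
  dotv a xi.1.1 + dotv b xi.1.2 + c * xi.2.

Definition haff (a b : 'rV[R]_n) c k (xi : H) : R := hlin a b c xi - k.

(** Components of N, the derivatives of the affine function along the horizontal fields
    ([hlin_hE]). *)
Definition hnormal (a b : 'rV[R]_n) (c : R) (e : E) (xi : H) : R :=
  if e.2 then a 0 e.1 + 2 * c * xi.1.2 0 e.1 else b 0 e.1 - 2 * c * xi.1.1 0 e.1.

Definition hnormal2 (a b : 'rV[R]_n) c (xi : H) : R := \sum_e hnormal a b c e xi ^+ 2.

Variables (a b : 'rV[R]_n) (c k : R).
Local Notation gr := (hnormal a b c).

Lemma dotvZr (x y : 'rV[R]_n) (s : R) : dotv x (s *: y) = s * dotv x y.
Proof. by rewrite /dotv mulr_sumr; apply: eq_bigr => i _; rewrite mxE mulrCA. Qed.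

Lemma hlinD xi zeta : hlin a b c (xi + zeta) = hlin a b c xi + hlin a b c zeta.
Proof. by rewrite /hlin /= !dotvDr; ring. Qed.

Lemma hlinZ s xi : hlin a b c (s *: xi) = s * hlin a b c xi.
Proof. by rewrite /hlin /= !dotvZr /GRing.scale /=; ring. Qed.

Lemma hlinB xi zeta : hlin a b c (xi - zeta) = hlin a b c xi - hlin a b c zeta.
Proof. by rewrite hlinD -scaleN1r hlinZ mulN1r. Qed.

Lemma hlin_hE e xi : hlin a b c (hE e xi) = gr e xi.
Proof.
case: e => i []; rewrite /hlin /hnormal /hE /hX /hY /= dotv0;
by rewrite -[delta_mx 0 i]scale1r dotv_delta; ring.
Qed.

Lemma haff_line (s : R) (xi v : H) : haff a b c k (xi + s *: v) = haff a b c k xi + s * hlin a b c v.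
Proof. by rewrite /haff hlinD hlinZ; ring. Qed.

Definition hnormal_lin e (v : H) : R := if e.2 then 2 * c * v.1.2 0 e.1 else - (2 * c * v.1.1 0 e.1).

Lemma hnormal_line e (s : R) (xi v : H) :
  gr e (xi + s *: v) = gr e xi + s * hnormal_lin e v.
Proof. by case: e => i []; rewrite /hnormal /hnormal_lin /= !mxE; ring. Qed.

Lemma hnormal_lin_hE e e' xi :
  hnormal_lin e (hE e' xi) = (e == hconj e')%:R * (2 * c * hsign e').
Proof.
case: e => i []; case: e' => j []; rewrite /hnormal_lin /hE /hX /hY /hconj /hsign /=
  !mxE /= xpair_eqE ?andbT ?andbF ?eqxx /=; ring.
Qed.

Lemma is_derive_affine (f : H -> R) xi v d :
  (forall s, f (xi + s *: v) = f xi + s * d) -> is_derive xi v f d.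
Proof.
move=> h; apply/is_derive_line0; rewrite (funext h).
have h1 := isd_mul (is_derive_id (0 : R) 1) (isd_cst d (0 : R) 1).
by apply: isd_eq (isd_add (isd_cst (f xi) (0 : R) 1) h1) _; rewrite /=; ring.
Qed.

Lemma is_derive_haff e xi : is_derive xi (hE e xi) (haff a b c k) (gr e xi).
Proof. by apply: is_derive_affine => s; rewrite haff_line hlin_hE. Qed.

Lemma is_derive_hnormal e e' xi :
  is_derive xi (hE e' xi) (gr e) ((e == hconj e')%:R * (2 * c * hsign e')).
Proof. by apply: is_derive_affine => s; rewrite hnormal_line hnormal_lin_hE. Qed.

Lemma is_derive_hnormal2 e xi :
  is_derive xi (hE e xi) (hnormal2 a b c) (4 * c * hsign e * gr (hconj e) xi).
Proof.
apply: isd_eq (isd_sum (fun e' => isd_sqr (is_derive_hnormal e' e xi))) _.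
rewrite -[RHS](@sum_hE_pick (hconj e) (fun e' => 4 * c * hsign e * gr e' xi)).
by apply: eq_bigr => e' _; ring.
Qed.

Lemma hnormal2_ge0 xi : 0 <= hnormal2 a b c xi.
Proof. by apply: sumr_ge0 => e _; exact: sqr_ge0. Qed.

Lemma continuous_dotv (w : 'rV[R]_n) (f : H -> 'rV[R]_n) :
  (forall i, continuous (fun xi => f xi 0 i)) -> continuous (fun xi => dotv w (f xi)).
Proof.
move=> cf xi; rewrite /dotv.
apply: cvg_sumr => i.
by apply: cvgM; [exact: cvg_cst|exact: cf].
Qed.

Lemma continuous_hlin : continuous (hlin a b c).
Proof.
move=> xi; apply: cvgD.
  apply: cvgD.
    by apply: (@continuous_dotv a (fun xi : H => xi.1.1)) => i; exact: continuous_coordx.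
  by apply: (@continuous_dotv b (fun xi : H => xi.1.2)) => i; exact: continuous_coordy.
by apply: cvgM; [exact: cvg_cst|exact: continuous_coordt].
Qed.

Lemma continuous_haff : continuous (haff a b c k).
Proof. by move=> xi; apply: cvgB; [exact: continuous_hlin|exact: cvg_cst]. Qed.

Lemma continuous_hnormal e : continuous (gr e).
Proof.
case: e => i [] xi; rewrite /hnormal /=.
  apply: cvgD; first exact: cvg_cst.
  by apply: cvgM; [exact: cvg_cst|exact: continuous_coordy].
apply: cvgB; first exact: cvg_cst.
by apply: cvgM; [exact: cvg_cst|exact: continuous_coordx].
Qed.

Lemma continuous_sum_hE (F : E -> H -> R) : (forall e, continuous (F e)) ->
  continuous (fun xi => \sum_e F e xi).
Proof.
move=> cF xi; apply: cvg_sumr => e.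
exact: cF.
Qed.

Lemma continuous_hnormal2 : continuous (hnormal2 a b c).
Proof.
apply: continuous_sum_hE => e xi.
by rewrite /GRing.exp /=; apply: cvgM; exact: continuous_hnormal.
Qed.

Section curve.
Variables (g : R -> H) (s : R) (g' : H).
Hypothesis dg : is_derive s 1 g g'.

(** A horizontal curve is only known to be differentiable at [s]; continuity and linearity of [f]
    let the limit of the difference quotients pass through it. *)
Lemma is_derive_linear_comp (f : H -> R) : continuous f ->
  (forall u v, f (u - v) = f u - f v) -> (forall r u, f (r *: u) = r * f u) ->
  is_derive s 1 (f \o g) (f g').
Proof.
move=> cf fB fZ.
have [d1 d2] := dg.
have d1' := d1; move: d1' => /cvg_ex[/= l cl].
have lE : l = g' by rewrite -d2; exact/esym/(cvg_lim (@norm_hausdorff _ _) cl).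
have : (fun h : R => h^-1 *: ((f \o g \o shift s) (h *: 1) - (f \o g) s)) @ 0^' --> f g'.
  rewrite -lE.
  have -> : (fun h : R => h^-1 *: ((f \o g \o shift s) (h *: 1) - (f \o g) s)) =
     f \o (fun h : R => h^-1 *: ((g \o shift s) (h *: 1) - g s)).
    by apply/funext => h /=; rewrite fZ fB.
  by apply: cvg_comp cl _; exact: cf.
move=> h; split; first by apply/cvg_ex; exists (f g').
exact: (cvg_lim (@norm_hausdorff _ _) h).
Qed.

Lemma is_derive_haff_comp : is_derive s 1 (haff a b c k \o g) (hlin a b c g').
Proof.
apply: isd_eq (isd_sub (is_derive_linear_comp continuous_hlin hlinB hlinZ) (isd_cst k s 1)) _.
by rewrite subr0.
Qed.

Lemma is_derive_hnormal_comp e : is_derive s 1 (gr e \o g) (hnormal_lin e g').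
Proof.
have cf : continuous (hnormal_lin e).
  case: e => i [] xi; rewrite /hnormal_lin /=.
    by apply: cvgM; [exact: cvg_cst|exact: continuous_coordy].
  by apply: cvgN; apply: cvgM; [exact: cvg_cst|exact: continuous_coordx].
have fB u v : hnormal_lin e (u - v) = hnormal_lin e u - hnormal_lin e v.
  by case: e {cf} => i []; rewrite /hnormal_lin /= !mxE; ring.
have fZ r u : hnormal_lin e (r *: u) = r * hnormal_lin e u.
  by case: e {cf fB} => i []; rewrite /hnormal_lin /= !mxE; ring.
have -> : gr e \o g = fun s => gr e 0 + hnormal_lin e (g s).
  by apply/funext => r /=; rewrite -[in LHS](add0r (g r)) -[g r in LHS]scale1r hnormal_line mul1r.
apply: isd_eq (isd_add (isd_cst _ s 1) (is_derive_linear_comp cf fB fZ)) _.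
by rewrite add0r.
Qed.

End curve.

Lemma hlin_sum (w : E -> R) xi : hlin a b c (\sum_e w e *: hE e xi) = \sum_e w e * gr e xi.
Proof.
rewrite (big_morph (hlin a b c) hlinD (_ : hlin a b c 0 = 0)).
  by apply: eq_bigr => e _; rewrite hlinZ hlin_hE.
by rewrite -[X in hlin _ _ _ X](scale0r 0) hlinZ mul0r.
Qed.

Lemma hnormal_lin_sum e (w : E -> R) xi :
  hnormal_lin e (\sum_e' w e' *: hE e' xi) = - (2 * c * hsign e * w (hconj e)).
Proof.
have fD u v : hnormal_lin e (u + v) = hnormal_lin e u + hnormal_lin e v.
  by case: e => i []; rewrite /hnormal_lin /= !mxE; ring.
have fZ r u : hnormal_lin e (r *: u) = r * hnormal_lin e u.
  by case: e {fD} => i []; rewrite /hnormal_lin /= !mxE; ring.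
rewrite (big_morph (hnormal_lin e) fD (_ : hnormal_lin e 0 = 0)); last first.
  by rewrite -(scale0r 0) fZ mul0r.
rewrite -(@sum_hE_pick (hconj e) (fun e' => - (2 * c * hsign e * w e'))).
apply: eq_bigr => e' _; rewrite fZ hnormal_lin_hE.
rewrite -(inj_eq (inv_inj hconjK)) hconjK eq_sym.
have [->|_] := eqVneq e' (hconj e); last by rewrite mul0r !mulr0.
by rewrite hsign_conj; ring.
Qed.

Lemma is_derive_hnormal2_comp (g : R -> H) (s : R) (w : E -> R) :
  is_derive s 1 g (\sum_e w e *: hE e (g s)) ->
  is_derive s 1 (hnormal2 a b c \o g)
    (\sum_e w e * (4 * c * hsign e * gr (hconj e) (g s))).
Proof.
move=> dg; apply: isd_eq (isd_sum (fun e => isd_sqr (is_derive_hnormal_comp dg e))) _.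
rewrite -[RHS]sum_hconj; apply: eq_bigr => e _ /=.
by rewrite hnormal_lin_sum hsign_conj hconjK; ring.
Qed.

End halfspace_functions.

(** * Gradient and sub-Laplacian of the regularised distance *)

Section barrier.
Context {R : realType} {n : nat}.
Local Notation H := (heis R n).
Local Notation E := ('I_n * bool)%type.
Variables (a b : 'rV[R]_n) (c k eps : R).
Hypotheses (c0 : c != 0) (eps0 : 0 < eps).
Local Notation gr := (hnormal a b c).

(** [bT], [bQ], [bv], [bd] are T, Q, v and delta of the regularised distance. The suffix 1 marks
    first derivatives along [hE e], [bdv] is the one of [bv], and [bd2] is the derivative of [bd1 e]
    along the same field. *)
Definition bT (xi : H) : R := haff a b c k xi / `|c|.
Definition bQ (xi : H) : R := hnormal2 a b c xi / (4 * c ^+ 2) + eps ^+ 2.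
Definition bT1 e (xi : H) : R := gr e xi / `|c|.
Definition bQ1 e (xi : H) : R := hsign e * gr (hconj e) xi / c.
Definition bv (xi : H) : R := prof_inv (bT xi / bQ xi).
Definition bz (xi : H) : R := Num.sqrt (bQ xi * (1 + bv xi ^+ 2)).
Definition bd (xi : H) : R := arc (bT xi) (bQ xi).
Definition bd1 e (xi : H) : R := (bT1 e xi - bv xi * bQ1 e xi) / (2 * bz xi).
Definition bdv e (xi : H) : R := (2 * (1 + bv xi * atan (bv xi)))^-1 *
  ((bT1 e xi * bQ xi - bT xi * bQ1 e xi) / bQ xi ^+ 2).
Definition bd2 e (xi : H) : R :=
  (0 - bdv e xi * bQ1 e xi - bv xi * 2) / (2 * bz xi)
  - (bT1 e xi - bv xi * bQ1 e xi) *
    (bQ1 e xi * (1 + bv xi ^+ 2) + 2 * bQ xi * bv xi * bdv e xi) / (4 * bz xi ^+ 3).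

Lemma bQ_ge xi : eps ^+ 2 <= bQ xi.
Proof. by rewrite lerDr divr_ge0 ?hnormal2_ge0// mulr_ge0// sqr_ge0. Qed.

Lemma bQ_gt0 xi : 0 < bQ xi.
Proof. by apply: lt_le_trans (bQ_ge xi); rewrite exprn_gt0. Qed.

Lemma onesqr_gt0 (r : R) : 0 < 1 + r ^+ 2.
Proof. by rewrite ltr_pwDl// sqr_ge0. Qed.

Lemma bz_gt0 xi : 0 < bz xi.
Proof. by rewrite sqrtr_gt0 mulr_gt0 ?bQ_gt0// onesqr_gt0. Qed.

Lemma bz_sqr xi : bz xi ^+ 2 = bQ xi * (1 + bv xi ^+ 2).
Proof. by rewrite sqr_sqrtr// mulr_ge0// ltW// ?bQ_gt0 ?onesqr_gt0. Qed.

Lemma P_gt0 (v : R) : 0 < 1 + v * atan v.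
Proof. by rewrite ltr_pwDl// mul_atan_ge0. Qed.

Lemma bTE xi : bT xi = bQ xi * ((1 + bv xi ^+ 2) * atan (bv xi) + bv xi).
Proof. by rewrite -[_ + bv xi]/(prof (bv xi)) prof_invK mulrC divfK// gt_eqF// bQ_gt0. Qed.

Lemma is_derive_bT e xi : is_derive xi (hE e xi) bT (bT1 e xi).
Proof.
apply: isd_eq (isd_mul (is_derive_haff a b c k e xi) (isd_cst `|c|^-1 _ _)) _.
by rewrite mulr0 addr0.
Qed.

Lemma is_derive_bQ e xi : is_derive xi (hE e xi) bQ (bQ1 e xi).
Proof.
apply: isd_eq (isd_add (isd_mul (is_derive_hnormal2 a b c e xi) (isd_cst (4 * c ^+ 2)^-1 _ _)) (isd_cst (eps ^+ 2) _ _)) _.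
by rewrite mulr0 !addr0 /bQ1; field.
Qed.

Lemma is_derive_bT1 e xi : is_derive xi (hE e xi) (bT1 e) 0.
Proof.
apply: isd_eq (isd_mul (is_derive_hnormal a b c e e xi) (isd_cst `|c|^-1 _ _)) _.
by rewrite hconj_neq !mul0r mulr0 addr0.
Qed.

(** Up to eps^2, Q is the squared Euclidean distance to the line N = 0 in the variables (x, y),
    whose pure second derivatives are 2. *)
Lemma is_derive_bQ1 e xi : is_derive xi (hE e xi) (bQ1 e) 2.
Proof.
apply: isd_eq (isd_mul (isd_mul (isd_cst (hsign e) _ _) (is_derive_hnormal a b c (hconj e) e xi)) (isd_cst c^-1 _ _)) _.
rewrite eqxx mul0r add0r mulr0 addr0 mul1r.
have -> : hsign e * (2 * c * hsign e) / c = 2 * hsign e ^+ 2 * (c / c) by ring.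
by rewrite divff// hsign_sqr !mulr1.
Qed.

Lemma is_derive_bd e xi : is_derive xi (hE e xi) bd (bd1 e xi).
Proof.
exact: (is_derive_arc (bQ_gt0 xi) (is_derive_bT e xi) (is_derive_bQ e xi)).
Qed.

Lemma is_derive_bd1 e xi : is_derive xi (hE e xi) (bd1 e) (bd2 e xi).
Proof.
exact: (is_derive2_arc (bQ_gt0 xi) (is_derive_bT e xi) (is_derive_bQ e xi)
  (is_derive_bT1 e xi) (is_derive_bQ1 e xi)).
Qed.

Lemma bT1_sqr xi : \sum_e bT1 e xi ^+ 2 = hnormal2 a b c xi / c ^+ 2.
Proof.
rewrite /hnormal2 mulr_suml; apply: eq_bigr => e _.
by rewrite expr_div_n real_normK ?num_real.
Qed.

Lemma bQ1_sqr xi : \sum_e bQ1 e xi ^+ 2 = hnormal2 a b c xi / c ^+ 2.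
Proof.
rewrite /hnormal2 -[in RHS]sum_hconj mulr_suml; apply: eq_bigr => e _.
by rewrite expr_div_n exprMn hsign_sqr mul1r.
Qed.

(** Up to sign, the gradient of Q is that of T rotated by a quarter turn in each plane (X_i, Y_i),
    so the two terms of each plane cancel. All mixed terms below disappear for this reason. *)
Lemma bTQ1 xi : \sum_e bT1 e xi * bQ1 e xi = 0.
Proof.
rewrite sum_hE big1// => i _; rewrite /bT1 /bQ1 /hsign /hconj /=.
by ring.
Qed.

(* The squared length of the horizontal gradient of [bd]. *)
Definition bkappa (xi : H) : R := hnormal2 a b c xi / (4 * c ^+ 2) / bQ xi.

Lemma bkappaE xi : bkappa xi = 1 - eps ^+ 2 / bQ xi.
Proof.
rewrite /bkappa; have -> : hnormal2 a b c xi / (4 * c ^+ 2) = bQ xi - eps ^+ 2 by rewrite addrK.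
by rewrite mulrBl divff// gt_eqF// bQ_gt0.
Qed.

Lemma bkappa_ge0 xi : 0 <= bkappa xi.
Proof.
rewrite /bkappa divr_ge0//; last by rewrite ltW// bQ_gt0.
by rewrite divr_ge0 ?hnormal2_ge0// mulr_ge0// sqr_ge0.
Qed.

Lemma bkappa_le1 xi : bkappa xi <= 1.
Proof. by rewrite bkappaE gerBl divr_ge0 ?sqr_ge0// ltW// bQ_gt0. Qed.

(** Both the squared gradient and the sub-Laplacian of [bd] are brought to this form; the constant
    term is summed over the 2n fields. *)
Lemma sum_lin3 (x y z d : R) xi :
  \sum_e (x * bT1 e xi ^+ 2 + y * bQ1 e xi ^+ 2 + z * (bT1 e xi * bQ1 e xi) + d) =
  (x + y) * (hnormal2 a b c xi / c ^+ 2) + d * (2 * n%:R).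
Proof.
rewrite !big_split/= -!mulr_sumr bT1_sqr bQ1_sqr bTQ1 mulr0 addr0 -mulrDl.
by congr (_ + _); rewrite (@sum_hE R n (fun=> d)) sumr_const card_ord -mulr_natr; ring.
Qed.

(** By orthogonality the squares of the coefficients 1 and v add up to 1 + v^2, which cancels
    against z^2 = Q (1 + v^2). *)
Lemma bd1_sqr xi : \sum_e bd1 e xi ^+ 2 = bkappa xi.
Proof.
have Q0 := bQ_gt0 xi; have z2 := bz_sqr xi; have s0 := onesqr_gt0 (bv xi).
transitivity (\sum_e ((4 * bz xi ^+ 2)^-1 * bT1 e xi ^+ 2 + (bv xi ^+ 2 / (4 * bz xi ^+ 2)) * bQ1 e xi ^+ 2
   + (- (2 * bv xi) / (4 * bz xi ^+ 2)) * (bT1 e xi * bQ1 e xi) + 0)).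
  apply: eq_bigr => e _; rewrite /bd1; have := bz_gt0 xi; move: (bz xi) => z z0.
  by field; rewrite gt_eqF.
rewrite sum_lin3 z2 /bkappa mul0r addr0.
by field; rewrite c0 !gt_eqF.
Qed.

Lemma laplacian_bd xi : - bd xi * \sum_e bd2 e xi =
  atan (bv xi) * (2 * n%:R * bv xi -
   bkappa xi * ((1 + bv xi ^+ 2) * atan (bv xi) + bv xi) / (1 + bv xi * atan (bv xi))).
Proof.
have Q0 := bQ_gt0 xi; have z2 := bz_sqr xi; have s0 := onesqr_gt0 (bv xi).
have P0 := P_gt0 (bv xi); have z0 := bz_gt0 xi.
have TE := bTE xi.
have bdE : bd xi = bz xi * atan (bv xi) by [].
pose v := bv xi; pose Q := bQ xi; pose z := bz xi; pose w := (2 * (1 + v * atan v) * Q ^+ 2)^-1.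
(* Coefficients of T1^2, Q1^2 and T1 Q1 in the second derivative; the free term - v / z comes from
   the second derivative 2 of Q. *)
pose al := - (2 * Q ^+ 2 * v * w) / (4 * z ^+ 3).
pose be := w * bT xi / (2 * z) - (- (v * (1 + v ^+ 2)) + 2 * Q * v ^+ 2 * w * bT xi) / (4 * z ^+ 3).
pose ga := - (w * Q) / (2 * z) - ((1 + v ^+ 2) - 2 * Q * v * w * bT xi - 2 * Q ^+ 2 * v ^+ 2 * w) / (4 * z ^+ 3).
have -> : \sum_e bd2 e xi = \sum_e (al * bT1 e xi ^+ 2 + be * bQ1 e xi ^+ 2
    + ga * (bT1 e xi * bQ1 e xi) + (- (v / z))).
  apply: eq_bigr => e _; rewrite /bd2 /bdv /al /be /ga /w -/v -/Q -/z.
  by field; rewrite !gt_eqF.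
rewrite sum_lin3 bdE /bkappa -/v -/Q -/z.
(* Odd powers of z reduce to z itself, which the factor z of [bd] then cancels. *)
have zE : z ^+ 3 = z * (Q * (1 + v ^+ 2)) by rewrite exprS z2.
rewrite /al /be zE /w TE -/v -/Q.
by field; rewrite c0 !gt_eqF.
Qed.

Lemma bv_gt0 xi : 0 < haff a b c k xi -> 0 < bv xi.
Proof.
move=> h; rewrite lt_neqAle -{2}(@prof_inv0 R) prof_inv_le divr_ge0 ?ltW ?bQ_gt0//; last first.
  by rewrite divr_gt0// normr_gt0.
rewrite andbT eq_sym; apply: contraTneq h => v0.
have : bT xi = 0 by rewrite bTE v0 atan0 mulr0 addr0 mulr0.
by rewrite /bT => /eqP; rewrite mulf_eq0 invr_eq0 normr_eq0 (negbTE c0) orbF => /eqP ->; rewrite ltxx.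
Qed.

Lemma bd_gt0 xi : 0 < haff a b c k xi -> 0 < bd xi.
Proof. by move=> h; rewrite mulr_gt0 ?bz_gt0// atan_gt0// bv_gt0. Qed.

(** From atan v <= v the fraction in [laplacian_bd] is at most 2 v, and n >= 1 gives 2 n v - 2 kappa
    v >= 2 (1 - kappa) v. The bound is large where both v and the loss 1 - kappa of the gradient
    are. *)
Lemma laplacian_bd_ge xi : (0 < n)%N -> 0 < haff a b c k xi ->
  2 * (1 - bkappa xi) * (bv xi * atan (bv xi)) <= - bd xi * \sum_e bd2 e xi.
Proof.
move=> n0 h; have v0 := bv_gt0 h; rewrite laplacian_bd.
have a0 := atan_gt0 v0; have av := atan_le (ltW v0).
have k0 := bkappa_ge0 xi; have P0 := P_gt0 (bv xi).
have n1 : 1 <= n%:R :> R by rewrite ler1n.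
move: (bv xi) v0 a0 av k0 P0 => v v0; move: (atan v) (bkappa xi) => al ka a0 av k0 P0.
have hP : ((1 + v ^+ 2) * al + v) / (1 + v * al) <= 2 * v.
  rewrite ler_pdivrMr//.
  have : 0 <= v ^+ 2 * al by rewrite mulr_ge0 ?sqr_ge0// ltW.
  by nra.
have -> : 2 * (1 - ka) * (v * al) = al * (2 * (1 - ka) * v) by ring.
rewrite ler_pM2l// -mulrA.
have := ler_wpM2l k0 hP.
have : v <= n%:R * v by rewrite ler_peMl// ltW.
by lra.
Qed.

(** Makes the barrier small near the hyperplane where N degenerates. It compares z^2 (atan v)^2 with
    T = Q ((1 + v^2) atan v + v), using atan v < pi / 2 < 2. *)
Lemma bd_sqr_le xi : 0 <= haff a b c k xi -> bd xi ^+ 2 <= 2 * bT xi.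
Proof.
move=> h; have T0 : 0 <= bT xi by rewrite divr_ge0.
have Q0 := bQ_gt0 xi.
have v0 : 0 <= bv xi by rewrite -(@prof_inv0 R) prof_inv_le divr_ge0// ltW.
have a0 := atan_ge0 v0.
have a2 : atan (bv xi) <= 2 by apply: ltW; apply: lt_trans (atan_ltpi2 _) _; exact: pihalf_lt2.
have -> : bd xi = bz xi * atan (bv xi) by [].
rewrite exprMn bz_sqr [bT xi in leRHS]bTE.
have : bQ xi * (1 + bv xi ^+ 2) * atan (bv xi) ^+ 2 <= bQ xi * (1 + bv xi ^+ 2) * atan (bv xi) * 2.
  rewrite expr2 mulrA; apply: ler_wpM2l => //; rewrite mulr_ge0//.
  by apply: mulr_ge0; rewrite ltW// onesqr_gt0.
have : 0 <= bQ xi * bv xi by rewrite mulr_ge0// ltW.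
by lra.
Qed.

(** The complementary bound where N is not small: |N| <= 2 |c| sqrt Q, while sqrt (1 + v^2) <= 1 +
    v^2 gives delta sqrt Q <= T. *)
Lemma bd_normal_le xi : 0 <= haff a b c k xi ->
  bd xi * Num.sqrt (hnormal2 a b c xi) <= 2 * haff a b c k xi.
Proof.
move=> h; have T0 : 0 <= bT xi by rewrite divr_ge0.
have Q0 := bQ_gt0 xi.
have v0 : 0 <= bv xi by rewrite -(@prof_inv0 R) prof_inv_le divr_ge0// ltW.
have a0 := atan_ge0 v0.
have c2 : 0 < 4 * c ^+ 2 by rewrite mulr_gt0// exprn_even_gt0.
have hN : Num.sqrt (hnormal2 a b c xi) <= 2 * `|c| * Num.sqrt (bQ xi).
  have -> : 2 * `|c| * Num.sqrt (bQ xi) = Num.sqrt (4 * c ^+ 2 * bQ xi).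
    rewrite sqrtrM ?ltW// sqrtrM// sqrtr_sqr.
    have -> : 4 = 2 ^+ 2 :> R by ring.
    by rewrite sqrtr_sqr (ger0_norm (_ : 0 <= 2)).
  apply: ler_wsqrtr.
  by rewrite /bQ mulrDr [X in _ <= X + _]mulrC divfK ?gt_eqF// lerDl mulr_ge0 ?sqr_ge0// ltW.
have hb : bd xi * Num.sqrt (bQ xi) <= bT xi.
  have -> : bd xi * Num.sqrt (bQ xi) = bQ xi * Num.sqrt (1 + bv xi ^+ 2) * atan (bv xi).
    rewrite /bd /arc -/(bv xi) sqrtrM ?ltW//.
    have := sqr_sqrtr (ltW Q0); set q := Num.sqrt (bQ xi) => <-; ring.
  have hs : Num.sqrt (1 + bv xi ^+ 2) <= 1 + bv xi ^+ 2.
    have w1 : 1 <= 1 + bv xi ^+ 2 by rewrite lerDl sqr_ge0.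
    have := onesqr_gt0 (bv xi); move: (1 + _) w1 => w w1 w0.
    apply: (@le_trans _ _ (Num.sqrt (w ^+ 2))); last by rewrite sqrtr_sqr gtr0_norm.
    by apply: ler_wsqrtr; rewrite expr2 ler_peMl// ltW.
  rewrite bTE -mulrA ler_wpM2l ?(ltW Q0)//.
  by have := ler_wpM2r a0 hs; lra.
have d0 : 0 <= bd xi by rewrite mulr_ge0// ltW// bz_gt0.
apply: le_trans (ler_wpM2l d0 hN) _.
have -> : bd xi * (2 * `|c| * Num.sqrt (bQ xi)) = (2 * `|c|) * (bd xi * Num.sqrt (bQ xi)) by ring.
apply: (@le_trans _ _ (2 * `|c| * bT xi)); first by rewrite ler_wpM2l// mulr_ge0.
have n0 : `|c| != 0 by rewrite normr_eq0.
by rewrite /bT -mulrA [`|c| * _]mulrC divfK.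
Qed.

Lemma continuous_bT : continuous bT.
Proof. by move=> xi; apply: cvgM; [exact: continuous_haff|exact: cvg_cst]. Qed.

Lemma continuous_bQ : continuous bQ.
Proof.
move=> xi; apply: cvgD; last exact: cvg_cst.
by apply: cvgM; [exact: continuous_hnormal2|exact: cvg_cst].
Qed.

Lemma continuous_bT1 e : continuous (bT1 e).
Proof. by move=> xi; apply: cvgM; [exact: continuous_hnormal|exact: cvg_cst]. Qed.

Lemma continuous_bQ1 e : continuous (bQ1 e).
Proof.
move=> xi; apply: cvgM; last exact: cvg_cst.
by apply: cvgM; [exact: cvg_cst|exact: continuous_hnormal].
Qed.

Lemma continuous_bv : continuous bv.
Proof.
move=> xi; apply: (@continuous_comp _ _ _ (fun xi => bT xi / bQ xi) (@prof_inv R)).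
  apply: cvgM; first exact: continuous_bT.
  by apply: cvgV; [rewrite gt_eqF// bQ_gt0|exact: continuous_bQ].
exact: isd_continuous (is_derive_prof_inv _).
Qed.

Lemma continuous_atan_bv : continuous (fun xi => atan (bv xi)).
Proof.
move=> xi; apply: (@continuous_comp _ _ _ bv (@atan R)); first exact: continuous_bv.
exact: continuous_atan.
Qed.

Lemma continuous_onesqr_bv : continuous (fun xi => 1 + bv xi ^+ 2).
Proof.
move=> xi; apply: cvgD; first exact: cvg_cst.
by rewrite /GRing.exp /=; apply: cvgM; exact: continuous_bv.
Qed.

Lemma continuous_bz : continuous bz.
Proof.
move=> xi; apply: (@continuous_comp _ _ _ (fun xi => bQ xi * (1 + bv xi ^+ 2)) (@Num.sqrt R)).
  by apply: cvgM; [exact: continuous_bQ|exact: continuous_onesqr_bv].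
exact: sqrt_continuous.
Qed.

Lemma continuous_bd : continuous bd.
Proof. by move=> xi; apply: cvgM; [exact: continuous_bz|exact: continuous_atan_bv]. Qed.

Lemma continuous_bTvQ1 e : continuous (fun xi => bT1 e xi - bv xi * bQ1 e xi).
Proof.
move=> xi; apply: cvgB; first exact: continuous_bT1.
by apply: cvgM; [exact: continuous_bv|exact: continuous_bQ1].
Qed.

Lemma continuous_bd1 e : continuous (bd1 e).
Proof.
move=> xi; apply: cvgM; first exact: continuous_bTvQ1.
apply: cvgV; first by rewrite mulf_neq0// gt_eqF// bz_gt0.
by apply: cvgM; [exact: cvg_cst|exact: continuous_bz].
Qed.

Lemma continuous_bdv e : continuous (bdv e).
Proof.
move=> xi; apply: cvgM.
  apply: cvgV; first by rewrite mulf_neq0// gt_eqF// P_gt0.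
  apply: cvgM; first exact: cvg_cst.
  apply: cvgD; first exact: cvg_cst.
  by apply: cvgM; [exact: continuous_bv|exact: continuous_atan_bv].
apply: cvgM.
  apply: cvgB; apply: cvgM.
  - exact: continuous_bT1.
  - exact: continuous_bQ.
  - exact: continuous_bT.
  - exact: continuous_bQ1.
apply: cvgV; first by rewrite expf_neq0// gt_eqF// bQ_gt0.
by rewrite /GRing.exp /=; apply: cvgM; exact: continuous_bQ.
Qed.

Lemma continuous_bd2 e : continuous (bd2 e).
Proof.
move=> xi; apply: cvgB; apply: cvgM.
- apply: cvgB.
    apply: cvgB; first exact: cvg_cst.
    by apply: cvgM; [exact: continuous_bdv|exact: continuous_bQ1].
  by apply: cvgM; [exact: continuous_bv|exact: cvg_cst].
- apply: cvgV; first by rewrite mulf_neq0// gt_eqF// bz_gt0.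
  by apply: cvgM; [exact: cvg_cst|exact: continuous_bz].
- apply: cvgM; first exact: continuous_bTvQ1.
  apply: cvgD; apply: cvgM.
  + exact: continuous_bQ1.
  + exact: continuous_onesqr_bv.
  + apply: cvgM; last exact: continuous_bv.
    by apply: cvgM; [exact: cvg_cst|exact: continuous_bQ].
  + exact: continuous_bdv.
- apply: cvgV; first by rewrite mulf_neq0// expf_neq0// gt_eqF// bz_gt0.
  apply: cvgM; first exact: cvg_cst.
  rewrite /GRing.exp /=; apply: cvgM; first exact: continuous_bz.
  by apply: cvgM; exact: continuous_bz.
Qed.

End barrier.

(** Mean value theorem on the segment between the two pairs, with |v| <= |T| / Q and z >= [e]. It
    supplies the local Lipschitz bound that carries the absolute continuity of a curve over to [bd]
    along it. *)
Lemma arc_lipschitz (R : realType) (T0 T1 Q0 Q1 e C : R) : 0 < e ->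
  e ^+ 2 <= Q0 -> e ^+ 2 <= Q1 -> `|T0| <= C -> `|T1| <= C ->
  `|arc T1 Q1 - arc T0 Q0| <= (`|T1 - T0| + C / e ^+ 2 * `|Q1 - Q0|) / (2 * e).
Proof.
move=> e0 eQ0 eQ1 TC0 TC1.
have e20 : 0 < e ^+ 2 by rewrite exprn_gt0.
have C0 : 0 <= C by apply: le_trans TC0.
pose T s := T0 + s * (T1 - T0); pose Q s := Q0 + s * (Q1 - Q0).
pose v s := prof_inv (T s / Q s).
have QE (s : R) : 0 <= s <= 1 -> e ^+ 2 <= Q s.
  by move=> /andP[s0 s1]; rewrite /Q; have : 0 <= s * (Q1 - e ^+ 2) + (1 - s) * (Q0 - e ^+ 2);
   [rewrite addr_ge0// mulr_ge0// subr_ge0|lra].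
have TE (s : R) : 0 <= s <= 1 -> `|T s| <= C.
  move=> /andP[s0 s1]; rewrite /T (_ : _ + _ = s * T1 + (1 - s) * T0); last by ring.
  apply: le_trans (ler_normD _ _) _; rewrite !normrM (ger0_norm s0) (ger0_norm (_ : 0 <= 1 - s)) ?subr_ge0//.
  have h1 := ler_wpM2l s0 TC1; have s1' : 0 <= 1 - s by rewrite subr_ge0.
  by have h2 := ler_wpM2l s1' TC0; lra.
have dT (s : R) : is_derive s 1 T (T1 - T0).
  have h1 := isd_mul (is_derive_id (s : R) 1) (isd_cst (T1 - T0) (s : R) 1).
  by apply: isd_eq (isd_add (isd_cst T0 (s : R) 1) h1) _; rewrite /=; ring.
have dQ (s : R) : is_derive s 1 Q (Q1 - Q0).
  have h1 := isd_mul (is_derive_id (s : R) 1) (isd_cst (Q1 - Q0) (s : R) 1).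
  by apply: isd_eq (isd_add (isd_cst Q0 (s : R) 1) h1) _; rewrite /=; ring.
pose d s := ((T1 - T0) - v s * (Q1 - Q0)) / (2 * Num.sqrt (Q s * (1 + v s ^+ 2))).
have darc (s : R) : 0 <= s <= 1 -> is_derive s 1 (fun s => arc (T s) (Q s)) (d s).
  by move=> s01; apply: is_derive_arc => //; apply: lt_le_trans (QE s s01).
have [s s01] : exists2 s, s \in `]0, 1[ & arc (T 1) (Q 1) - arc (T 0) (Q 0) = d s * (1 - 0).
  apply: (@MVT R (fun s => arc (T s) (Q s)) d) => //.
    move=> s; rewrite in_itv/= => /andP[s0 s1]; apply: darc; rewrite !ltW//.
  apply: derivable_within_continuous => s; rewrite in_itv/= => s01.
  by have [] := darc s s01.
have -> : T 1 = T1 by rewrite /T; ring.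
have -> : T 0 = T0 by rewrite /T; ring.
have -> : Q 1 = Q1 by rewrite /Q; ring.
have -> : Q 0 = Q0 by rewrite /Q; ring.
rewrite subr0 mulr1 => ->.
move: s01; rewrite in_itv/= => /andP[/ltW s0 /ltW s1].
have s01 : 0 <= s <= 1 by rewrite s0.
have Qs := QE s s01; have Ts := TE s s01.
have Q0' : 0 < Q s by apply: lt_le_trans Qs.
have zE : e <= Num.sqrt (Q s * (1 + v s ^+ 2)).
  apply: (@le_trans _ _ (Num.sqrt (e ^+ 2))); first by rewrite sqrtr_sqr gtr0_norm.
  apply: ler_wsqrtr.
  by apply: le_trans Qs _; rewrite ler_peMr ?(ltW Q0')// lerDl sqr_ge0.
have vE : `|v s| <= C / e ^+ 2.
  apply: le_trans (prof_inv_norm _) _; rewrite normrM normfV (gtr0_norm Q0').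
  rewrite ler_pdivrMr// mulrAC ler_pdivlMr//.
  by apply: ler_pM => //; rewrite ltW.
rewrite /d normrM normfV (gtr0_norm (_ : 0 < 2 * _)); last by rewrite mulr_gt0// (lt_le_trans e0).
apply: ler_pM => //.
- apply: le_trans (ler_normB _ _) _; rewrite lerD2l normrM ler_wpM2r//.
- by rewrite lef_pV2 ?posrE ?mulr_gt0// ?ler_pM2l// (lt_le_trans e0).
Qed.

(** * The Carnot-Caratheodory distance from below *)

Section integral_lemmas.
Context d (T : measurableType d) (R : realType) (mu : {measure set T -> \bar R}).

(** Proved on the supremum over simple functions, since the quotient by [bdist] and the speed of a
    horizontal curve are integrated without being known to be measurable. *)
Lemma ge0_le_integral_nm (D : set T) (f g : T -> \bar R) :
  (forall x, D x -> (0 <= f x)%E) -> (forall x, D x -> (f x <= g x)%E) ->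
  (\int[mu]_(x in D) f x <= \int[mu]_(x in D) g x)%E.
Proof.
move=> f0 fg; have g0 x : D x -> (0 <= g x)%E by move=> Dx; exact: le_trans (f0 x Dx) (fg x Dx).
rewrite !ge0_integralE//; apply: ereal_sup_le => _ [h /= hf <-].
exists h => // x; apply: le_trans (hf x) _.
by rewrite !patchE; case: ifPn => // /set_mem; exact: fg.
Qed.

End integral_lemmas.

Section absolute_continuity.
Context {R : realType}.
Local Notation mu := (@lebesgue_measure R).

(** [F] is monotone but need not be absolutely continuous, so phi - F cannot be recovered from its
    derivative. On a fine partition, cells containing a point with uniformly controlled difference
    quotients are handled by the derivative; the remaining cells have small total length, where
    absolute continuity bounds the increments of [phi] and monotonicity those of [F]. *)
Lemma ac_sub_le (phi F : R -> R) :
  abs_continuous 0 1 phi -> measurable_fun setT phi -> nondecreasing_fun F ->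
  {ae mu, forall s : R, 0 < s < 1 -> exists dphi dF : R,
    [/\ is_derive s 1 phi dphi, is_derive s 1 F dF & dphi <= dF]} ->
  phi 1 - phi 0 <= F 1 - F 0.
Proof.
move=> ac mphi ndF [N [mN N0 hN]].
have mF : measurable_fun setT F by exact: nondecreasing_measurable.
apply/ler_addgt0Pr => e2 e20.
pose e := e2 / 2; have e0 : 0 < e by rewrite divr_gt0.
have -> : e2 = e + e by rewrite /e; field.
have [d d0 hd] := ac _ e0.
have leM (X Y : set R) : measurable X -> measurable Y -> X `<=` Y -> (mu X <= mu Y)%E.
  by move=> mX mY XY; apply: le_measure; rewrite ?inE.
pose psi s := phi s - F s.
have mpsi : measurable_fun setT psi by exact: measurable_funB.
(* Only the countably many partition points r are tested, which keeps the sets measurable.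
   Multiplying the quotient by (r - s)^2 treats both sides of s at once. *)
pose P (j k i : nat) : set R := [set s | let r := i%:R / k.+1%:R in
   r <= 1 -> `|r - s| < j.+1%:R^-1 -> (r - s) * (psi r - psi s) <= e * (r - s) ^+ 2].
have mP j k i : measurable (P j k i).
  rewrite /P /=; set r := i%:R / _.
  have [r1|r1] := leP r 1; last first.
    by rewrite (_ : [set _ | _] = setT)//; apply/seteqP; split.
  pose S1 : set R := [set s | (j.+1%:R^-1 <= `|r - s|) = true].
  pose S2 : set R := [set s | ((r - s) * (psi r - psi s) <= e * (r - s) ^+ 2) = true].
  rewrite (_ : [set _ | _] = S1 `|` S2); last first.
    apply/seteqP; split => s /=.
      by move=> /(_ isT); case: ltP => [_ /(_ isT) ?|? _]; [right|left].
    by move=> [h|h] _; [rewrite ltNge h|].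
  have mrs : measurable_fun setT (fun s : R => r - s) by exact: measurable_funB.
  apply: measurableU.
    have h : measurable_fun setT (fun s : R => j.+1%:R^-1 <= `|r - s|).
      by apply: measurable_fun_ler => //; exact: measurableT_comp.
    by rewrite -[S1]setTI; exact: (h measurableT [set true]).
  have h : measurable_fun setT (fun s : R => (r - s) * (psi r - psi s) <= e * (r - s) ^+ 2).
    apply: measurable_fun_ler.
      by apply: measurable_funM => //; exact: measurable_funB.
    by apply: measurable_funM => //; exact: measurable_funX.
  by rewrite -[S2]setTI; exact: (h measurableT [set true]).
pose A j : set R := [set s | 0 < s < 1] `&` \bigcap_k \bigcap_i P j k i.
have m01 : measurable [set s : R | 0 < s < 1].
  by rewrite (_ : [set _ | _] = `]0, 1[%classic)//; apply/seteqP; split => s /=; rewrite in_itv.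
have mA j : measurable (A j).
  apply: measurableI => //.
  by apply: bigcapT_measurable => k; apply: bigcapT_measurable.
pose B j : set R := [set s | 0 < s < 1] `\` A j.
have mB j : measurable (B j) by exact: measurableD.
have A_nd j j' : (j <= j')%N -> A j `<=` A j'.
  move=> jj' s [s01 sA]; split => // k _ i _ r r1 hr.
  apply: (sA k I i I) => //; apply: lt_le_trans hr _.
  by rewrite lef_pV2 ?posrE// ler_nat.
(* At a point outside [N] both functions are differentiable and the bound holds on some
   neighbourhood, so every such point of (0, 1) leaves [B j] for large j. *)
have capB : \bigcap_j B j `<=` N.
  move=> s hs; have s01 : 0 < s < 1 by have [] := hs 0%N I.
  apply: contrapT => Ns; have : ~ (~` N) s -> False by [].
  have [dphi [dF [hphi hF dd]]] : exists dphi dF : R,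
      [/\ is_derive s 1 phi dphi, is_derive s 1 F dF & dphi <= dF].
    by apply: contrapT => h; apply: Ns; apply: hN => /(_ s01).
  have hpsi := isd_sub hphi hF.
  have [c1 c2] := hpsi.
  have : \forall h \near (0 : R)^', h^-1 *: (((fun y => phi y - F y) \o shift s) (h *: 1) - (phi s - F s)) < e.
    have /cvgr_lt := c1; apply.
    rewrite -[X in X < _]/('D_1 (fun y => phi y - F y) s) c2.
    by apply: le_lt_trans e0; rewrite subr_le0.
  move=> /nbhs_ballP[r /= r0 hr] _.
  have [j hj] : exists j : nat, j.+1%:R^-1 < r.
    exists (Num.truncn r^-1).
    by rewrite invf_plt ?posrE//; exact: truncnS_gt.
  have [_ []] := hs j I; split => // k _ i _; rewrite /P /=; set q := _ / _ => q1 hq.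
  have [->|qs] := eqVneq q s; first by rewrite subrr mul0r expr0n mulr0.
  have qs0 : q - s != 0 by rewrite subr_eq0.
  have hb : ball (0 : R) r (q - s).
    by rewrite -ball_normE /ball_ /= sub0r normrN; exact: lt_trans hq hj.
  have := hr _ hb qs0; rewrite [(q - s)%:A]mulr1 subrK => /ltW hh.
  have q20 : 0 <= (q - s) ^+ 2 by rewrite sqr_ge0.
  have := ler_wpM2r q20 hh.
  rewrite expr2 {1}/GRing.scale /= mulrACA mulVf// mul1r.
  by rewrite [X in X <= _]mulrC -expr2.
have muB : mu \o B @ \oo --> 0%E.
  have -> : 0%E = mu (\bigcap_j B j).
    apply/esym/eqP; rewrite eq_le measure_ge0 andbT -N0.
    by apply: leM => //; exact: bigcapT_measurable.
  apply: nonincreasing_cvg_mu => //.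
  - apply: (@le_lt_trans _ _ (mu (`]0, 1[%classic : set R))).
      by apply: leM => // s [/= s01 _]; rewrite in_itv.
    by rewrite lebesgue_measure_itv/= lte_fin ltr01 sube0 ltry.
  - exact: bigcapT_measurable.
  - move=> j j' jj'; apply/subsetPset => s [s01 sA]; split => // sA'.
    by apply: sA; exact: A_nd sA'.
have [j hj] : exists j, (mu (B j) < d%:E)%E.
  have nd : nbhs (0%E : \bar R) [set y | (y < d%:E)%E].
    apply: open_nbhs_nbhs; split; first exact: open_ereal_lt_ereal.
    by rewrite /= lte_fin.
  have [j _ hj] := muB _ nd.
  by exists j; apply: (hj j) => /=.
(* The mesh 1 / (j + 2) is strictly below the radius 1 / (j + 1) of [A j], and the partition points
   are those tested by [P] with k = j + 1. *)
have [m mE] : exists m, m = j.+2 by exists j.+2.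
pose a (i : nat) : R := i%:R / m%:R.
have m0 : 0 < m%:R :> R by rewrite mE ltr0n.
have aS i : a i.+1 - a i = m%:R^-1.
  by rewrite /a -mulrBl -natrB// subSnn mul1r.
have aSl i : a i < a i.+1 by rewrite -subr_gt0 aS invr_gt0.
have a0 : a 0%N = 0 by rewrite /a mul0r.
have am : a m = 1 by rewrite /a divff// gt_eqF.
have a_le i i' : (i <= i')%N -> a i <= a i' by move=> ii'; rewrite ler_pM2r ?invr_gt0// ler_nat.
have a_ge0 i : 0 <= a i by rewrite divr_ge0.
have a_le1 i : (i <= m)%N -> a i <= 1 by move=> im; rewrite -am; exact: a_le.
pose good i := `[< exists s, A j s /\ a i <= s <= a i.+1 >].
have hgood i : (i < m)%N -> good i -> psi (a i.+1) - psi (a i) <= e / m%:R.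
  move=> im /asboolP[s [[s01 sA] /andP[as1 as2]]].
  have key i' : (i' = i \/ i' = i.+1) -> (a i' - s) * (psi (a i') - psi s) <= e * (a i' - s) ^+ 2.
    move=> ii'; have := sA j.+1 I i' I; rewrite /P /= -mE -/(a i'); apply.
      by rewrite a_le1//; case: ii' => ->//; exact: ltnW.
    apply: (@le_lt_trans _ _ m%:R^-1); last by rewrite ltf_pV2 ?posrE// mE ltr_nat.
    have := aS i; case: ii' => -> h; rewrite ler_norml; lra.
  have h1 : psi (a i.+1) - psi s <= e * (a i.+1 - s).
    have := key i.+1 (or_intror erefl); rewrite le_eqVlt in as2; case/orP: as2 => [/eqP ->|as2 h].
      by move=> _; rewrite !subrr mulr0.
    by rewrite -(ler_pM2l (_ : 0 < a i.+1 - s)) ?subr_gt0//; apply: le_trans h _; rewrite expr2; lra.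
  have h2 : psi s - psi (a i) <= e * (s - a i).
    have := key i (or_introl erefl); rewrite le_eqVlt in as1; case/orP: as1 => [/eqP ->|as1 h].
      by move=> _; rewrite !subrr mulr0.
    by rewrite -(ler_pM2l (_ : 0 < s - a i)) ?subr_gt0//; rewrite expr2 in h; lra.
  have := aS i; have : e * (a i.+1 - a i) = e / m%:R by rewrite aS.
  by move: h1 h2; lra.
(* The intervals of the partition missing [A j] have small total length. *)
have hbad k : (k <= m)%N ->
    ((\sum_(i <- iota 0 k | ~~ good i) (a i.+1 - a i))%:E <= mu (B j `&` `]0%R, a k]%classic))%E.
  elim: k => [_|k IHk km]; first by rewrite big_nil measure_ge0.
  rewrite -addn1 iotaD add0n big_cat /= big_mkcond [X in (_ + X)%R]big_mkcond big_seq1 -big_mkcond /=.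
  have mI (x y : R) : measurable (B j `&` `]x, y]%classic) by exact: measurableI.
  have -> : B j `&` `]0, a (k + 1)%N]%classic = (B j `&` `]0, a k]%classic) `|` (B j `&` `]a k, a k.+1]%classic).
    rewrite addn1 -setIUr; congr (_ `&` _); apply/seteqP; split => s /=; rewrite !in_itv/=.
      by move=> /andP[s0 sk]; have [ks|ks] := leP s (a k); [left; rewrite s0|right].
    move=> [/andP[s0 sk]|/andP[s0 sk]].
      by rewrite s0 (le_trans sk)// ltW.
    by rewrite sk (le_lt_trans _ s0).
  have dis : (B j `&` `]0, a k]%classic) `&` (B j `&` `]a k, a k.+1]%classic) = set0.
    by apply/seteqP; split => s //= [[_ h1] [_ h2]]; move: h1 h2; rewrite /= !in_itv/=; lra.
  rewrite (measureU mu (mI _ _) (mI _ _) dis).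
  rewrite EFinD leeD//; first by apply: IHk; exact: ltnW.
  case: ifPn => [bk|_]; last exact: measure_ge0.
  have -> : ((a k.+1 - a k)%:E = mu (`]a k, a k.+1[%classic : set R))%E.
    by rewrite lebesgue_measure_itv/= lte_fin aSl.
  apply: leM => // s /=; rewrite in_itv/= => /andP[s1 s2].
  split; last by rewrite /= in_itv/= s1 ltW.
  split; first by rewrite /= (le_lt_trans _ s1)//= (lt_le_trans s2)// a_le1.
  by move=> As; move/negP: bk; apply; apply/asboolP; exists s; rewrite !ltW.
pose I := [seq (a i, a i.+1) | i <- iota 0 m & ~~ good i].
have hI : \sum_(i <- I) `|phi i.2 - phi i.1| < e.
  apply: hd.
  - apply/allP => x /mapP[i]; rewrite mem_filter mem_iota add0n /= => /andP[_ im] -> /=.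
    by rewrite a_ge0 ltW//= a_le1.
  - rewrite pairwise_map; apply: pairwise_filter.
    have : sorted ltn (iota 0 m) by exact: iota_ltn_sorted.
    rewrite sorted_pairwise; last exact: ltn_trans.
    by apply: sub_pairwise => i i' /= ii'; rewrite a_le.
  - rewrite big_map big_filter /=.
    rewrite -lte_fin; apply: le_lt_trans (hbad m (leqnn _)) _.
    by apply: le_lt_trans hj; apply: leM => //; exact: measurableI.
have tel (f : R -> R) : f 1 - f 0 = \sum_(i <- iota 0 m) (f (a i.+1) - f (a i)).
  have /= h := @telescope_sumr R 0 m (f \o a) isT.
  by move: h; rewrite am a0 /index_iota subn0 => <-.
rewrite (tel phi) (tel F).
rewrite (bigID good) /= [X in _ <= X + _](bigID good) /=.
have H1 : \sum_(i <- iota 0 m | good i) (phi (a i.+1) - phi (a i)) <=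
    \sum_(i <- iota 0 m | good i) (F (a i.+1) - F (a i)) + e.
  apply: (@le_trans _ _ (\sum_(i <- iota 0 m | good i) ((F (a i.+1) - F (a i)) + e / m%:R))).
    rewrite big_seq_cond [leRHS]big_seq_cond; apply: ler_sum => i; rewrite mem_iota add0n /= => /andP[im gi].
    by have := hgood i im gi; rewrite /psi; lra.
  rewrite big_split lerD2l.
  apply: (@le_trans _ _ (\sum_(i <- iota 0 m) (e / m%:R))).
    rewrite [X in _ <= X](bigID good) /= lerDl sumr_ge0// => i _.
    by rewrite divr_ge0// ltW.
  rewrite big_const_seq count_predT size_iota iter_addr_0.
  by rewrite -[X in X <= _]mulr_natr divfK// gt_eqF.
have H2 : \sum_(i <- iota 0 m | ~~ good i) (phi (a i.+1) - phi (a i)) <= e.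
  apply: ltW; apply: le_lt_trans hI; rewrite big_map big_filter /=.
  by apply: ler_sum => i _; exact: ler_norm.
have H3 : 0 <= \sum_(i <- iota 0 m | ~~ good i) (F (a i.+1) - F (a i)).
  by apply: sumr_ge0 => i _; rewrite subr_ge0; apply: ndF; exact: ltW.
by lra.
Qed.

End absolute_continuity.

Section cc_lower_bound.
Context {R : realType} {n : nat}.
Local Notation H := (heis R n).
Local Notation E := ('I_n * bool)%type.
Local Notation mu := (@lebesgue_measure R).

(** A curve is controlled on [0, 1] only; precomposing with [clamp] makes it continuous and bounded
    on the whole line. *)
Definition clamp (s : R) : R := Num.max 0 (Num.min s 1).

Lemma clamp01 s : 0 <= clamp s <= 1.
Proof. by rewrite /clamp le_max lexx ge_max ler01 ge_min lexx orbT. Qed.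

Lemma clampE s : 0 <= s <= 1 -> clamp s = s.
Proof. by rewrite /clamp => /andP[s0 s1]; rewrite min_l// max_r. Qed.

Lemma clamp_dist s r : `|clamp s - clamp r| <= `|s - r|.
Proof.
have h (x y : R) : x <= y -> `|clamp x - clamp y| <= `|x - y|.
  move=> xy; rewrite [leRHS]ler0_norm ?subr_le0// opprB ler_norml /clamp.
  by case: (leP x 1) => ?; case: (leP y 1) => ?; case: (leP 0 x) => ?; case: (leP 0 y) => ?;
    case: (leP (0 : R) 1) => ?; lra.
by have [/h//|/ltW/h] := leP s r; rewrite distrC [X in _ <= X]distrC.
Qed.

Lemma ac_uniform (V : normedModType R) (g : R -> V) : abs_continuous 0 1 g ->
  forall e, 0 < e -> exists2 d, 0 < d & forall s r, 0 <= s <= 1 -> 0 <= r <= 1 ->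
    `|s - r| < d -> `|g s - g r| < e.
Proof.
move=> ac e e0; have [d d0 hd] := ac e e0; exists d => // .
have h x y : 0 <= x <= 1 -> 0 <= y <= 1 -> x <= y -> `|x - y| < d -> `|g x - g y| < e.
  move=> /andP[x0 x1] /andP[y0 y1] xy xyd.
  have := hd [:: (x, y)]; rewrite /= !big_seq1 /= x0 xy y1 => /(_ isT isT).
  rewrite [`|g x - _|]distrC; apply.
  by move: xyd; rewrite distrC ger0_norm// subr_ge0.
move=> s r s01 r01; have [sr|/ltW rs] := leP s r; first exact: h.
by rewrite distrC [`|g s - _|]distrC; exact: h.
Qed.

Lemma hnorm_ge0 (v : 'rV[R]_n * 'rV[R]_n) : 0 <= hnorm v.
Proof. exact: sqrtr_ge0. Qed.

Lemma horizontal_sumE (a b : 'rV[R]_n) (xi : H) :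
  \sum_(i < n) (a 0 i *: hX i xi + b 0 i *: hY i xi) =
  \sum_(e : E) (if e.2 then a 0 e.1 else b 0 e.1) *: hE e xi.
Proof.
rewrite (eq_bigr (fun e : E => (if (e.1, e.2).2 then a 0 (e.1, e.2).1 else b 0 (e.1, e.2).1) *: hE (e.1, e.2) xi)); last by case.
rewrite -(pair_bigA _ (fun i b' => (if (i, b').2 then a 0 (i, b').1 else b 0 (i, b').1) *: hE (i, b') xi)) /=.
by apply: eq_bigr => i _; rewrite big_bool.
Qed.

Lemma hnormE (a b : 'rV[R]_n) :
  hnorm (a, b) = Num.sqrt (\sum_(e : E) (if e.2 then a 0 e.1 else b 0 e.1) ^+ 2).
Proof. by rewrite sum_hE. Qed.

(* [f] plays the role of a calibration: bounded horizontal gradient makes it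
   1-Lipschitz for the Carnot-Caratheodory distance. *)
Lemma ccdist_ge (f : H -> R) :
  (forall M, exists2 L, 0 <= L & forall xi zeta : H, `|xi| <= M -> `|zeta| <= M ->
     `|f xi - f zeta| <= L * `|xi - zeta|) ->
  (forall (g : R -> H) (s : R) (w : E -> R),
     is_derive s 1 g (\sum_e w e *: hE e (g s)) ->
     exists2 d, is_derive s 1 (f \o g) d & `|d| <= Num.sqrt (\sum_e w e ^+ 2)) ->
  forall xi zeta : H, ((f xi - f zeta)%:E <= ccdist xi zeta)%E.
Proof.
move=> flip fder xi zeta; apply: le_ereal_inf_tmp => _ [g [a [b [[ac [N [mN N0 hN]]] g0 g1 ->]]]].
pose gc s := g (clamp s).
have cgc : continuous gc.
  move=> s; apply/cvgrPdist_lt => e e0; have [d d0 hd] := ac_uniform ac e0.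
  near=> r; apply: hd; rewrite ?clamp01//; apply: le_lt_trans (clamp_dist _ _) _.
  near: r; exists d => //= r; rewrite /ball_ /=; exact.
have [M hM] : exists M, forall s, `|gc s| <= M.
  have [c _ hc] : exists2 c, c \in `[0, 1] & forall t, t \in `[0, 1] -> `|gc t| <= `|gc c|.
    apply: EVT_max => //; apply: continuous_subspaceT => s.
    by apply: (@continuous_comp _ _ _ gc (fun v => `|v|)); [exact: cgc|exact: norm_continuous].
  exists `|gc c| => s; have cc : clamp (clamp s) = clamp s by rewrite clampE ?clamp01.
  rewrite -[gc s]/(g (clamp s)) -cc; apply: hc.
  by rewrite in_itv/= clamp01.
have [L L0 hL] := flip M.
(* The sign makes phi 1 - phi 0 equal to f xi - f zeta, as the curve runs from [xi] to [zeta]. *)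
pose phi s := - f (gc s).
have cphi : continuous phi.
  move=> s; apply: cvgN; apply/cvgrPdist_lt => e e0.
  have [d d0 hd] : exists2 d, 0 < d & forall r, `|s - r| < d -> `|gc s - gc r| < e / (L + 1).
    have /cvgrPdist_lt := cgc s => /(_ (e / (L + 1))).
    rewrite divr_gt0 ?ltr_pwDr// => /(_ isT) /nbhs_ballP[d d0 hd].
    by exists d => // r sr; exact: hd.
  near=> r; apply: le_lt_trans (hL _ _ (hM s) (hM r)) _.
  have h : `|gc s - gc r| < e / (L + 1).
    by apply: hd; near: r; exists d => //= r; rewrite /ball_ /=; exact.
  apply: (@le_lt_trans _ _ ((L + 1) * `|gc s - gc r|)); first by rewrite ler_wpM2r// lerDl.
  by rewrite mulrC -ltr_pdivlMr// ltr_pwDr.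
have acphi : abs_continuous 0 1 phi.
  move=> e e0; have [d d0 hd] := ac (e / (L + 1)) (divr_gt0 e0 (ltr_pwDr ltr01 L0)).
  exists d => // I I1 I2 I3; have := hd I I1 I2 I3 => h.
  have : \sum_(i <- I) `|phi i.2 - phi i.1| <= (L + 1) * \sum_(i <- I) `|g i.2 - g i.1|.
    rewrite mulr_sumr !big_seq; apply: ler_sum => i iI.
    have /allP/(_ i iI)/= := I1; move=> /andP[/andP[i0 i12] i1].
    have c1 : clamp i.1 = i.1 by rewrite clampE// i0 (le_trans i12).
    have c2 : clamp i.2 = i.2 by rewrite clampE// i1 (le_trans i0).
    rewrite /phi opprK addrC; apply: le_trans (hL _ _ (hM i.1) (hM i.2)) _.
    by rewrite /gc c1 c2 [`|g i.1 - _|]distrC ler_wpM2r// lerDl.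
  by move=> /le_lt_trans; apply; rewrite mulrC -ltr_pdivlMr// ltr_pwDr.
have mphi : measurable_fun setT phi by exact: continuous_measurable_fun.
pose G : set R := [set s | 0 < s < 1] `\` N.
have mG : measurable G.
  apply: measurableD => //.
  by rewrite (_ : [set _ | _] = `]0, 1[%classic)//; apply/seteqP; split => s /=; rewrite in_itv.
have hder s : G s -> exists2 d, is_derive s 1 phi d & `|d| <= hnorm (a s, b s).
  move=> [s01 Ns].
  have hg : is_derive s 1 g (\sum_(i < n) (a s 0 i *: hX i (g s) + b s 0 i *: hY i (g s))).
    by apply: contrapT => h; apply: Ns; apply: hN => /(_ s01).
  rewrite horizontal_sumE in hg.
  have [d hd dle] := fder g s _ hg.
  exists (- d); last by rewrite normrN hnormE.
  have hd' := isd_opp hd.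
  apply: (@near_eq_is_derive R R R (fun r => - (f \o g) r) phi s 1 (- d)) hd'.
  have : \forall r \near s, 0 < r < 1.
    have : \forall r \near s, r \in `]0, 1[ by apply: near_in_itvoo; rewrite in_itv.
    by apply: filterS => r; rewrite in_itv.
  apply: filterS => r /andP[r0 r1]; rewrite /phi /gc /= clampE//.
  by rewrite !ltW.
(* Difference quotients of step 1 / (k + 1): their limit makes the derivative of [phi] measurable,
   which is not known for the controls [a] and [b]. *)
pose q k s := k.+1%:R * (phi (s + k.+1%:R^-1) - phi s).
have mq k : measurable_fun setT (q k).
  apply: measurable_funM => //; apply: measurable_funB => //.
  by apply: (measurableT_comp mphi); exact: measurable_funD.
have [h hE'] : exists h : R -> R, forall s, if s \in G then is_derive s 1 phi (h s) else h s = 0.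
  have ex (s : R) : exists d : R, if s \in G then is_derive s 1 phi d else d = 0.
    have [sG|sG] := boolP (s \in G); last by exists 0.
    by have [d hd _] := hder s (set_mem sG); exists d.
  by exists (fun s => sval (cid (ex s))) => s; exact: (svalP (cid (ex s))).
have mh : measurable_fun setT h.
  apply: (@measurable_fun_cvg _ _ _ setT (fun k => (q k) \_ G)).
    by move=> k; apply/(measurable_restrictT _ _).1 => //; exact: measurable_funTS.
  move=> s _; have := hE' s; case: ifPn => sG hs; last first.
    rewrite hs (_ : (fun k => _) = cst 0); first exact: cvg_cst.
    by apply/funext => k /=; rewrite patchE (negbTE sG).
  rewrite (_ : (fun k => _) = q^~ s); last by apply/funext => k /=; rewrite patchE sG.
  have [c1 c2] := hs.
  have hh : (fun k => k.+1%:R^-1 : R) @ \oo --> (0 : R)^'.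
    move=> P /= nP.
    have hP : \forall k \near \oo, k.+1%:R^-1 != 0 :> R -> P k.+1%:R^-1 by exact: (@cvg_harmonic R _ nP).
    have : \forall k \near \oo, P k.+1%:R^-1 by apply: filterS hP => k; apply; rewrite gt_eqF.
    exact.
  rewrite -c2 /derive; have := cvg_comp _ _ hh c1.
  rewrite (_ : _ \o (fun k => _) = q^~ s)//; apply/funext => k /=.
  rewrite /q invrK /GRing.scale /=; congr (_ * (phi _ - _)).
  by rewrite mulr1 addrC.
(* A measurable function below the speed of the curve; its integral bounds the length from below. *)
pose ah s := `|h s|.
have mah : measurable_fun setT ah by exact: measurableT_comp.
have ahm s : ah s <= hnorm (a s, b s).
  rewrite /ah; have := hE' s; case: ifPn => [/set_mem sG hs|_ ->]; last by rewrite normr0 hnorm_ge0.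
  have [d hd dle] := hder s sG.
  by have [_ <-] := hs; have [_ ->] := hd.
have ahG s : ~ G s -> ah s = 0.
  by move=> nG; rewrite /ah; have := hE' s; rewrite memNset// => ->; rewrite normr0.
have int_le : (\int[mu]_(s in `[0%R, 1%R]) (ah s)%:E <= hlength a b)%E.
  apply: ge0_le_integral_nm => s _; rewrite lee_fin; first exact: normr_ge0.
  exact: ahm.
apply: le_trans int_le.
(* An infinite integral leaves nothing to prove; otherwise [ah] is integrable and has a primitive
   [F] with F' = [ah] almost everywhere. *)
have [->|] := eqVneq (\int[mu]_(s in `[0%R, 1%R]) (ah s)%:E)%E +oo%E; first exact: leey.
rewrite -ltey => intfin.
have int01 : mu.-integrable `[0, 1] (EFin \o ah).
  apply/integrableP; split; first by apply/measurable_EFinP; exact: measurable_funTS.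
  have -> : (fun x => `|(EFin \o ah) x|)%E = (fun s => (ah s)%:E).
    by apply/funext => s; rewrite /= normr_id.
  exact: intfin.
have intT : mu.-integrable setT (EFin \o ah).
  have -> : EFin \o ah = (EFin \o ah) \_ `[0, 1]%classic.
    apply/funext => s; rewrite patchE; case: ifPn => //; rewrite notin_setE/= in_itv/= => /negP s01.
    rewrite ahG// => -[/= /andP[s0 s1] _]; move: s01; rewrite !ltW//.
  have mI : measurable (`[0, 1]%classic : set (measurableTypeR R)) by [].
  by apply/(@integrable_mkcond _ _ _ _ _ (EFin \o (ah : measurableTypeR R -> R)) mI).
have intD (D : set (measurableTypeR R)) : measurable D -> mu.-integrable D (EFin \o ah).
  by move=> mD; apply: (integrableS measurableT mD _ intT).
pose F x := (\int[mu]_(t in [set` Interval (BLeft 0) (BRight x)]) (ah t))%R.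
have ndF : nondecreasing_fun F.
  move=> x y xy; rewrite /F /Rintegral fine_le//.
  - by apply: integrable_fin_num => //; exact: intD.
  - by apply: integrable_fin_num => //; exact: intD.
  - apply: ge0_subset_integral => //.
    + by apply/measurable_EFinP; exact: measurable_funTS.
    + by move=> t _; rewrite lee_fin /ah.
    + by move=> t /=; rewrite !in_itv/= => /andP[-> /le_trans->].
have F1 : (F 1)%:E = (\int[mu]_(s in `[0%R, 1%R]) (ah s)%:E)%E.
  by rewrite /F /Rintegral fineK// integrable_fin_num.
have F0 : 0 <= F 0 by apply: Rintegral_ge0 => s _; rewrite /ah.
have intd (y : itv_bound R) : mu.-integrable [set` Interval (BLeft 0) y] (EFin \o ah).
  exact: intD.
have loc : locally_integrable [set: R] ah.
  by have := @integrable_locally R ah setT measurableT intT; rewrite patch_setT.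
have [N' [mN' N'0 hN']] := @FTC1 R ah (BLeft 0) (fun y => intd (BRight y)) loc.
have : phi 1 - phi 0 <= F 1 - F 0.
  apply: ac_sub_le => //; exists (N `|` N'); split.
  - exact: measurableU.
  - by transitivity (mu N) => //; exact: measureU0.
  - move=> s /= hs; apply: contrapT => /not_orP[Ns N's]; apply: hs => s01.
    have sG : G s by split.
    have := hE' s; rewrite mem_set// => hphi.
    have [hd hF] : derivable F s 1 /\ derive1 F s = ah s.
      by apply: contrapT => hc; apply: N's; apply: hN' => /= /(_ _) hc'; apply: hc; apply: hc'; rewrite ?lte_fin; case/andP: s01.
    exists (h s), (ah s); split; [exact: hphi| |exact: ler_norm].
    by split; [exact: hd|rewrite -derive1E; exact: hF].
rewrite -F1 lee_fin /phi /gc !clampE ?lexx ?ler01// g0 g1 opprK addrC => h1.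
by apply: le_trans h1 _; rewrite gerBl.
Unshelve. all: by end_near. Qed.

End cc_lower_bound.

(** Lagrange's identity: the double sum of the (x_i y_j - x_j y_i)^2 is twice the difference of the
    two sides. *)
Lemma cauchy_schwarz (R : realFieldType) (I : finType) (x y : I -> R) :
  (\sum_i x i * y i) ^+ 2 <= (\sum_i x i ^+ 2) * (\sum_i y i ^+ 2).
Proof.
have h : 0 <= \sum_i \sum_j (x i * y j - x j * y i) ^+ 2.
  by apply: sumr_ge0 => i _; apply: sumr_ge0 => j _; exact: sqr_ge0.
have XY : \sum_i \sum_j x i ^+ 2 * y j ^+ 2 = (\sum_i x i ^+ 2) * (\sum_i y i ^+ 2).
  by rewrite big_distrlr.
have YX : \sum_i \sum_j x j ^+ 2 * y i ^+ 2 = (\sum_i x i ^+ 2) * (\sum_i y i ^+ 2).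
  by rewrite exchange_big /= big_distrlr.
have ZZ : \sum_i \sum_j (x i * y i) * (x j * y j) = (\sum_i x i * y i) ^+ 2.
  by rewrite expr2 big_distrlr.
have E : \sum_i \sum_j (x i * y j - x j * y i) ^+ 2 =
    \sum_i \sum_j x i ^+ 2 * y j ^+ 2 + \sum_i \sum_j x j ^+ 2 * y i ^+ 2
    - 2 * \sum_i \sum_j (x i * y i) * (x j * y j).
  rewrite mulr_sumr -big_split -sumrB; apply: eq_bigr => i _ /=.
  rewrite mulr_sumr -big_split -sumrB; apply: eq_bigr => j _ /=.
  by ring.
by move: h; rewrite E XY YX ZZ; lra.
Qed.

(** * Barriers of a half-space *)

Section barrier_existence.
Context {R : realType} {n : nat}.
Local Notation H := (heis R n).
Local Notation E := ('I_n * bool)%type.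

(** What the soft minimum uses of a barrier. [d2 e] differentiates [d1 e] along the same field only,
    as a divergence contains no mixed derivatives. *)
Record hregular (d : H -> R) (d1 d2 : E -> H -> R) : Prop := HRegular {
  hregular_cont : continuous d;
  hregular_cont1 : forall e, continuous (d1 e);
  hregular_cont2 : forall e, continuous (d2 e);
  hregular_derive : forall e xi, is_derive xi (hE e xi) d (d1 e xi);
  hregular_derive2 : forall e xi, is_derive xi (hE e xi) (d1 e) (d2 e xi);
  hregular_grad : forall xi, \sum_e d1 e xi ^+ 2 <= 1 }.

Section translate.
Variables (a b : 'rV[R]_n) (c k : R) (zeta : H).
Local Notation a' := (a + (2 * c) *: zeta.1.2).
Local Notation b' := (b - (2 * c) *: zeta.1.1).
Local Notation k' := (k - hlin a b c zeta).

(** Left translations are affine and preserve the horizontal fields: they turn a half-space into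
    another with the same c, and N into the N of the new one. Hence [bd] is carried to a function of
    the same form. *)
Lemma hlin_translate xi : hlin a b c (hmul zeta xi) = hlin a b c zeta + hlin a' b' c xi.
Proof.
case: zeta xi => [[x0 y0] t0] [[x y] t].
rewrite /hlin /hmul /= !dotvDr !dotvDl dotvNl.
rewrite (dotvC (_ *: y0)) (dotvC (_ *: x0)) !dotvZr (dotvC x y0) (dotvC y x0).
by ring.
Qed.

Lemma haff_translate xi : haff a b c k (hmul zeta xi) = haff a' b' c k' xi.
Proof. by rewrite /haff hlin_translate; ring. Qed.

Lemma hnormal_translate e xi : hnormal a b c e (hmul zeta xi) = hnormal a' b' c e xi.
Proof.
case: zeta xi => [[x0 y0] t0] [[x y] t]; case: e => i [];
by rewrite /hnormal /= !mxE; ring.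
Qed.

Lemma bd_translate eps xi : bd a b c k eps (hmul zeta xi) = bd a' b' c k' eps xi.
Proof.
rewrite /bd /bT /bQ haff_translate; congr (arc _ (_ / _ + _)).
by apply: eq_bigr => e _; rewrite hnormal_translate.
Qed.

End translate.

(** The left translation in [bdist] is put into the function: [ccdist_ge] is applied to [f] composed
    with left multiplication by [zeta], between zeta^-1 xi and the origin. *)
Lemma ccnorm_ge (f : H -> R) zeta :
  (forall M, exists2 L, 0 <= L & forall xi xi' : H, `|xi| <= M -> `|xi'| <= M ->
     `|f (hmul zeta xi) - f (hmul zeta xi')| <= L * `|xi - xi'|) ->
  (forall (g : R -> H) (s : R) (w : E -> R),
     is_derive s 1 g (\sum_e w e *: hE e (g s)) ->
     exists2 d, is_derive s 1 (fun r => f (hmul zeta (g r))) d &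
       `|d| <= Num.sqrt (\sum_e w e ^+ 2)) ->
  forall xi, ((f xi - f zeta)%:E <= ccnorm (hmul (hinv zeta) xi))%E.
Proof.
move=> h1 h2 xi; have hinvK : hmul zeta (hinv zeta) = 0.
  case: zeta {h1 h2} => [[x y] t]; rewrite /hinv /= -[- x]scaleN1r -[- y]scaleN1r !dotvZr (dotvC y).
  by rewrite !scaleN1r !mulN1r opprK subrr; congr (_, _, _); rewrite ?subrr ?addrN//; ring.
have h0x (z : H) : hmul 0 z = z.
  case: z => [[x y] t] /=; rewrite !(dotvC 0) !dotv0 subrr mulr0 addr0 !add0r//.
have E1 : xi = hmul zeta (hmul (hinv zeta) xi) by rewrite hmulA hinvK h0x.
have E2 : zeta = hmul zeta 0 by rewrite hmulx0.
rewrite [in X in (X%:E <= _)%E]E1 [X in f _ - f X]E2.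
exact: (ccdist_ge (f := fun z => f (hmul zeta z)) h1 h2).
Qed.

Lemma hlin_bound (a b : 'rV[R]_n) c : exists2 C, 0 <= C & forall v : H, `|hlin a b c v| <= C * `|v|.
Proof.
exists (\sum_i `|a 0 i| + \sum_i `|b 0 i| + `|c|).
  by rewrite !addr_ge0// sumr_ge0.
move=> v; rewrite /hlin !mulrDl.
have /and3P[h1 h2 h3] : [&& `|v.1.1| <= `|v|, `|v.1.2| <= `|v| & `|v.2| <= `|v|] by rewrite -heis_norm_le.
have hd (w u : 'rV[R]_n) : `|u| <= `|v| -> `|dotv w u| <= (\sum_i `|w 0 i|) * `|v|.
  move=> uv; apply: le_trans (ler_norm_sum _ _ _) _; rewrite mulr_suml; apply: ler_sum => i _.
  by rewrite normrM ler_wpM2l// (le_trans _ uv)// rV_coord_le.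
apply: le_trans (ler_normD _ _) _; apply: lerD; last by rewrite normrM ler_wpM2l.
by apply: le_trans (ler_normD _ _) _; apply: lerD; exact: hd.
Qed.

Lemma hnormal_lin_bound c e (v : H) : `|hnormal_lin c e v| <= 2 * `|c| * `|v|.
Proof.
have /and3P[h1 h2 h3] : [&& `|v.1.1| <= `|v|, `|v.1.2| <= `|v| & `|v.2| <= `|v|] by rewrite -heis_norm_le.
case: e => i []; rewrite /hnormal_lin /= ?normrN !normrM (ger0_norm (_ : 0 <= 2))// ler_wpM2l ?mulr_ge0//.
  by rewrite (le_trans _ h2)// rV_coord_le.
by rewrite (le_trans _ h1)// rV_coord_le.
Qed.

Lemma haffB (a b : 'rV[R]_n) c k xi zeta : haff a b c k xi - haff a b c k zeta = hlin a b c (xi - zeta).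
Proof. by rewrite /haff hlinB; ring. Qed.

Lemma hnormalB (a b : 'rV[R]_n) c e xi zeta :
  hnormal a b c e xi - hnormal a b c e zeta = hnormal_lin c e (xi - zeta).
Proof.
have := hnormal_line a b c e 1 zeta (xi - zeta); rewrite scale1r addrC subrK => ->.
by ring.
Qed.

Lemma hnormal2_lipschitz (a b : 'rV[R]_n) c M : exists2 L, 0 <= L & forall xi zeta : H,
  `|xi| <= M -> `|zeta| <= M -> `|hnormal2 a b c xi - hnormal2 a b c zeta| <= L * `|xi - zeta|.
Proof.
have h e : exists2 L, 0 <= L & forall xi zeta : H, `|xi| <= M -> `|zeta| <= M ->
    `|hnormal a b c e xi ^+ 2 - hnormal a b c e zeta ^+ 2| <= L * `|xi - zeta|.
  have [C C0 hC] := continuous_bounded M (@continuous_hnormal R n a b c e).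
  exists (2 * `|c| * (C + C)); first by rewrite !mulr_ge0// addr_ge0.
  move=> xi zeta xiM zM; rewrite subr_sqr hnormalB normrM mulrAC.
  apply: ler_pM => //; first exact: hnormal_lin_bound.
  by apply: le_trans (ler_normD _ _) _; apply: lerD; exact: hC.
pose L e := sval (cid2 (h e)).
exists (\sum_e L e).
  by apply: sumr_ge0 => e _; rewrite /L; case: cid2.
move=> xi zeta xiM zM; rewrite /hnormal2 -sumrB mulr_suml.
apply: le_trans (ler_norm_sum _ _ _) _; apply: ler_sum => e _.
by rewrite /L; case: cid2 => l l0 /=; apply.
Qed.

(** The horizontal gradient of [bd] has length at most one, so Cauchy-Schwarz bounds its derivative
    along a curve by the speed. *)
Lemma bd_ccnorm (a b : 'rV[R]_n) c k eps : c != 0 -> 0 < eps -> forall xi zeta,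
  ((bd a b c k eps xi - bd a b c k eps zeta)%:E <= ccnorm (hmul (hinv zeta) xi))%E.
Proof.
move=> c0 eps0 xi zeta; apply: ccnorm_ge.
  move=> M; set a' := a + (2 * c) *: zeta.1.2; set b' := b - (2 * c) *: zeta.1.1.
  set k' := k - hlin a b c zeta.
  have [C1 C10 hC1] := hlin_bound a' b' c.
  have [L L0 hL] := hnormal2_lipschitz a' b' c M.
  have [C C0 hC] := continuous_bounded M (continuous_bT (a := a') (b := b') (c := c) (k := k')).
  have c2 : 0 < 4 * c ^+ 2 by rewrite mulr_gt0// exprn_even_gt0.
  exists ((C1 / `|c| + C / eps ^+ 2 * (L / (4 * c ^+ 2))) / (2 * eps)).
    apply: divr_ge0; last by rewrite mulr_ge0 ?(ltW eps0).
    apply: addr_ge0; first exact: divr_ge0.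
    by apply: mulr_ge0; apply: divr_ge0; rewrite ?sqr_ge0 ?(ltW c2).
  move=> x y xM yM; rewrite !bd_translate -/a' -/b' -/k'.
  apply: le_trans (arc_lipschitz eps0 (bQ_ge a' b' c eps _) (bQ_ge a' b' c eps _) (hC _ yM) (hC _ xM)) _.
  rewrite [X in _ <= X]mulrAC ler_wpM2r// ?invr_ge0 ?mulr_ge0 ?(ltW eps0)// mulrDl; apply: lerD.
    by rewrite /bT -mulrBl haffB normrM normfV normr_id mulrAC ler_wpM2r// invr_ge0.
  rewrite -[leRHS]mulrA ler_wpM2l ?divr_ge0 ?sqr_ge0//.
  rewrite /bQ opprD addrACA subrr addr0 -mulrBl normrM normfV (gtr0_norm c2) mulrAC.
  by rewrite ler_wpM2r ?invr_ge0 ?(ltW c2)// hL.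
move=> g s w dg; set a' := a + (2 * c) *: zeta.1.2; set b' := b - (2 * c) *: zeta.1.1.
set k' := k - hlin a b c zeta.
have -> : (fun r => bd a b c k eps (hmul zeta (g r))) = (fun r => arc (bT a' b' c k' (g r)) (bQ a' b' c eps (g r))).
  by apply/funext => r; rewrite bd_translate.
have hT : is_derive s 1 (fun r => bT a' b' c k' (g r)) (\sum_e w e * bT1 a' b' c e (g s)).
  apply: isd_eq (isd_mul (is_derive_haff_comp a' b' c k' dg) (isd_cst `|c|^-1 s 1)) _.
  rewrite mulr0 addr0 hlin_sum mulr_suml; apply: eq_bigr => e _.
  by rewrite /bT1 mulrA.
have hQ : is_derive s 1 (fun r => bQ a' b' c eps (g r)) (\sum_e w e * bQ1 a' b' c e (g s)).
  apply: isd_eq (isd_add (isd_mul (is_derive_hnormal2_comp a' b' c dg) (isd_cst (4 * c ^+ 2)^-1 s 1)) (isd_cst (eps ^+ 2) s 1)) _.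
  rewrite mulr0 !addr0 mulr_suml; apply: eq_bigr => e _.
  by rewrite /bQ1; field.
have Q0 := bQ_gt0 a' b' c eps0 (g s).
exists (\sum_e w e * bd1 a' b' c k' eps e (g s)).
  apply: isd_eq (is_derive_arc (Q := fun r => bQ a' b' c eps (g r)) Q0 hT hQ) _.
  rewrite mulr_sumr -sumrB mulr_suml; apply: eq_bigr => e _.
  by rewrite /bd1 [RHS]mulrA mulrBr [w e * (_ * bQ1 _ _ _ _ _)]mulrCA.
rewrite -sqrtr_sqr ler_wsqrtr//; apply: le_trans (cauchy_schwarz _ _) _.
rewrite bd1_sqr// ler_piMr ?sumr_ge0// => [e _|]; first exact: sqr_ge0.
exact: bkappa_le1.
Qed.

Section vertical.
Variables (a b : 'rV[R]_n) (k : R).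
Hypothesis ab0 : (a, b, 0 : R) != 0 :> H.
Let nu := Num.sqrt (hnormal2 a b 0 0).

Lemma hnormal_vert e (xi zeta : H) : hnormal a b 0 e xi = hnormal a b 0 e zeta.
Proof. by rewrite /hnormal; case: ifP => _; rewrite !mulr0 !mul0r. Qed.

Lemma hnormal2_vert (xi : H) : hnormal2 a b 0 xi = hnormal2 a b 0 0.
Proof. by apply: eq_bigr => e _; rewrite (hnormal_vert e xi 0). Qed.

Lemma vert_gt0 : 0 < hnormal2 a b 0 0.
Proof.
rewrite lt_neqAle hnormal2_ge0 andbT eq_sym; apply: contraNneq ab0 => /eqP.
rewrite psumr_eq0 => [/allP h|e _]; last exact: sqr_ge0.
have he e : hnormal a b 0 e 0 = 0.
  by have := h e (mem_index_enum e); rewrite /= sqrf_eq0 => /eqP.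
apply/eqP; congr (_, _, _); apply/rowP => i; rewrite mxE.
  by have := he (i, true); rewrite /hnormal /= mulr0 mul0r addr0.
by have := he (i, false); rewrite /hnormal /= mulr0 mul0r subr0.
Qed.

Let nu0 : 0 < nu. Proof. by rewrite sqrtr_gt0 vert_gt0. Qed.
Let nu2 : nu ^+ 2 = hnormal2 a b 0 0. Proof. by rewrite sqr_sqrtr// hnormal2_ge0. Qed.

Lemma vert_sqr (xi : H) : \sum_e (hnormal a b 0 e xi / nu) ^+ 2 = 1.
Proof.
transitivity (hnormal2 a b 0 xi / nu ^+ 2).
  by rewrite /hnormal2 mulr_suml; apply: eq_bigr => e _; rewrite expr_div_n.
by rewrite hnormal2_vert nu2 divff// gt_eqF// vert_gt0.
Qed.

(** For c = 0 the field N is constant, so l / |N| itself has horizontal gradient of length one and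
    vanishing second derivatives. *)
Lemma vert_regular : hregular (fun xi => haff a b 0 k xi / nu) (fun e xi => hnormal a b 0 e xi / nu)
  (fun _ _ => 0).
Proof.
split.
- by move=> xi; apply: cvgM; [exact: continuous_haff|exact: cvg_cst].
- by move=> e xi; apply: cvgM; [exact: continuous_hnormal|exact: cvg_cst].
- by move=> e xi; exact: cvg_cst.
- move=> e xi; apply: isd_eq (isd_mul (is_derive_haff a b 0 k e xi) (isd_cst nu^-1 _ _)) _.
  by rewrite mulr0 addr0.
- move=> e xi; apply: isd_eq (isd_mul (is_derive_hnormal a b 0 e e xi) (isd_cst nu^-1 _ _)) _.
  by rewrite hconj_neq !mul0r mulr0 addr0.
- by move=> xi; rewrite vert_sqr.
Qed.

Lemma vert_ccnorm (xi zeta : H) :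
  ((haff a b 0 k xi / nu - haff a b 0 k zeta / nu)%:E <= ccnorm (hmul (hinv zeta) xi))%E.
Proof.
apply: (@ccnorm_ge (fun xi => haff a b 0 k xi / nu)).
  move=> M; set a' := a + (2 * 0) *: zeta.1.2; set b' := b - (2 * 0) *: zeta.1.1.
  set k' := k - hlin a b 0 zeta.
  have [C1 C10 hC1] := hlin_bound a' b' 0.
  exists (C1 / nu); first by rewrite divr_ge0// ltW.
  move=> x y _ _; rewrite !haff_translate -/a' -/b' -/k' -mulrBl haffB normrM normfV (gtr0_norm nu0) mulrAC.
  by rewrite ler_wpM2r// invr_ge0 ltW.
move=> g s w dg; set a' := a + (2 * 0) *: zeta.1.2; set b' := b - (2 * 0) *: zeta.1.1.
set k' := k - hlin a b 0 zeta.
have -> : (fun r => haff a b 0 k (hmul zeta (g r)) / nu) = (fun r => haff a' b' 0 k' (g r) / nu).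
  by apply/funext => r; rewrite haff_translate.
exists (\sum_e w e * (hnormal a b 0 e (hmul zeta (g s)) / nu)).
  apply: isd_eq (isd_mul (is_derive_haff_comp a' b' 0 k' dg) (isd_cst nu^-1 s 1)) _.
  rewrite mulr0 addr0 hlin_sum mulr_suml; apply: eq_bigr => e _.
  by rewrite [hnormal a b 0 e (hmul _ _)]hnormal_translate mulrA.
rewrite -sqrtr_sqr ler_wsqrtr//; apply: le_trans (cauchy_schwarz _ _) _.
by rewrite vert_sqr mulr1.
Qed.

End vertical.

(** The third clause is the supersolution inequality with loss eta, stated on a compact set because
    eps is chosen from the minimum of l there. The last clause bounds the barrier near the
    hyperplane uniformly in eps, since eps shrinks with eta and [K]. *)
Lemma exists_barrier (a b : 'rV[R]_n) c k p eta (K : set H) : (0 < n)%N ->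
  (a, b, c) != 0 -> 1 < p -> 0 < eta -> compact K ->
  (forall xi, K xi -> 0 < haff a b c k xi) ->
  exists d d1 d2, [/\ hregular d d1 d2,
    forall xi, 0 < haff a b c k xi -> 0 < d xi,
    forall xi, K xi -> (p - 1) * (1 - eta) <=
       - d xi * \sum_e d2 e xi + (p - 1) * \sum_e d1 e xi ^+ 2,
    forall xi zeta, ((d xi - d zeta)%:E <= ccnorm (hmul (hinv zeta) xi))%E &
    forall zeta, 0 <= haff a b c k zeta ->
      d zeta ^+ 2 * `|c| <= 2 * haff a b c k zeta /\
      d zeta * Num.sqrt (hnormal2 a b c zeta) <= 2 * haff a b c k zeta].
Proof.
move=> n0 abc0 p1 eta0 cK hK.
have p10 : 0 < p - 1 by rewrite subr_gt0.
have [c0|c0] := eqVneq c 0.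
  rewrite c0 in abc0 hK *; have N0 := vert_gt0 abc0.
  have nu0 : 0 < Num.sqrt (hnormal2 a b 0 0) by rewrite sqrtr_gt0.
  exists (fun xi => haff a b 0 k xi / Num.sqrt (hnormal2 a b 0 0)),
    (fun e xi => hnormal a b 0 e xi / Num.sqrt (hnormal2 a b 0 0)), (fun _ _ => 0).
  split.
  - exact: vert_regular.
  - by move=> xi h; rewrite divr_gt0.
  - move=> xi _; rewrite vert_sqr// big1// mulr0 add0r.
    by rewrite ler_wpM2l ?(ltW p10)// gerBl ltW.
  - by move=> xi zeta; exact: vert_ccnorm.
  - move=> zeta h; rewrite normr0 mulr0 mulr_ge0//; split => //.
    rewrite (hnormal2_vert a b zeta) divfK ?gt_eqF//; lra.
have [h0 h00 hmin] : exists2 h0, 0 < h0 & forall xi, K xi -> h0 <= haff a b c k xi.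
  have [->|/set0P K0] := eqVneq K set0; first by exists 1.
  have [x Kx hx] := compact_EVT_min K0 cK (continuous_subspaceT (@continuous_haff _ _ a b c k)).
  exists (haff a b c k x); first by apply: hK; exact: set_mem.
  by move=> xi Kxi; apply: hx; exact: mem_set.
(* As M >= 1, atan M >= pi / 4 >= 1 / 2, so M atan M >= (p - 1) / 2: from v >= M on, the bound 2 (1
   - kappa) v atan v compensates the loss (p - 1) (1 - kappa). *)
pose M := p + 1; have M1 : 1 <= M by rewrite /M; lra.
have M0 : 0 < M by lra.
have aM : 1 / 2 <= atan M.
  apply: (@le_trans _ _ (atan 1)); last exact: le_atan.
  by rewrite atan1; have := @pi_ge2 R; lra.
have hMp : (p - 1) / 2 <= M * atan M.
  by have := ler_wpM2l (ltW M0) aM; rewrite /M; lra.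
have prM : 0 < prof M := lt_le_trans M0 (prof_ge (ltW M0)).
have nc0 : 0 < `|c| by rewrite normr_gt0.
(* If eps^2 / Q > eta, then T / Q >= (h0 / |c|) eta / eps^2 >= prof M, that is v >= M. The minimum
   with 1 gives eps^2 <= eps. *)
pose eps := Num.min 1 (h0 / `|c| * eta / prof M).
have eps0 : 0 < eps by rewrite lt_min ltr01 divr_gt0// mulr_gt0// divr_gt0.
have eps2 : eps ^+ 2 <= h0 / `|c| * eta / prof M.
  apply: (@le_trans _ _ eps); last by rewrite /eps ge_min lexx orbT.
  by rewrite expr2 ler_piMr ?(ltW eps0)// /eps ge_min lexx.
exists (bd a b c k eps), (bd1 a b c k eps), (bd2 a b c k eps); split.
- split.
  + exact: continuous_bd.
  + exact: continuous_bd1.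
  + exact: continuous_bd2.
  + exact: is_derive_bd.
  + exact: is_derive_bd1.
  + by move=> xi; rewrite bd1_sqr//; exact: bkappa_le1.
- by move=> xi; exact: bd_gt0.
- move=> xi Kxi; have hxi := hK xi Kxi; rewrite bd1_sqr//.
  have lap := laplacian_bd_ge c0 eps0 n0 hxi.
  have k1 := bkappa_le1 a b c eps0 xi.
  have v0 := bv_gt0 c0 eps0 hxi.
  have va0 := mul_atan_ge0 (bv a b c k eps xi).
  have Q0 := bQ_gt0 a b c eps0 xi.
  have [small|big] := leP (eps ^+ 2 / bQ a b c eps xi) eta.
    have : 0 <= 2 * (1 - bkappa a b c eps xi) * (bv a b c k eps xi * atan (bv a b c k eps xi)).
      by rewrite mulr_ge0// mulr_ge0// subr_ge0.
    have : (p - 1) * (1 - eta) <= (p - 1) * bkappa a b c eps xi.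
      by rewrite ler_wpM2l ?(ltW p10)// bkappaE// lerB.
    by lra.
  have Mv : M <= bv a b c k eps xi.
    rewrite -[M]profK prof_inv_le ler_pdivlMr//.
    have hT : h0 / `|c| <= bT a b c k xi by rewrite ler_wpM2r ?invr_ge0//; exact: hmin.
    apply: le_trans hT; rewrite mulrC -ler_pdivlMr//.
    move: big; rewrite ltr_pdivlMr// => big.
    rewrite -(ler_pM2l eta0); apply/ltW/(lt_le_trans big)/(le_trans eps2).
    by rewrite mulrAC [leRHS]mulrC.
  have : (p - 1) / 2 <= bv a b c k eps xi * atan (bv a b c k eps xi).
    apply: le_trans hMp _; apply: ler_pM => //; first exact: ltW.
      exact/atan_ge0/ltW.
    exact: le_atan.
  move: lap va0 k1; set A := _ * atan _; set X := - bd _ _ _ _ _ _ * _; set ka := bkappa _ _ _ _ _.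
  move=> lap va0 k1 hA.
  have : 2 * (1 - ka) * ((p - 1) / 2) <= 2 * (1 - ka) * A by rewrite ler_wpM2l// mulr_ge0// subr_ge0.
  have : 0 <= (p - 1) * eta by exact: mulr_ge0 (ltW p10) (ltW eta0).
  by lra.
- exact: bd_ccnorm.
- move=> zeta h; split; last exact: bd_normal_le.
  have := bd_sqr_le eps0 h; rewrite /bT => /(ler_wpM2r (ltW nc0)).
  by rewrite -[X in _ <= X -> _]mulrA divfK// gt_eqF.
Qed.

End barrier_existence.

(** * The Hardy inequality for a finite family of half-spaces *)

Section powers.
Context {R : realType}.
Implicit Types (p q r : R).

Lemma continuous_normpow q : 0 < q -> continuous (fun r : R => `|r| `^ q).
Proof.
move=> q0 r; have [->|r0] := eqVneq r 0.
  rewrite /continuous_at normr0 powR0 ?gt_eqF//; apply/cvgrPdist_lt => e e0.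
  have d0 : 0 < e `^ q^-1 by rewrite powR_gt0.
  apply/nbhs_ballP; exists (e `^ q^-1) => //= y; rewrite /ball /= !sub0r !normrN => yd.
  rewrite ger0_norm ?powR_ge0//.
  have := gt0_ltr_powR q0 _ _ yd; rewrite !nnegrE normr_ge0 powR_ge0 => /(_ isT isT).
  by rewrite -powRrM mulVf ?gt_eqF// powRr1// ltW.
apply: (@continuous_comp _ _ _ (fun r : R => `|r|) (fun r => r `^ q)); first exact: norm_continuous.
by apply: isd_continuous (is_derive1_powR _ _); rewrite normr_gt0.
Qed.

(* [p |r|^(p-1) sgn r], written through the positive and negative parts of [r]. *)
Definition normpow1 p r : R :=
  p * (`|(r + `|r|) / 2| `^ (p - 1) - `|(r - `|r|) / 2| `^ (p - 1)).

Lemma continuous_normpow1 p : 1 < p -> continuous (normpow1 p).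
Proof.
move=> p1 r; have p10 : 0 < p - 1 by rewrite subr_gt0.
apply: cvgM; first exact: cvg_cst.
apply: cvgB.
  apply: (@continuous_comp _ _ _ (fun r : R => (r + `|r|) / 2) (fun r => `|r| `^ (p - 1))).
    apply: cvgM; last exact: cvg_cst.
    by apply: cvgD; [exact: cvg_id|exact: norm_continuous].
  exact: continuous_normpow.
apply: (@continuous_comp _ _ _ (fun r : R => (r - `|r|) / 2) (fun r => `|r| `^ (p - 1))).
  apply: cvgM; last exact: cvg_cst.
  by apply: cvgB; [exact: cvg_id|exact: norm_continuous].
exact: continuous_normpow.
Qed.

Lemma normpow1_ge0 p r : 1 < p -> 0 <= r -> normpow1 p r = p * r `^ (p - 1).
Proof.
move=> p1 r0; have p10 : p - 1 != 0 by rewrite gt_eqF// subr_gt0.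
rewrite /normpow1 (ger0_norm r0) subrr mul0r normr0 (powR0 p10) subr0.
have -> : (r + r) / 2 = r by field.
by rewrite ger0_norm.
Qed.

Lemma normpow1N p r : normpow1 p (- r) = - normpow1 p r.
Proof.
rewrite /normpow1 normrN.
have -> : (- r + `|r|) / 2 = - ((r - `|r|) / 2) by field.
have -> : (- r - `|r|) / 2 = - ((r + `|r|) / 2) by field.
by rewrite !normrN -mulrN opprB.
Qed.

Lemma normpow1_norm p r : 1 < p -> `|normpow1 p r| = p * `|r| `^ (p - 1).
Proof.
move=> p1; wlog r0 : r / 0 <= r => [h|].
  have [|/ltW r0] := leP 0 r; first exact: h.
  by rewrite -normrN -normpow1N h ?oppr_ge0// normrN.
by rewrite normpow1_ge0// ger0_norm ?(ger0_norm r0)// mulr_ge0 ?powR_ge0//; lra.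
Qed.

Lemma is_derive_normpow p r : 1 < p ->
  is_derive r 1 (fun r : R => `|r| `^ p) (normpow1 p r).
Proof.
move=> p1; have p10 : p - 1 != 0 by rewrite gt_eqF// subr_gt0.
have p0 : 0 < p by lra.
have [r0|r0|->] := ltgtP r 0.
- apply: (@near_eq_is_derive _ _ _ (fun r : R => (- r) `^ p)).
  + near=> y; rewrite ltr0_norm//; near: y; exact: lt_nbhsl.
  + apply: isd_eq (isd_powR p _ (isd_opp (is_derive_id r 1))) _; first by rewrite oppr_gt0.
    by rewrite -[r in RHS]opprK normpow1N normpow1_ge0 ?oppr_ge0 ?(ltW r0)// mulrN1.
- apply: (@near_eq_is_derive _ _ _ (fun r : R => r `^ p)).
  + near=> y; rewrite gtr0_norm//; near: y; exact: lt_nbhsr.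
  + apply: isd_eq (isd_powR p r0 (is_derive_id r 1)) _.
    by rewrite normpow1_ge0 ?(ltW r0)// mulr1.
have -> : normpow1 p 0 = 0 by rewrite /normpow1 normr0 addr0 subr0 mul0r normr0 powR0// subr0 mulr0.
(* At the origin the quotient has absolute value |h|^(p - 1), which tends to 0 because p > 1. *)
have h : (fun h : R => h^-1 * (`|h * 1 + 0| `^ p - `|0 : R| `^ p)) @ 0^' --> (0 : R).
  have h0 : (fun h : R => `|h| `^ (p - 1)) @ 0^' --> (0 : R).
    have q0 : 0 < p - 1 by rewrite subr_gt0.
    have := @continuous_normpow (p - 1) q0 0; rewrite /continuous_at normr0 powR0// => c0.
    exact: (cvg_trans (cvg_app _ (@nbhs_dnbhs _ _)) c0).
  apply/cvgrPdist_lt => e e0; move/cvgrPdist_lt : h0 => /(_ e e0); apply: filterS => y.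
  rewrite !sub0r !normrN addr0 normr0 powR0 ?gt_eqF// subr0.
  have [->|y0] := eqVneq y 0; first by rewrite invr0 mul0r normr0.
  rewrite ger0_norm ?powR_ge0// => ye; rewrite mulr1 normrM normrV ?unitfE//.
  rewrite (ger0_norm (powR_ge0 _ _)) -(mulr_powRB1 _ p0)// mulrA mulVf ?normr_eq0// mul1r//.
apply: DeriveDef; first by apply/cvg_ex; exists 0.
exact: cvg_lim.
Unshelve. all: by end_near. Qed.

End powers.

Section smooth_gradient.
Context {R : realType} {n : nat}.
Local Notation H := (heis R n).
Local Notation E := ('I_n * bool)%type.

(** [smooth] speaks of directional derivatives one direction at a time; their additivity, needed for
    fields with variable coefficients, comes from the mean value theorem in direction [w] and the
    continuity of the derivative along [w]. *)
Lemma is_derive_add_dir (V : normedModType R) (u u' : V -> R) (x v w : V) (s dv : R) :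
  is_derive x v u dv -> (forall y, is_derive y w u (u' y)) -> {for x, continuous u'} ->
  is_derive x (v + s *: w) u (dv + s * u' x).
Proof.
move=> hv hw cu.
have hq : (fun h : R => h^-1 *: (u (h *: v + x) - u x)) @ 0^' --> dv.
  by case: hv => ex <-; exact: ex.
have hr : (fun h : R => h^-1 *: (u (h *: (v + s *: w) + x) - u (h *: v + x))) @ 0^' --> s * u' x.
  apply/cvgrPdist_lt => e e0.
  have [d d0 hd] : exists2 d, 0 < d & forall y : V, `|y - x| < d -> `|u' x - u' y| < e / (1 + `|s|).
    have e1 : 0 < e / (1 + `|s|) by rewrite divr_gt0// ltr_pwDl.
    move/cvgrPdist_lt : cu => /(_ _ e1) /nbhs_ballP[d /= d0 hd]; exists d => // y yd.
    by apply: hd; rewrite -ball_normE /= distrC.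
  have vs0 : 0 < 1 + `|v| + `|s *: w| by rewrite -addrA ltr_pwDl// addr_ge0.
  apply/nbhs_ballP; exists (d / (1 + `|v| + `|s *: w|)) => /=; first by rewrite divr_gt0.
  move=> h; rewrite /ball /= sub0r normrN => hh h0.
  pose y := h *: v + x.
  have D (r : R) : is_derive r 1 (fun r => u (y + (h * s * r) *: w)) (u' (y + (h * s * r) *: w) * (h * s)).
    have H1 (r0 : R) : is_derive r0 1 (fun r => u (y + r *: w)) (u' (y + r0 *: w)).
      exact: (proj1 (is_derive_line u y w r0 _) (hw _)).
    have H2 : is_derive r 1 (fun r => h * s * r) (h * s).
      by apply: isd_eq (isd_mul (isd_cst (h * s) r 1) (is_derive_id r 1)) _; rewrite mul0r add0r mulr1.
    exact: isd_comp (H1 _) H2.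
  have [c cI] := @MVT_segment R _ _ 0 1 ler01 (fun x _ => D x) (continuous_subspaceT (fun x => isd_continuous (D x))).
  rewrite (mulr1 (h * s)) (mulr0 (h * s)) scale0r addr0 subr0 mulr1 -(scalerA h).
  have -> : y + h *: (s *: w) = h *: (v + s *: w) + x by rewrite /y scalerDr addrAC.
  rewrite -/y => ->.
  have -> : h^-1 *: (u' (y + (h * s * c) *: w) * (h * s)) = s * u' (y + (h * s * c) *: w).
    by rewrite /GRing.scale /=; field.
  rewrite -mulrBr normrM.
  have hc : `|u' x - u' (y + (h * s * c) *: w)| < e / (1 + `|s|).
    apply: hd; have -> : y + (h * s * c) *: w - x = h *: (v + c *: (s *: w)).
      by rewrite /y addrAC addrK scalerDr !scalerA mulrAC -mulrA mulrCA !mulrA.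
    rewrite normrZ; apply: (@le_lt_trans _ _ (`|h| * (1 + `|v| + `|s *: w|))); last by rewrite -ltr_pdivlMr.
    rewrite ler_wpM2l// -addrA (le_trans (ler_normD _ _))// normrZ addrCA lerD// .
    move: cI; rewrite in_itv /= => /andP[c0 c1].
    rewrite (ger0_norm c0) (@le_trans _ _ (1 * `|s *: w|)) ?ler_wpM2r// mul1r lerDr//.
  apply: (@le_lt_trans _ _ (`|s| * (e / (1 + `|s|)))); first by rewrite ler_wpM2l// ltW.
  by rewrite mulrCA gtr_pMr// ltr_pdivrMr ?mul1r ?ltrDr// ltr_pwDl.
have h : (fun h : R => h^-1 *: (u (h *: (v + s *: w) + x) - u x)) @ 0^' --> dv + s * u' x.
  rewrite (_ : (fun h : R => _) = (fun h : R => h^-1 *: (u (h *: v + x) - u x)) \+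
     (fun h : R => h^-1 *: (u (h *: (v + s *: w) + x) - u (h *: v + x)))); first exact: cvgD.
  by apply/funext => h /=; rewrite /GRing.scale /=; ring.
apply: DeriveDef; first by apply/cvg_ex; exists (dv + s * u' x).
exact: cvg_lim.
Qed.

Definition hdir (e : E) : H := if e.2 then (delta_mx 0 e.1, 0, 0) else (0, delta_mx 0 e.1, 0).
Definition hvert : H := (0, 0, 1).

Lemma hE_dir e (xi : H) : hE e xi =
  hdir e + (if e.2 then 2 * xi.1.2 0 e.1 else - (2 * xi.1.1 0 e.1)) *: hvert.
Proof.
case: e => i [] /=; rewrite /hE /hdir /hvert /hX /hY /=; congr (_, _, _) => /=.
- by rewrite scaler0 addr0.
- by rewrite scaler0 addr0.
- by rewrite add0r /GRing.scale /= mulr1.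
- by rewrite scaler0 addr0.
- by rewrite scaler0 addr0.
- by rewrite add0r /GRing.scale /= mulr1.
Qed.

Variable u : H -> R.
Hypothesis su : smooth u.

Definition hder e (xi : H) : R := 'D_(hE e xi) u xi.

Lemma smooth_continuous : continuous u. Proof. by case: (su [::]). Qed.

Lemma smooth_is_derive (xi v : H) : is_derive xi v u ('D_v u xi).
Proof. by apply: derivableP; case: (su [::]). Qed.

Lemma is_derive_hder e xi : is_derive xi (hE e xi) u (hder e xi).
Proof. exact: smooth_is_derive. Qed.

Lemma hderE e xi : hder e xi = 'D_(hdir e) u xi +
  (if e.2 then 2 * xi.1.2 0 e.1 else - (2 * xi.1.1 0 e.1)) * 'D_hvert u xi.
Proof.
rewrite /hder hE_dir; apply: derive_val.
apply: (@is_derive_add_dir _ u ('D_hvert u) xi (hdir e) hvert _ _ (smooth_is_derive _ _)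
  (fun y => smooth_is_derive y hvert)).
by case: (su [:: hvert]) => /(_ xi).
Qed.

Lemma continuous_hder e : continuous (hder e).
Proof.
have -> : hder e = (fun xi => 'D_(hdir e) u xi +
  (if e.2 then 2 * xi.1.2 0 e.1 else - (2 * xi.1.1 0 e.1)) * 'D_hvert u xi).
  by apply/funext => xi; exact: hderE.
move=> xi; apply: cvgD; first by case: (su [:: hdir e]) => /(_ xi).
apply: cvgM; last by case: (su [:: hvert]) => /(_ xi).
case: e => i [] /=; [|apply: cvgN]; (apply: cvgM; first exact: cvg_cst).
  exact: continuous_coordy.
exact: continuous_coordx.
Qed.

Lemma hgradE xi : hnorm (hgrad u xi) = Num.sqrt (\sum_e hder e xi ^+ 2).
Proof.
by rewrite hnormE; congr (Num.sqrt _); apply: eq_bigr => -[i []] _ /=; rewrite mxE.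
Qed.

Lemma hder_supp e xi : ~ tsupport u xi -> hder e xi = 0.
Proof.
move=> h; rewrite /hder; rewrite (@near_eq_derive _ _ _ u (cst 0)); first exact: derive_cst.
have : nbhs xi (~` tsupport u) by apply: open_nbhs_nbhs; split => //; exact/closed_openC/closed_closure.
apply: filterS => y hy; apply: contra_notP hy => /eqP uy; exact: subset_closure.
Qed.

Lemma supp_eq0 xi : ~ tsupport u xi -> u xi = 0.
Proof. by move=> h; apply: contra_notP h => /eqP ux; exact: subset_closure. Qed.

End smooth_gradient.

Section softmin_algebra.
Context {R : realType}.

Lemma powRDp (x a b : R) : 0 < x -> x `^ (a + b) = x `^ a * x `^ b.
Proof. by move=> x0; rewrite powRD// (gt_eqF x0) implybT. Qed.

(** Young's inequality with exponents p and p / (p - 1) for A x^((1 - p) / p) and (Y x^(1/p))^(p -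
    1), in whose product x cancels. The free weight [x] is set to (p - 1) / p at the end. *)
Lemma powR_young (p x A Y : R) : 1 < p -> 0 < x -> 0 <= A -> 0 <= Y ->
  p * A * Y `^ (p - 1) <= A `^ p * x `^ (1 - p) + (p - 1) * x * Y `^ p.
Proof.
move=> p1 x0 A0 Y0; have p0 : 0 < p by lra.
have pn0 : p != 0 by rewrite gt_eqF.
have q0 : 0 < p - 1 by rewrite subr_gt0.
have qn0 : p - 1 != 0 by rewrite gt_eqF.
have := @conjugate_powR R (A * x `^ ((1 - p) / p)) ((Y * x `^ p^-1) `^ (p - 1)) p (p / (p - 1)).
rewrite mulr_ge0 ?powR_ge0// divr_gt0// => /(_ isT isT p0 isT).
have -> : p^-1 + (p / (p - 1))^-1 = 1 by field; rewrite qn0 pn0.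
move=> /(_ erefl).
rewrite !powRM ?powR_ge0// -!powRrM.
have -> : (1 - p) / p * p = 1 - p by field.
have -> : (p - 1) * (p / (p - 1)) = p by field.
have -> : p^-1 * (p - 1) * (p / (p - 1)) = 1 by field; rewrite qn0 pn0.
rewrite (powRr1 (ltW x0)).
have -> : A * x `^ ((1 - p) / p) * (Y `^ (p - 1) * x `^ (p^-1 * (p - 1))) = A * Y `^ (p - 1).
  rewrite mulrACA -powRDp//.
  have -> : (1 - p) / p + p^-1 * (p - 1) = 0 by field.
  by rewrite powRr0 mulr1.
move=> /(ler_wpM2l (ltW p0)); rewrite mulrA => /le_trans; apply.
rewrite le_eqVlt; apply/orP; left; apply/eqP; field; rewrite qn0 pn0//.
Qed.

(** Jensen's inequality for the t-th power: the tangent line at the mean [M], an instance of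
    [powR_young], is summed over [I]. *)
Lemma power_mean (I : finType) (a : I -> R) (t : R) : 1 < t -> (forall i, 0 < a i) ->
  (#|I|%:R) `^ (1 - t) * (\sum_i a i) `^ t <= \sum_i a i `^ t.
Proof.
move=> t1 a0; have t0 : 0 < t by lra.
have [I0|I0] := posnP #|I|.
  rewrite big_pred0 => [|i]; last by have := card0_eq I0 i.
  by rewrite powR0 ?gt_eqF// mulr0 sumr_ge0// => i _; exact: powR_ge0.
have N0 : 0 < #|I|%:R :> R by rewrite ltr0n.
have S0 : 0 < \sum_i a i.
  have /card_gt0P[i _] := I0; rewrite (bigD1 i)//= ltr_pwDl// sumr_ge0// => j _.
  exact: ltW.
set N : R := #|I|%:R in N0 *; set S := \sum_i a i in S0 *.
pose M := S / N; have M0 : 0 < M by rewrite divr_gt0.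
have h i : t * a i * M `^ (t - 1) <= a i `^ t + (t - 1) * M `^ t.
  have := powR_young t1 ltr01 (ltW (a0 i)) (ltW M0); rewrite powR1 mulr1 mulr1.
  exact.
have : \sum_i t * a i * M `^ (t - 1) <= \sum_i (a i `^ t + (t - 1) * M `^ t) by apply: ler_sum.
rewrite -mulr_suml -mulr_sumr -/S big_split /= sumr_const cardT -cardE -mulr_natl -/N.
have E1 : S * M `^ (t - 1) = N * M `^ t.
  rewrite -(mulr_powRB1 (ltW M0) t0) mulrA; congr (_ * _).
  by rewrite /M mulrCA divff ?mulr1// gt_eqF.
have -> : N `^ (1 - t) * S `^ t = N * M `^ t.
  have -> : S = N * M by rewrite /M mulrCA divff ?mulr1// gt_eqF.
  rewrite powRM ?ltW// mulrA -powRDp// subrK powRr1// ltW//.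
rewrite -mulrA E1; lra.
Qed.

Section pointwise.
Variables (I E : finType) (d : I -> R) (a b : I -> E -> R) (p q m : R).
Hypotheses (d0 : forall i, 0 < d i) (p1 : 1 < p) (pq : p <= q) (m0 : 0 <= m) (i0 : I).
Hypothesis a1 : forall i, \sum_e a i e ^+ 2 <= 1.
Hypothesis ab : forall i, m <= - d i * \sum_e b i e + (p - 1) * \sum_e a i e ^+ 2.

(* [d], [a], [b] stand for the [d_i], their first and their second horizontal
   derivatives at a point; [P1] and [V1] are the derivatives of [P] and [V]. *)
Definition smS := \sum_i d i `^ (- q).
Definition smP e := \sum_i d i `^ (- q - 1) * a i e.
Definition smP1 e := \sum_i ((- q - 1) * d i `^ (- q - 2) * a i e ^+ 2 + d i `^ (- q - 1) * b i e).
(** For a single d this exponent makes V equal to d^(1 - p) grad d, the field of the one-barrier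
    proof. *)
Definition smr := (q + 2 - p) / q.
Definition smV e := smS `^ (- smr) * smP e.
Definition smV1 e := smr * q * smS `^ (- smr - 1) * smP e ^+ 2 + smS `^ (- smr) * smP1 e.

Let q0 : 0 < q. Proof. exact: lt_le_trans (lt_trans ltr01 p1) pq. Qed.
Let r0 : 0 <= smr * q.
Proof. by rewrite /smr divfK ?(gt_eqF q0)// addrAC addr_ge0// subr_ge0. Qed.

Lemma smS_gt0 : 0 < smS.
Proof.
rewrite /smS (bigD1 i0)//= ltr_pwDl ?powR_gt0// sumr_ge0// => j _.
exact: powR_ge0.
Qed.

Let w i := d i `^ (- q - 2).
Let w0 i : 0 <= w i. Proof. exact: powR_ge0. Qed.

(** Cauchy-Schwarz after splitting d^(-q-1) as d^(-q/2) times d^(-q/2-1). *)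
Lemma smP_sqr e : smP e ^+ 2 <= smS * \sum_i w i * a i e ^+ 2.
Proof.
have := @cauchy_schwarz R I (fun i => d i `^ (- (q / 2))) (fun i => d i `^ (- (q / 2) - 1) * a i e).
have -> : \sum_i d i `^ (- (q / 2)) * (d i `^ (- (q / 2) - 1) * a i e) = smP e.
  apply: eq_bigr => i _; rewrite mulrA -powRDp//; congr (_ `^ _ * _); by field.
have -> : \sum_i d i `^ (- (q / 2)) ^+ 2 = smS.
  by apply: eq_bigr => i _; rewrite expr2 -powRDp//; congr (_ `^ _); field.
congr (_ <= _ * _); apply: eq_bigr => i _; rewrite exprMn expr2 -powRDp//.
by congr (_ `^ _ * _); field.
Qed.

Lemma sum_smP_sqr : \sum_e smP e ^+ 2 <= smS * \sum_i w i * \sum_e a i e ^+ 2.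
Proof.
apply: (@le_trans _ _ (\sum_e (smS * \sum_i w i * a i e ^+ 2))).
  by apply: ler_sum => e _; exact: smP_sqr.
rewrite -mulr_sumr ler_wpM2l ?(ltW smS_gt0)// exchange_big /=.
by apply: ler_sum => i _; rewrite mulr_sumr.
Qed.

Let wE i : w i = (d i `^ (- q)) `^ ((q + 2) / q).
Proof. by rewrite -powRrM /w; congr (_ `^ _); field; rewrite (gt_eqF q0). Qed.

(** Each d_i^(-q) is at most S and (q + 2) / q >= 1, so the sum of the weights d_i^(-q-2) is at most
    S^((q+2)/q); the exponents of S then add up to 2 (p - 1) / q. *)
Lemma smV_sqr : \sum_e smV e ^+ 2 <= (smS `^ ((p - 1) / q)) ^+ 2.
Proof.
have S0 := smS_gt0; have qn0 : q != 0 by rewrite (gt_eqF q0).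
have t0 : 0 < (q + 2) / q by rewrite divr_gt0// addr_gt0.
have hw : \sum_i w i <= smS `^ ((q + 2) / q).
  rewrite -(mulr_powRB1 (ltW S0) t0) {1}/smS mulr_suml; apply: ler_sum => i _.
  rewrite wE -(mulr_powRB1 (powR_ge0 _ _) t0) ler_wpM2l ?powR_ge0//.
  have t10 : 0 <= (q + 2) / q - 1.
    by rewrite subr_ge0 ler_pdivlMr// mul1r lerDl.
  apply: ge0_ler_powR => //; rewrite ?nnegrE ?powR_ge0 ?(ltW S0)//.
  by rewrite /smS (bigD1 i)//= lerDl sumr_ge0// => j _; exact: powR_ge0.
have -> : \sum_e smV e ^+ 2 = (smS `^ (- smr)) ^+ 2 * \sum_e smP e ^+ 2.
  by rewrite mulr_sumr; apply: eq_bigr => e _; rewrite exprMn.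
have -> : (smS `^ ((p - 1) / q)) ^+ 2 = (smS `^ (- smr)) ^+ 2 * (smS * smS `^ ((q + 2) / q)).
  have -> : smS * smS `^ ((q + 2) / q) = smS `^ (1 + (q + 2) / q).
    by rewrite powRDp// (powRr1 (ltW S0)).
  by rewrite !expr2 -!powRDp//; congr (_ `^ _); rewrite /smr; field.
rewrite ler_wpM2l ?sqr_ge0//; apply: le_trans sum_smP_sqr _.
rewrite ler_wpM2l ?(ltW S0)//; apply: le_trans hw; apply: ler_sum => i _.
by rewrite ler_piMr.
Qed.

(** Differentiating S^(-r) produces a multiple r q of |P|^2 / S with the wrong sign; [sum_smP_sqr]
    absorbs it, as r q >= 0 by p <= q. Then |a_i|^2 carries the coefficient q + 1 - r q = p - 1, so
    [ab] applies termwise, and [power_mean] with exponent (q + 2) / q bounds the sum of the weights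
    from below. *)
Lemma smV_div : m * #|I|%:R `^ (- (2 / q)) * smS `^ (p / q) <= - \sum_e smV1 e.
Proof.
have S0 := smS_gt0; have qn0 : q != 0 by rewrite (gt_eqF q0).
have hw : #|I|%:R `^ (- (2 / q)) * smS `^ ((q + 2) / q) <= \sum_i w i.
  have t1 : 1 < (q + 2) / q by rewrite ltr_pdivlMr// mul1r ltrDl.
  have := power_mean t1 (fun i => powR_gt0 (- q) (d0 i)).
  have -> : 1 - (q + 2) / q = - (2 / q) by field.
  by rewrite -/smS; under [X in _ <= X -> _]eq_bigr do rewrite -wE.
have E1 : \sum_e smP1 e = \sum_i w i * ((- q - 1) * \sum_e a i e ^+ 2 + d i * \sum_e b i e).
  rewrite exchange_big /=; apply: eq_bigr => i _; rewrite mulrDr !mulr_sumr -big_split /=.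
  apply: eq_bigr => e _; rewrite /w.
  have -> : d i `^ (- q - 1) = d i `^ (- q - 2) * d i.
    by rewrite -{3}(powRr1 (ltW (d0 i))) -powRDp//; congr (_ `^ _); ring.
  by ring.
have E2 : \sum_e smV1 e = smr * q * smS `^ (- smr - 1) * \sum_e smP e ^+ 2 + smS `^ (- smr) * \sum_e smP1 e.
  by rewrite !mulr_sumr -big_split.
have h1 : smr * q * smS `^ (- smr - 1) * \sum_e smP e ^+ 2 <=
    smS `^ (- smr) * (smr * q * \sum_i w i * \sum_e a i e ^+ 2).
  have -> : smS `^ (- smr) = smS `^ (- smr - 1) * smS.
    by rewrite -{3}(powRr1 (ltW S0)) -powRDp// subrK.
  have -> : smS `^ (- smr - 1) * smS * (smr * q * \sum_i w i * \sum_e a i e ^+ 2) =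
    smr * q * smS `^ (- smr - 1) * (smS * \sum_i w i * \sum_e a i e ^+ 2) by ring.
  by rewrite ler_wpM2l ?sum_smP_sqr// mulr_ge0 ?powR_ge0.
have h2 : m * \sum_i w i <= \sum_i w i * (- d i * \sum_e b i e + (p - 1) * \sum_e a i e ^+ 2).
  by rewrite mulr_sumr; apply: ler_sum => i _; rewrite mulrC ler_wpM2l.
have E3 : - (smr * q * \sum_i w i * \sum_e a i e ^+ 2 + \sum_e smP1 e) =
    \sum_i w i * (- d i * \sum_e b i e + (p - 1) * \sum_e a i e ^+ 2).
  rewrite E1 mulr_sumr -big_split -sumrN; apply: eq_bigr => i _ /=.
  by rewrite /smr divfK//; ring.
have h3 : m * #|I|%:R `^ (- (2 / q)) * smS `^ (p / q) <= smS `^ (- smr) * (m * \sum_i w i).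
  have -> : smS `^ (p / q) = smS `^ (- smr) * smS `^ ((q + 2) / q).
    by rewrite -powRDp//; congr (_ `^ _); rewrite /smr; field.
  have -> : m * #|I|%:R `^ (- (2 / q)) * (smS `^ (- smr) * smS `^ ((q + 2) / q)) =
    smS `^ (- smr) * (m * (#|I|%:R `^ (- (2 / q)) * smS `^ ((q + 2) / q))) by ring.
  by rewrite ler_wpM2l ?powR_ge0// ler_wpM2l.
have h4 : smS `^ (- smr) * (m * \sum_i w i) <= smS `^ (- smr) *
    - (smr * q * \sum_i w i * \sum_e a i e ^+ 2 + \sum_e smP1 e).
  by rewrite E3 ler_wpM2l ?powR_ge0.
by rewrite E2; move: h1 h3 h4; lra.
Qed.

(** The first sum is the divergence of |u|^p V and integrates to zero; the rest is Young's
    inequality for |grad_H u| and |u| S^(1/q). *)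
Lemma sm_young (u : R) (g : E -> R) x : 0 < x ->
  \sum_e (normpow1 p u * g e * smV e + `|u| `^ p * smV1 e) +
    (m * #|I|%:R `^ (- (2 / q)) - (p - 1) * x) * (`|u| `^ p * smS `^ (p / q)) <=
  x `^ (1 - p) * (Num.sqrt (\sum_e g e ^+ 2)) `^ p.
Proof.
move=> x0; have S0 := smS_gt0; have qn0 : q != 0 by rewrite (gt_eqF q0).
set G := Num.sqrt _; set W := smS `^ q^-1.
have W0 : 0 < W by rewrite powR_gt0.
have WE s : smS `^ (s / q) = W `^ s by rewrite /W -powRrM mulrC.
have hGV : `|\sum_e g e * smV e| <= G * W `^ (p - 1).
  rewrite -WE -sqrtr_sqr -(ger0_norm (powR_ge0 smS ((p - 1) / q))) -sqrtr_sqr -sqrtrM; last first.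
    by apply: sumr_ge0 => e _; exact: sqr_ge0.
  rewrite ler_wsqrtr//; apply: le_trans (cauchy_schwarz _ _) _.
  by rewrite ler_wpM2l ?smV_sqr// sumr_ge0// => e _; exact: sqr_ge0.
have h1 : \sum_e normpow1 p u * g e * smV e <= p * G * (`|u| * W) `^ (p - 1).
  under eq_bigr do rewrite -mulrA; rewrite -mulr_sumr.
  apply: le_trans (ler_norm _) _; rewrite normrM normpow1_norm// powRM ?(ltW W0)//.
  have -> : p * G * (`|u| `^ (p - 1) * W `^ (p - 1)) = p * `|u| `^ (p - 1) * (G * W `^ (p - 1)) by ring.
  by rewrite ler_wpM2l// mulr_ge0 ?powR_ge0 ?(ltW (lt_trans ltr01 p1)).
have h2 := powR_young p1 x0 (sqrtr_ge0 _ : 0 <= G) (mulr_ge0 (normr_ge0 u) (ltW W0)).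
have h3 := ler_wpM2l (powR_ge0 `|u| p) smV_div.
have hM := powRM p (normr_ge0 u) (ltW W0).
rewrite hM in h2; rewrite WE in h3 *; rewrite big_split /= -mulr_sumr.
move: h1 h2 h3; rewrite mulrN; set Vs := \sum_e smV1 e; set A := \sum_e _.
set B := p * G * _; set Y := `|u| `^ p; set Wp := W `^ p.
move: Vs A B Y Wp (_ `^ (- (2 / q))) (G `^ p) (x `^ _) => Vs A B Y Wp N Gp xp h1 h2 h3.
lra.
Qed.

End pointwise.
End softmin_algebra.

Section support.
Context {R : realType} {V : normedModType R}.

(** The negative powers of the barriers are controlled only on the support of u; products with |u|^p
    are extended by zero across its open complement. *)
Lemma continuous_supp (T : topologicalType) (K : set T) (f : T -> R) : closed K ->
  (forall x, K x -> {for x, continuous f}) -> (forall x, ~ K x -> f x = 0) -> continuous f.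
Proof.
move=> cK h0 h1 x; have [|nK] := pselect (K x); first exact: h0.
apply/cvgrPdist_lt => e e0; rewrite (h1 x nK).
have : nbhs x (~` K) by apply: open_nbhs_nbhs; split => //; exact: closed_openC.
by apply: filterS => y /h1 ->; rewrite subrr normr0.
Qed.

Lemma isd_supp (K : set V) (f f' : V -> R) (x v : V) : closed K ->
  (K x -> is_derive x v f (f' x)) -> (forall x, ~ K x -> f x = 0) ->
  (forall x, ~ K x -> f' x = 0) -> is_derive x v f (f' x).
Proof.
move=> cK h0 h1 h2; have [|nK] := pselect (K x); first exact: h0.
rewrite h2//; apply: (@near_eq_is_derive _ _ _ (fun=> 0)).
have : nbhs x (~` K) by apply: open_nbhs_nbhs; split => //; exact: closed_openC.
by apply: filterS => y /h1 ->.
Qed.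

Lemma continuous_powR (T : topologicalType) (f : T -> R) (x : T) s :
  0 < f x -> {for x, continuous f} -> {for x, continuous (fun y => f y `^ s)}.
Proof.
move=> fx cf; apply: (@continuous_comp _ _ _ f (fun r => r `^ s)) => //.
exact: isd_continuous (is_derive1_powR _ _).
Qed.

Lemma continuous_sqr (T : topologicalType) (f : T -> R) (x : T) :
  {for x, continuous f} -> {for x, continuous (fun y => f y ^+ 2)}.
Proof. by move=> cf; exact: cvgM. Qed.

Lemma continuous_sum (T : topologicalType) (I : finType) (F : I -> T -> R) (x : T) :
  (forall i, {for x, continuous (F i)}) -> {for x, continuous (fun y => \sum_i F i y)}.
Proof. by move=> h; apply: cvg_sumr. Qed.

End support.

(** * The integrated inequality for finitely many barriers *)

Section softmin_hardy.
Context {R : realType} {n : nat}.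
Local Notation H := (heis R n).
Local Notation E := ('I_n * bool)%type.
Variables (I : finType) (i0 : I) (d : I -> H -> R) (d1 d2 : I -> E -> H -> R).
Variables (u : H -> R) (p q m x : R).
Hypothesis reg : forall i, hregular (d i) (d1 i) (d2 i).
Hypotheses (su : smooth u) (cu : compact (tsupport u)).
Hypotheses (p1 : 1 < p) (pq : p <= q) (m0 : 0 <= m) (x0 : 0 < x).
Local Notation K := (tsupport u).
Hypothesis dK : forall i xi, K xi -> 0 < d i xi.
Hypothesis good : forall i xi, K xi ->
  m <= - d i xi * \sum_e d2 i e xi + (p - 1) * \sum_e d1 i e xi ^+ 2.

Let S xi := smS (d^~ xi) q.
Let P e xi := smP (d^~ xi) (fun i e => d1 i e xi) q e.
Let P1 e xi := smP1 (d^~ xi) (fun i e => d1 i e xi) (fun i e => d2 i e xi) q e.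
Let V e xi := smV (d^~ xi) (fun i e => d1 i e xi) p q e.
Let V1 e xi := smV1 (d^~ xi) (fun i e => d1 i e xi) (fun i e => d2 i e xi) p q e.
Let up xi := `|u xi| `^ p.
Let F e xi := up xi * V e xi.
Let F1 e xi := normpow1 p (u xi) * hder u e xi * V e xi + up xi * V1 e xi.
Let B xi := up xi * S xi `^ (p / q).
Let c := m * #|I|%:R `^ (- (2 / q)) - (p - 1) * x.

Let cK : closed K. Proof. exact: closed_closure. Qed.
Let p0 : 0 < p. Proof. exact: lt_trans ltr01 p1. Qed.
Let q0 : 0 < q. Proof. exact: lt_le_trans p0 pq. Qed.

Let S0 xi : K xi -> 0 < S xi.
Proof. by move=> Kxi; apply: smS_gt0 => // i; exact: dK. Qed.

Let cd i s xi : K xi -> {for xi, continuous (fun xi => d i xi `^ s)}.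
Proof. by move=> Kxi; apply: continuous_powR; [exact: dK|exact: hregular_cont (reg i) xi]. Qed.

Let cS xi : K xi -> {for xi, continuous S}.
Proof. by move=> Kxi; apply: continuous_sum => i; exact: cd. Qed.

Let cP e xi : K xi -> {for xi, continuous (P e)}.
Proof.
move=> Kxi; apply: continuous_sum => i; apply: cvgM; first exact: cd.
exact: hregular_cont1 (reg i) e xi.
Qed.

Let cP1 e xi : K xi -> {for xi, continuous (P1 e)}.
Proof.
move=> Kxi; apply: continuous_sum => i.
have c1 : {for xi, continuous (d1 i e)} := @hregular_cont1 _ _ _ _ _ (reg i) e xi.
have c2 : {for xi, continuous (d2 i e)} := @hregular_cont2 _ _ _ _ _ (reg i) e xi.
apply: cvgD; apply: cvgM.
- by apply: cvgM; [exact: cvg_cst|exact: cd].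
- exact: continuous_sqr c1.
- exact: cd.
- exact: c2.
Qed.

Let cSs s xi : K xi -> {for xi, continuous (fun xi => S xi `^ s)}.
Proof. by move=> Kxi; apply: continuous_powR; [exact: S0|exact: cS]. Qed.

Let cV e xi : K xi -> {for xi, continuous (V e)}.
Proof. by move=> Kxi; apply: cvgM; [exact: cSs|exact: cP]. Qed.

Let cV1 e xi : K xi -> {for xi, continuous (V1 e)}.
Proof.
move=> Kxi; have h1 := cP Kxi.
apply: cvgD; apply: cvgM.
- by apply: cvgM; [exact: cvg_cst|exact: cSs].
- exact: continuous_sqr (cP Kxi).
- exact: cSs.
- exact: cP1.
Qed.

Let dV e xi : K xi -> is_derive xi (hE e xi) (V e) (V1 e xi).
Proof.
move=> Kxi; have hd i s := isd_powR s (dK i Kxi) (hregular_derive (reg i) e xi).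
have hS := isd_sum (fun i => hd i (- q)).
have hP := isd_sum (fun i => isd_mul (hd i (- q - 1)) (hregular_derive2 (reg i) e xi)).
apply: isd_eq (isd_mul (isd_powR (- smr p q) (S0 Kxi) hS) hP) _.
rewrite /V1 /smV1; congr (_ + _ * _).
  rewrite -[X in _ * X * _](_ : - q * P e xi = _); last first.
    by rewrite mulr_sumr; apply: eq_bigr => i _; rewrite mulrA.
  change (- smr p q * S xi `^ (- smr p q - 1) * (- q * P e xi) * P e xi =
    smr p q * q * S xi `^ (- smr p q - 1) * P e xi ^+ 2).
  by ring.
rewrite /smP1; apply: eq_bigr => i _; rewrite expr2 !mulrA; congr (_ * _ `^ _ * _ * _ + _).
by have -> : - q - 2 = - q - 1 - 1 by ring.
Qed.

Let cup : continuous up.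
Proof.
move=> xi; apply: (@continuous_comp _ _ _ u (fun r => `|r| `^ p)); first exact: smooth_continuous.
exact: continuous_normpow.
Qed.

Let up0 xi : ~ K xi -> up xi = 0.
Proof. by move=> h; rewrite /up supp_eq0// normr0 powR0// gt_eqF. Qed.

Let cF e : continuous (F e).
Proof.
apply: (continuous_supp cK) => xi h; last by rewrite /F up0// mul0r.
by apply: cvgM; [exact: cup|exact: cV].
Qed.

Let F10 e xi : ~ K xi -> F1 e xi = 0.
Proof. by move=> h; rewrite /F1 hder_supp// up0// mulr0 !mul0r addr0. Qed.

Let cF1 e : continuous (F1 e).
Proof.
apply: (continuous_supp cK) => xi h; last exact: F10.
apply: cvgD; apply: cvgM.
- apply: cvgM; last exact: continuous_hder.
  apply: (@continuous_comp _ _ _ u (normpow1 p)); first exact: smooth_continuous.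
  exact: continuous_normpow1.
- exact: cV.
- exact: cup.
- exact: cV1.
Qed.

Let dF e xi : is_derive xi (hE e xi) (F e) (F1 e xi).
Proof.
apply: (isd_supp cK); [move=> h|by move=> y h; rewrite /F up0// mul0r|exact: F10].
exact: isd_mul (isd_comp (is_derive_normpow (u xi) p1) (is_derive_hder su e xi)) (dV e h).
Qed.

Let cB : continuous B.
Proof.
apply: (continuous_supp cK) => xi h; last by rewrite /B up0// mul0r.
by apply: cvgM; [exact: cup|exact: cSs].
Qed.

Let G xi := hnorm (hgrad u xi) `^ p.

Let G0 xi : ~ K xi -> G xi = 0.
Proof.
move=> h; rewrite /G hgradE big1 ?sqrtr0 ?powR0 ?gt_eqF// => e _.
by rewrite hder_supp// expr0n.
Qed.

Let cG : continuous G.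
Proof.
have -> : G = (fun xi => `|Num.sqrt (\sum_e hder u e xi ^+ 2)| `^ p).
  by apply/funext => xi; rewrite /G hgradE ger0_norm ?sqrtr_ge0.
move=> xi; apply: (@continuous_comp _ _ _ (fun xi => Num.sqrt (\sum_e hder u e xi ^+ 2)) (fun r => `|r| `^ p)).
  apply: (@continuous_comp _ _ _ (fun xi => \sum_e hder u e xi ^+ 2) (@Num.sqrt R)); last exact: sqrt_continuous.
  by apply: continuous_sum => e; apply: continuous_sqr; exact: continuous_hder.
exact: continuous_normpow.
Qed.

Lemma softmin_hardy :
  ((m * #|I|%:R `^ (- (2 / q)) - (p - 1) * x)%:E *
   \int[volume]_(xi in [set: heism R n]) (`|u xi| `^ p * smS (d^~ xi) q `^ (p / q))%:E <=
   (x `^ (1 - p))%:E * \int[volume]_(xi in [set: heism R n]) (hnorm (hgrad u xi) `^ p)%:E)%E.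
Proof.
have [M [_ /(_ (M + 1)) KM]] := compact_bounded cu.
have {}KM xi : M + 1 < `|xi| -> ~ K xi.
  by move=> h Kxi; have h2 : `|xi| <= M + 1 := KM (ltr_pwDr ltr01 (lexx M)) xi Kxi; rewrite ltNge h2 in h.
have iF1 e : volume.-integrable [set: heism R n] (EFin \o F1 e).
  by apply: (@integrable_compact_support _ _ _ (M + 1)); [exact: cF1|move=> xi /KM /F10].
have iB : volume.-integrable [set: heism R n] (EFin \o B).
  apply: (@integrable_compact_support _ _ _ (M + 1)); first exact: cB.
  by move=> xi /KM h; rewrite /B up0// mul0r.
have iG : volume.-integrable [set: heism R n] (EFin \o G).
  by apply: (@integrable_compact_support _ _ _ (M + 1)); [exact: cG|move=> xi /KM /G0].
rewrite -/c -[X in (X <= _)%E](integralZl _ iB)// -[X in (_ <= X)%E](integralZl _ iG)//.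
have F0 : (\int[volume]_(xi in [set: heism R n]) (\sum_e (F1 e xi)%:E) = 0)%E.
  rewrite integral_sum//; apply: big1 => e _.
  apply: (integral_hE_eq0 (e := e) (f := F e) (M := M + 1)).
  - exact: cF.
  - exact: cF1.
  - by move=> xi /KM h; rewrite /F up0// mul0r.
  - exact: dF.
(* Adding the vanishing integral of the divergence turns the claim into the integral of the
   pointwise inequality [sm_young]. *)
rewrite -[leLHS]add0e -F0 -integralD//; last 2 first.
- by apply: integrable_sum => // e _; exact: iF1.
- exact: integrableZl.
apply: le_integral => //.
- apply: integrableD => //; first by apply: integrable_sum => // e _; exact: iF1.
  exact: integrableZl.
- exact: integrableZl.
move=> xi _ /=; rewrite sumEFin -!EFinM -EFinD lee_fin.
have [Kxi|nK] := pselect (K xi).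
  rewrite /G hgradE; apply: sm_young => //.
  - by move=> i; exact: dK.
  - by move=> i; exact: hregular_grad (reg i) xi.
  - by move=> i; exact: good.
rewrite /B up0// mul0r mulr0 addr0 big1 => [|e _]; last exact: F10.
by rewrite mulr_ge0 ?powR_ge0.
Qed.

End softmin_hardy.

(** N^(-2/q) = exp (- 2 ln N / q) >= 1 - 2 ln N / q. *)
Lemma powRN_card_ge (R : realType) (N : nat) (p eta : R) : (0 < N)%N -> 0 < eta ->
  exists2 q, p <= q & 1 - eta <= N%:R `^ (- (2 / q)).
Proof.
move=> N0 eta0; have N1 : 1 <= N%:R :> R by rewrite ler1n.
have l0 : 0 <= ln N%:R :> R by exact: ln_ge0.
exists (Num.max p (Num.max 1 (2 * ln N%:R / eta))); first by rewrite le_max lexx.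
set q := Num.max _ _; have q1 : 1 <= q by rewrite /q !le_max lexx orbT.
have q0 : 0 < q by lra.
have ql : 2 * ln N%:R / eta <= q by rewrite /q !le_max lexx !orbT.
rewrite /powR gt_eqF ?ltr0n//; apply: le_trans (expR_ge1Dx _); rewrite lerD2l mulNr lerN2.
by rewrite mulrAC ler_pdivrMr//; move: ql; rewrite ler_pdivrMr// [eta * q]mulrC.
Qed.

(** The weight x = (p - 1) / p maximises (p - 1) (1 - x) x^(p - 1), the constant obtained in the
    limit. Since q is chosen from the number of barriers, the constant on the left does not depend
    on [I]. *)
Theorem hardy_family (R : realType) (n : nat) (I : finType) (i0 : I)
    (d : I -> heis R n -> R) (d1 d2 : I -> 'I_n * bool -> heis R n -> R)
    (u : heis R n -> R) (p eta : R) (g : heis R n -> \bar R) :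
  (forall i, hregular (d i) (d1 i) (d2 i)) ->
  smooth u -> compact (tsupport u) -> 1 < p -> 0 < eta < 1 ->
  (p - 1) / p <= (1 - eta) ^+ 2 ->
  (forall i xi, tsupport u xi -> 0 < d i xi) ->
  (forall i xi, tsupport u xi -> (p - 1) * (1 - eta) <=
    - d i xi * \sum_e d2 i e xi + (p - 1) * \sum_e d1 i e xi ^+ 2) ->
  (forall xi, (0 <= g xi)%E) -> (forall xi, ~ tsupport u xi -> g xi = 0%E) ->
  (forall xi, tsupport u xi -> exists i, (g xi <= (`|u xi| `^ p * d i xi `^ (- p))%:E)%E) ->
  (((p - 1) * ((1 - eta) ^+ 2 - (p - 1) / p))%:E *
   \int[volume]_(xi in [set: heism R n]) g xi <=
   (((p - 1) / p) `^ (1 - p))%:E *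
   \int[volume]_(xi in [set: heism R n]) (hnorm (hgrad u xi) `^ p)%:E)%E.
Proof.
move=> reg su cu p1 /andP[eta0 eta1] etap d0 good g0 gK gle.
have p10 : 0 < p - 1 by rewrite subr_gt0.
have p0 : 0 < p by lra.
have x0 : 0 < (p - 1) / p by rewrite divr_gt0.
have N0 : (0 < #|I|)%N by apply/card_gt0P; exists i0.
have [q pq hq] := @powRN_card_ge R #|I| p eta N0 eta0.
have q0 : 0 < q by exact: lt_le_trans pq.
have m0 : 0 <= (p - 1) * (1 - eta) by apply: mulr_ge0; rewrite ?subr_ge0 ltW.
apply: le_trans (softmin_hardy i0 reg su cu p1 pq m0 x0 d0 good).
have c0 : 0 <= (p - 1) * ((1 - eta) ^+ 2 - (p - 1) / p).
  by apply: mulr_ge0; rewrite ?subr_ge0// ltW.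
have cc : (p - 1) * ((1 - eta) ^+ 2 - (p - 1) / p) <=
    (p - 1) * (1 - eta) * #|I|%:R `^ (- (2 / q)) - (p - 1) * ((p - 1) / p).
  rewrite -mulrA -mulrBr ler_wpM2l ?(ltW p10)// lerD2r expr2 ler_wpM2l// subr_ge0 ltW//.
apply: (@le_trans _ _ (((p - 1) * ((1 - eta) ^+ 2 - (p - 1) / p))%:E *
   \int[volume]_(xi in [set: heism R n]) (`|u xi| `^ p * smS (d^~ xi) q `^ (p / q))%:E)%E).
  rewrite lee_wpmul2l//; apply: ge0_le_integral_nm => // xi _.
  have [Kxi|/gK ->] := pselect (tsupport u xi); last first.
    by rewrite lee_fin mulr_ge0// powR_ge0.
  have [i /le_trans] := gle xi Kxi; apply; rewrite lee_fin ler_wpM2l ?powR_ge0//.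
  have di := d0 i xi Kxi.
  have -> : d i xi `^ (- p) = (d i xi `^ (- q)) `^ (p / q).
    by rewrite -powRrM; congr (_ `^ _); field; rewrite gt_eqF.
  apply: ge0_ler_powR; rewrite ?nnegrE ?powR_ge0 ?divr_ge0 ?(ltW p0) ?(ltW q0)//.
    by apply: sumr_ge0 => j _; exact: powR_ge0.
  by rewrite /smS (bigD1 i)//= lerDl sumr_ge0// => j _; exact: powR_ge0.
rewrite lee_wpmul2r//; apply: integral_ge0 => xi _.
by rewrite lee_fin mulr_ge0// powR_ge0.
Qed.

(** Recursive form of a maximum over N + 1 terms, so that measurability and monotonicity in N are
    immediate. *)
Fixpoint running_max (R : realType) (f : nat -> R) (N : nat) : R :=
  if N is k.+1 then Num.max (running_max f k) (f k.+1) else f 0%N.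

Lemma running_max_ge (R : realType) (f : nat -> R) N : f N <= running_max f N.
Proof. by case: N => //= N; rewrite le_max lexx orbT. Qed.

Lemma running_max_attained (R : realType) (f : nat -> R) N :
  exists i : 'I_N.+1, running_max f N = f i.
Proof.
elim: N => [|N [i hi]] /=; first by exists ord0.
rewrite /Num.max; case: ifP => _; first by exists ord_max.
by exists (widen_ord (leqnSn _) i); rewrite hi.
Qed.

(** * Countably many barriers *)

Section hardy_sequence.
Context {R : realType} {n : nat}.
Local Notation H := (heis R n).
Local Notation E := ('I_n * bool)%type.

Lemma div_poweR_le (a r p : R) (y : \bar R) : 0 <= a -> 0 < r -> 0 < p ->
  (r%:E <= y)%E -> (a%:E / y `^ p <= (a * r `^ (- p))%:E)%E.
Proof.
move=> a0 r0 p0; case: y => [y| |//].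
  rewrite lee_fin => ry; have y0 : 0 < y by exact: lt_le_trans ry.
  rewrite poweR_EFin inver gt_eqF ?powR_gt0// -EFinM lee_fin ler_wpM2l// powRN.
  by rewrite lef_pV2 ?posrE ?powR_gt0// ge0_ler_powR// ?nnegrE ltW.
by move=> _; rewrite poweRyr ?gt_eqF// invey mule0 lee_fin mulr_ge0// powR_ge0.
Qed.

Lemma div_poweR_ge0 (a p : R) (y : \bar R) : 0 <= a -> (0 <= a%:E / y `^ p)%E.
Proof. by move=> a0; rewrite mule_ge0// inve_ge0 poweR_ge0. Qed.

Lemma integral_supp (D : set H) (f : H -> \bar R) : open D ->
  (forall xi, ~ D xi -> f xi = 0%E) ->
  (\int[volume]_(xi in (D : set (heism R n))) f xi =
   \int[volume]_(xi in [set: heism R n]) f xi)%E.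
Proof.
move=> oD f0; rewrite integral_mkcond; apply: eq_integral => xi _; rewrite patchE.
by case: ifPn => // /negP nD; rewrite f0// => Dxi; apply: nD; exact: mem_set.
Qed.

Variables (D : set H) (u : H -> R) (p : R).
Hypotheses (p1 : 1 < p) (oD : open D) (uD : Ccinfty D u).
Local Notation K := (tsupport u).
Local Notation g := (fun xi => ((`|u xi| `^ p)%:E / bdist D xi `^ p)%E).
Local Notation J := (\int[volume]_(xi in [set: heism R n]) (hnorm (hgrad u xi) `^ p)%:E)%E.
Let p0 : 0 < p. Proof. exact: lt_trans ltr01 p1. Qed.
Let p10 : 0 < p - 1. Proof. by rewrite subr_gt0. Qed.
Let su : smooth u. Proof. by case: uD. Qed.
Let cu : compact K. Proof. by case: uD. Qed.

(** Monotone convergence in the number of barriers, with a constant independent of that number. The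
    last hypothesis says that the infimum of the barriers is a lower bound of the boundary
    distance. *)
Lemma hardy_sequence (eta : R) (d : nat -> H -> R) (d1 d2 : nat -> E -> H -> R) :
  0 < eta < 1 -> (p - 1) / p <= (1 - eta) ^+ 2 ->
  (forall i, hregular (d i) (d1 i) (d2 i)) ->
  (forall i xi, K xi -> 0 < d i xi) ->
  (forall i xi, K xi -> (p - 1) * (1 - eta) <=
    - d i xi * \sum_e d2 i e xi + (p - 1) * \sum_e d1 i e xi ^+ 2) ->
  (forall xi r, K xi -> (forall i, r <= d i xi) -> (r%:E <= bdist D xi)%E) ->
  (((p - 1) * ((1 - eta) ^+ 2 - (p - 1) / p))%:E *
   \int[volume]_(xi in [set: heism R n]) g xi <= (((p - 1) / p) `^ (1 - p))%:E * J)%E.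
Proof.
move=> eta01 etap reg d0 good dist.
pose m N xi : R := running_max (fun i => d i xi `^ (- p)) N.
pose h N xi : \bar R := (`|u xi| `^ p * m N xi)%:E.
have m0 N xi : 0 <= m N xi by have [i hi] := running_max_attained (fun i => d i xi `^ (- p)) N; rewrite /m hi powR_ge0.
have h0 N xi : (0 <= h N xi)%E by rewrite lee_fin mulr_ge0// powR_ge0.
have hS N xi : (h N xi <= h N.+1 xi)%E.
  by rewrite lee_fin ler_wpM2l ?powR_ge0// /m /= le_max lexx.
have hnd xi : nondecreasing_seq (h^~ xi).
  by apply/nondecreasing_seqP => N; exact: hS.
have c0 : 0 <= (p - 1) * ((1 - eta) ^+ 2 - (p - 1) / p).
  by apply: mulr_ge0; rewrite ?subr_ge0// ltW.
have u0 xi : ~ K xi -> `|u xi| `^ p = 0.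
  by move=> /supp_eq0 ->; rewrite normr0 powR0// gt_eqF.
have hN N : (((p - 1) * ((1 - eta) ^+ 2 - (p - 1) / p))%:E *
   \int[volume]_(xi in [set: heism R n]) h N xi <= (((p - 1) / p) `^ (1 - p))%:E * J)%E.
  apply: (@hardy_family R n 'I_N.+1 ord0 (fun i => d i) (fun i => d1 i) (fun i => d2 i)) => //.
  - by move=> i xi; exact: d0.
  - by move=> i xi; exact: good.
  - by move=> xi /u0 h1; rewrite /h h1 mul0r.
  - move=> xi Kxi; have [j hj] := running_max_attained (fun i => d i xi `^ (- p)) N.
    by exists j; rewrite lee_fin /m hj.
have md i : measurable_fun setT (fun xi : heism R n => d i xi `^ (- p)).
  apply: (measurableT_comp (measurable_powR _)).
  by apply: continuous_measurable_heis; exact: hregular_cont (reg i).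
have mm N : measurable_fun setT (m N : heism R n -> R).
  by elim: N => [|N IH]; [exact: md|exact: measurable_maxr IH (md N.+1)].
have mh N : measurable_fun [set: heism R n] (h N : heism R n -> \bar R).
  apply/measurable_EFinP; apply: measurable_funM; last exact: mm.
  apply: continuous_measurable_heis => xi.
  apply: (@continuous_comp _ _ _ u (fun r => `|r| `^ p)); first exact: smooth_continuous.
  exact: continuous_normpow.
have gle xi : (g xi <= limn (h^~ xi))%E.
  rewrite (cvg_lim _ (ereal_nondecreasing_cvgn (hnd xi)))//.
  have hsup N : (h N xi <= ereal_sup (range (h^~ xi)))%E by apply: ereal_sup_ubound; exists N.
  have [Kxi|/u0 ->] := pselect (K xi); last first.
    by rewrite mul0e (le_trans (h0 0%N xi)).
  have [->|/eqP ux] := eqVneq (u xi) 0.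
    by rewrite normr0 powR0 ?gt_eqF// mul0e (le_trans (h0 0%N xi)).
  have a0 : 0 < `|u xi| `^ p by rewrite powR_gt0// normr_gt0; exact/eqP.
  move: hsup; case: (ereal_sup _) => [s| |] hsup; last 2 first.
  - by rewrite leey.
  - by have := le_trans (h0 0%N xi) (hsup 0%N).
  set a := `|u xi| `^ p in a0 *.
  have hd i : a * d i xi `^ (- p) <= s.
    rewrite -lee_fin; apply: le_trans (hsup i); rewrite lee_fin ler_wpM2l ?(ltW a0)//.
    exact: running_max_ge.
  have s0 : 0 < s by apply: lt_le_trans (hd 0%N); rewrite mulr_gt0// powR_gt0// d0.
  (* If the supremum s is finite, every d_i is at least (a / s)^(1/p), hence so is the boundary
     distance, and the quotient is at most s. *)
  have r0 : 0 < (a / s) `^ p^-1 by rewrite powR_gt0// divr_gt0.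
  have rE : ((a / s) `^ p^-1) `^ p = a / s.
    by rewrite -powRrM mulVf ?gt_eqF// powRr1// ltW// divr_gt0.
  apply: (le_trans (div_poweR_le (ltW a0) r0 p0 (dist xi _ Kxi _))).
    move=> i; have di := d0 i xi Kxi.
    have : a / s <= d i xi `^ p.
      have := hd i; rewrite powRN ler_pdivrMr ?powR_gt0// => hh.
      by rewrite ler_pdivrMr// mulrC.
    move=> hle; rewrite leNgt; apply/negP => lt1.
    have := gt0_ltr_powR p0 _ _ lt1; rewrite rE !nnegrE (ltW di) (ltW r0) => /(_ isT isT).
    by rewrite ltNge hle.
  by rewrite lee_fin powRN rE invf_div mulrCA divff ?mulr1// gt_eqF.
have : (\int[volume]_(xi in [set: heism R n]) g xi <=
   \int[volume]_(xi in [set: heism R n]) limn (h^~ xi))%E.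
  by apply: ge0_le_integral_nm => // xi _; apply: div_poweR_ge0; exact: powR_ge0.
have cE : (0 <= ((p - 1) * ((1 - eta) ^+ 2 - (p - 1) / p))%:E)%E by rewrite lee_fin.
move=> /(lee_wpmul2l cE) /le_trans; apply.
rewrite (monotone_convergence _ measurableT)//.
have cvgI : cvgn (fun N => \int[volume]_(xi in [set: heism R n]) h N xi)%E.
  apply: ereal_nondecreasing_is_cvgn; apply/nondecreasing_seqP => N.
  by apply: ge0_le_integral_nm => // xi _; exact: hS.
rewrite -limeMl//; apply: lime_le; first exact: is_cvgeMl.
by apply: nearW => N; exact: hN.
Qed.

(** As eta tends to 0 the inequality becomes x I <= x^(1-p) J for x = (p - 1) / p, because (p - 1)
    (1 - x) = x; multiplying by x^(p-1) gives the constant x^p. *)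
Lemma hardy_limit (eta0 : R) : 0 < eta0 ->
  (forall eta, 0 < eta < eta0 -> 
    (((p - 1) * ((1 - eta) ^+ 2 - (p - 1) / p))%:E *
     \int[volume]_(xi in [set: heism R n]) g xi <= (((p - 1) / p) `^ (1 - p))%:E * J)%E) ->
  ((((p - 1) / p) `^ p)%:E *
    \int[volume]_(xi in (D : set (heism R n))) g xi <=
   \int[volume]_(xi in (D : set (heism R n))) (hnorm (hgrad u xi) `^ p)%:E)%E.
Proof.
move=> eta00 h.
have KD : K `<=` D by case: uD.
rewrite integral_supp//; last first.
  move=> xi nD; rewrite supp_eq0 => [|/KD//].
  by rewrite normr0 powR0 ?gt_eqF// mul0e.
rewrite [X in (_ <= X)%E]integral_supp//; last first.
  move=> xi nD; rewrite hgradE// big1 ?sqrtr0 ?powR0 ?gt_eqF// => e _.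
  by rewrite hder_supp ?expr0n// => /KD.
set x := (p - 1) / p; have x0 : 0 < x by rewrite divr_gt0.
have x1 : x < 1 by rewrite ltr_pdivrMr//; lra.
have px : (p - 1) * (1 - x) = x by rewrite /x; field; rewrite gt_eqF.
have : (0 <= J)%E by apply: integral_ge0 => xi _; rewrite lee_fin powR_ge0.
have : (0 <= \int[volume]_(xi in [set: heism R n]) g xi)%E.
  by apply: integral_ge0 => xi _; apply: div_poweR_ge0; exact: powR_ge0.
move: h; rewrite -/x; move: J (\int[volume]_xi _)%E => [j| |//] I h I0 J0; last by rewrite leey.
have cpos eta : 0 < eta -> eta < (1 - x) / 2 -> 0 < (p - 1) * ((1 - eta) ^+ 2 - x).
  move=> e0 e1; apply: mulr_gt0 => //; have : 0 <= eta ^+ 2 by exact: sqr_ge0.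
  by rewrite sqrrB expr1n mul1r; lra.
pose e1 := Num.min eta0 ((1 - x) / 2).
have e10 : 0 < e1 by rewrite lt_min eta00 divr_gt0// subr_gt0.
(* A single eta excludes an infinite left integral, J being finite here. *)
case: I I0 h => [i| |//] I0 h; last first.
  have e1h : e1 / 2 < (1 - x) / 2.
    apply: (@lt_le_trans _ _ e1); first by rewrite ltr_pdivrMr// ltr_pMr// ltr1n.
    by rewrite ge_min lexx orbT.
  have e1e : e1 / 2 < eta0.
    apply: (@lt_le_trans _ _ e1); first by rewrite ltr_pdivrMr// ltr_pMr// ltr1n.
    by rewrite ge_min lexx.
  have e120 : 0 < e1 / 2 by rewrite divr_gt0.
  have := h (e1 / 2); rewrite e120 e1e => /(_ isT).
  by rewrite gt0_muley ?lte_fin ?cpos// -EFinM leye_eq.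
rewrite -EFinM lee_fin; rewrite lee_fin in I0.
have xj : x * i <= x `^ (1 - p) * j.
  apply/ler_addgt0Pr => e e0.
  have D0 : 0 < 2 * (p - 1) * i + 1 by rewrite ltr_wpDl// !mulr_ge0// ltW.
  (* Makes the error 2 (p - 1) i eta at most e; the summand 1 keeps the denominator positive when i
     = 0. *)
  pose eta := Num.min (e1 / 2) (e / (2 * (p - 1) * i + 1)).
  have eta1 : 0 < eta by rewrite lt_min !divr_gt0.
  have eta2 : eta < eta0.
    apply: (@le_lt_trans _ _ (e1 / 2)); first by rewrite ge_min lexx.
    apply: (@lt_le_trans _ _ e1); first by rewrite ltr_pdivrMr// ltr_pMr// ltr1n.
    by rewrite ge_min lexx.
  have eta3 : eta * (2 * (p - 1) * i + 1) <= e.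
    by rewrite -ler_pdivlMr// ge_min lexx orbT.
  have := h eta; rewrite eta1 eta2 => /(_ isT); rewrite -!EFinM lee_fin.
  have e2 : 0 <= eta ^+ 2 by exact: sqr_ge0.
  have pi0 : 0 <= (p - 1) * i by rewrite mulr_ge0// ltW.
  have : 0 <= (p - 1) * i * eta ^+ 2 by rewrite mulr_ge0.
  have -> : (p - 1) * ((1 - eta) ^+ 2 - x) * i =
    (p - 1) * (1 - x) * i - 2 * ((p - 1) * i) * eta + (p - 1) * i * eta ^+ 2 by ring.
  by rewrite px; lra.
rewrite -(mulr_powRB1 (ltW x0) p0) mulrAC; apply: (@le_trans _ _ (x `^ (1 - p) * j * x `^ (p - 1))).
  by rewrite ler_wpM2r// powR_ge0.
rewrite mulrAC -powRDp//.
have -> : 1 - p + (p - 1) = 0 by ring.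
by rewrite powRr0 mul1r.
Qed.

End hardy_sequence.

(** * Convex domains and half-spaces *)

Section convex_geometry.
Context {R : realType} {n : nat}.
Local Notation H := (heis R n).
Implicit Types (x y z xi zeta : H) (D : set H).

(** The Euclidean inner product as an instance of [hlin], so that a separating functional is
    directly the linear part of a [haff]. *)
Definition ip (u v : H) : R := hlin u.1.1 u.1.2 u.2 v.

(** The Euclidean square norm; the norm of the space is a maximum norm, whose nearest points do not
    provide a normal vector. *)
Definition sqn z : R := \sum_i z.1.1 0 i ^+ 2 + \sum_i z.1.2 0 i ^+ 2 + z.2 ^+ 2.

Lemma ipC u v : ip u v = ip v u.
Proof. by rewrite /ip /hlin dotvC [dotv u.1.2 _]dotvC [u.2 * _]mulrC. Qed.

Lemma ip_sqn u : ip u u = sqn u.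
Proof.
by rewrite /ip /hlin /sqn /dotv; congr (_ + _ + _) => //; apply: eq_bigr => i _; rewrite expr2.
Qed.

Lemma sqn_ge0 u : 0 <= sqn u.
Proof. by rewrite !addr_ge0 ?sqr_ge0// sumr_ge0// => i _; exact: sqr_ge0. Qed.

Lemma sqn_gt0 u : u != 0 -> 0 < sqn u.
Proof.
move=> u0; rewrite lt_neqAle sqn_ge0 andbT eq_sym; apply: contraNneq u0 => /eqP.
have s0 (w : 'rV[R]_n) : 0 <= \sum_i w 0 i ^+ 2 by apply: sumr_ge0 => i _; exact: sqr_ge0.
rewrite /sqn paddr_eq0 ?addr_ge0 ?sqr_ge0// paddr_eq0// sqrf_eq0 => /andP[/andP[h1 h2] /eqP h3].
have hz (w : 'rV[R]_n) : \sum_i w 0 i ^+ 2 == 0 -> w = 0.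
  rewrite psumr_eq0 => [/allP h|i _]; last exact: sqr_ge0.
  by apply/rowP => i; rewrite mxE; have := h i (mem_index_enum i); rewrite /= sqrf_eq0 => /eqP.
by case: u h1 h2 h3 => [[a b] c] /= /hz -> /hz -> ->.
Qed.

Lemma sqn_line u v (s : R) : sqn (u + s *: v) = sqn u + 2 * s * ip u v + s ^+ 2 * sqn v.
Proof.
rewrite -!ip_sqn {1}/ip hlinD hlinZ -!/(ip _ _) !(ipC (u + _)) /ip !hlinD !hlinZ -!/(ip _ _) (ipC v u).
by ring.
Qed.

Lemma continuous_sqn : continuous sqn.
Proof.
move=> xi; apply: cvgD; [apply: cvgD|].
- by apply: continuous_sum => i; apply: continuous_sqr; exact: continuous_coordx.
- by apply: continuous_sum => i; apply: continuous_sqr; exact: continuous_coordy.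
- by apply: continuous_sqr; exact: continuous_coordt.
Qed.

Lemma convex_setE D : convex_set D -> forall x y (s : R), D x -> D y -> 0 <= s <= 1 ->
  D (s *: x + (1 - s) *: y).
Proof.
move=> cD x y s Dx Dy /andP[s0 s1].
have := cD x y (Itv01 s0 s1); rewrite !inE; exact.
Qed.

Lemma closure_ballP D x : closure D x <-> forall e, 0 < e -> exists2 y, D y & `|x - y| < e.
Proof.
split=> [cx e e0|h B /nbhs_ballP[e /= e0 eB]].
  have [y [Dy yB]] := cx _ (nbhsx_ballx x e e0).
  by exists y => //; move: yB; rewrite -ball_normE.
have [y Dy xy] := h e e0; exists y; split => //; apply: eB.
by rewrite -ball_normE.
Qed.

Lemma not_closure_ball D x : ~ closure D x -> exists2 e, 0 < e & forall y, `|x - y| < e -> ~ closure D y.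
Proof.
move=> nx; have : nbhs x (~` closure D).
  by apply: open_nbhs_nbhs; split => //; exact/closed_openC/closed_closure.
move=> /nbhs_ballP[e /= e0 h]; exists e => // y xy; apply: h.
by rewrite -ball_normE.
Qed.

Lemma closed_closure_le D (f : H -> R) r : continuous f -> (forall x, D x -> r <= f x) ->
  forall x, closure D x -> r <= f x.
Proof.
move=> cf h x; rewrite leNgt => cx; apply/negP => fx.
have := cf x => /cvgrPdist_lt /(_ (r - f x)); rewrite subr_gt0 => /(_ fx) hn.
have [y [Dy]] := cx _ hn; rewrite /= ltr_norml => /andP[h1 _].
by have := h y Dy; lra.
Qed.

Lemma bounded_closure_compact D : bounded_set D -> compact (closure D).
Proof.
move=> [M [_ /(_ (M + 1))]]; rewrite ltrDl ltr01 => /(_ isT) hM.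
apply: (@subclosed_compact _ _ [set xi : H | `|xi| <= M + 1]); [exact: closed_closure|exact: compact_heis_box|].
move=> x cx; rewrite /= -lerN2; apply: (closed_closure_le (f := fun x => - `|x|)) cx.
  by move=> y; apply: cvgN; exact: norm_continuous.
by move=> y Dy; rewrite lerN2; exact: hM.
Qed.

(** N points from q to its nearest point z0 in the closure; minimality along the segment from z0 to
    w gives ip N (w - z0) >= 0, and ip N (z0 - q) = sqn N > 0 makes the inequality strict. *)
Lemma separation D q : D !=set0 -> bounded_set D -> convex_set D -> ~ closure D q ->
  exists2 N : H, N != 0 & forall w, D w -> ip N q < ip N w.
Proof.
move=> [w0 Dw0] bD cD nq.
have cq : continuous (fun z => sqn (z - q)).
  move=> z; apply: (@continuous_comp _ _ _ (fun z => z - q) sqn); last exact: continuous_sqn.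
  by apply: cvgB; [exact: cvg_id|exact: cvg_cst].
have [z0 /set_mem cz0 zmin] : exists2 c, c \in closure D &
    forall t, t \in closure D -> sqn (c - q) <= sqn (t - q).
  apply: compact_EVT_min; first by exists w0; exact: subset_closure.
    exact: bounded_closure_compact.
  exact: continuous_subspaceT.
have N0 : z0 - q != 0 by apply: contra_notN nq; rewrite subr_eq0 => /eqP <-.
exists (z0 - q) => // w Dw.
have h (s : R) : 0 <= s <= 1 -> sqn (z0 - q) <= sqn (z0 - q + s *: (w - z0)).
  move=> s01.
  have : sqn (z0 - q) <= sqn (s *: w + (1 - s) *: z0 - q).
    apply: (@closed_closure_le D (fun z => sqn (s *: w + (1 - s) *: z - q))) cz0.
      move=> z; apply: (@continuous_comp _ _ _ (fun z => s *: w + (1 - s) *: z) (fun z => sqn (z - q))); last exact: cq.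
      by apply: cvgD; [exact: cvg_cst|apply: cvgZr; exact: cvg_id].
    move=> z Dz; apply: zmin; apply/mem_set/subset_closure.
    exact: convex_setE.
  suff -> : s *: w + (1 - s) *: z0 - q = z0 - q + s *: (w - z0) by [].
  by rewrite [RHS]addrAC; congr (_ - q); rewrite scalerBr scalerBl scale1r addrCA.
have ip0 : 0 <= ip (z0 - q) (w - z0).
  rewrite leNgt; apply/negP => neg.
  set P := ip _ _ in neg; set Q := sqn (w - z0).
  have Q0 : 0 <= Q by exact: sqn_ge0.
  (* A step so short that the quadratic term s^2 Q cannot outweigh the negative linear term 2 s P; Q
     + 1 avoids dividing by zero. *)
  pose s := Num.min 1 (- P / (Q + 1)).
  have s0 : 0 < s by rewrite lt_min ltr01 divr_gt0 ?oppr_gt0// ltr_wpDl.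
  have s1 : s <= 1 by rewrite ge_min lexx.
  have s2 : s * (Q + 1) <= - P by rewrite -ler_pdivlMr ?ltr_wpDl// ge_min lexx orbT.
  have := h s; rewrite (ltW s0) s1 => /(_ isT); rewrite sqn_line -/P -/Q => hh.
  have : 0 <= s * (2 * P + s * Q) by move: hh; lra.
  by rewrite pmulr_rge0//; lra.
have := sqn_gt0 N0; rewrite -ip_sqn.
have -> : ip (z0 - q) (z0 - q) = ip (z0 - q) z0 - ip (z0 - q) q by exact: hlinB.
by move: ip0; rewrite {1}/ip hlinB -!/(ip _ _); lra.
Qed.

(** Otherwise the closure contains a ball around zeta. Continuing the segment from a point w of D
    slightly beyond zeta and approximating its end by z in D, zeta lies between z and a point w' of
    D near w, hence in D, which is open. *)
Lemma boundary_exterior D zeta e : open D -> convex_set D -> D !=set0 ->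
  boundary D zeta -> 0 < e -> exists2 z, ~ closure D z & `|zeta - z| < e.
Proof.
move=> oD cD [w Dw] [_ nD] e0; move: nD; rewrite ((interior_id D).1 oD) => nD.
apply: contrapT => hn.
have hcl z : `|zeta - z| < e -> closure D z.
  by move=> hz; apply: contrapT => nz; apply: hn; exists z.
have [r /= r0 hr] : exists2 r, 0 < r & forall y, `|w - y| < r -> D y.
  have : nbhs w D by apply: open_nbhs_nbhs; split.
  by move=> /nbhs_ballP[r /= r0 h]; exists r => // y wy; apply: h; rewrite -ball_normE.
pose t := e / (2 * (1 + `|zeta - w|)).
have d0 : 0 < 2 * (1 + `|zeta - w|) by rewrite mulr_gt0// ltr_pwDl.
have t0 : 0 < t by rewrite divr_gt0.
have : closure D (zeta + t *: (zeta - w)).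
  apply: hcl; rewrite opprD addrA subrr add0r normrN normrZ gtr0_norm//.
  rewrite /t mulrAC ltr_pdivrMr// ltr_pM2l//; have := normr_ge0 (zeta - w); lra.
move=> /closure_ballP/(_ (t * r)); rewrite mulr_gt0// => /(_ isT)[z Dz hz].
(* Chosen so that zeta = (z + t w') / (1 + t). *)
pose w' := w + t^-1 *: (zeta + t *: (zeta - w) - z).
have Dw' : D w'.
  apply: hr; rewrite /w' opprD addrA subrr add0r normrN normrZ gtr0_norm ?invr_gt0//.
  by rewrite mulrC ltr_pdivrMr// mulrC.
have t1 : 0 < 1 + t by rewrite addr_gt0.
apply: nD; have -> : zeta = (1 + t)^-1 *: z + (1 - (1 + t)^-1) *: w'.
  have -> : 1 - (1 + t)^-1 = (1 + t)^-1 * t by field; rewrite gt_eqF.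
  have tw : t *: w' = t *: w + (zeta + t *: (zeta - w) - z).
    by rewrite /w' [LHS]scalerDr [t *: (t^-1 *: _)]scalerA divff ?gt_eqF// scale1r.
  rewrite -scalerA -scalerDr tw; apply: (scalerI (lt0r_neq0 t1)).
  rewrite [RHS]scalerA divff ?gt_eqF// scale1r addrCA addrC [z + _]addrC subrK.
  by rewrite scalerDl scale1r scalerBr -addrA subrK.
apply: convex_setE => //.
by rewrite invr_ge0 (ltW t1)/= invf_le1// lerDl ltW.
Qed.

(** Enumerates the rational points outside the closure; a point above the bounding box stands in for
    the indices that do not give one. *)
Lemma exterior_seq D : bounded_set D -> exists2 f : nat -> H, forall j, ~ closure D (f j) &
  forall z e, ~ closure D z -> 0 < e -> exists j, `|z - f j| < e.
Proof.
move=> [M [_ /(_ (Num.max 0 (M + 1)))]]; rewrite lt_max ltrDl ltr01 orbT => /(_ isT) hM.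
have M0 : 0 <= Num.max 0 (M + 1) by rewrite le_max lexx.
set M' := Num.max 0 _ in hM M0.
have nz : ~ closure D (0, 0, M' + 1).
  move=> /closure_ballP/(_ 1 ltr01)[y Dy hy]; have := hM y Dy; rewrite /= leNgt => /negP; apply.
  have : `|(0, 0, M' + 1) : H| <= `|(0, 0, M' + 1) - y| + `|y|.
    by rewrite (le_trans _ (ler_normD _ _))// subrK.
  have : M' + 1 <= `|(0, 0, M' + 1) : H|.
    have : [&& `|(0, 0, M' + 1) : H| <= `|(0, 0, M' + 1) : H| & true] by rewrite lexx.
    rewrite andbT heis_norm_le /= => /and3P[_ _]; apply: le_trans; exact: ler_norm.
  lra.
exists (fun j => if unpickle j is Some q then
    if `[< closure D (rat_point q) >] then (0, 0, M' + 1) else rat_point q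
  else (0, 0, M' + 1)).
  by move=> j; case: unpickle => // q; case: ifPn => // /asboolPn.
move=> z e nzD e0; have [e' e'0 he'] := not_closure_ball nzD.
have m0 : 0 < Num.min e e' by rewrite lt_min e0.
have [q hq] := rat_point_dense z m0.
exists (pickle q); rewrite pickleK; move: hq; rewrite -ball_normE /= lt_min => /andP[h1 h2].
by rewrite ifF//; apply/asboolPn/he'.
Qed.

Lemma ip_le u v : `|ip u v| <= (2 * n%:R + 1) * `|u| * `|v|.
Proof.
have /and3P[u1 u2 u3] : [&& `|u.1.1| <= `|u|, `|u.1.2| <= `|u| & `|u.2| <= `|u|] by rewrite -heis_norm_le.
have /and3P[v1 v2 v3] : [&& `|v.1.1| <= `|v|, `|v.1.2| <= `|v| & `|v.2| <= `|v|] by rewrite -heis_norm_le.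
have hd (w y : 'rV[R]_n) : `|w| <= `|u| -> `|y| <= `|v| -> `|dotv w y| <= n%:R * (`|u| * `|v|).
  move=> wu yv; apply: le_trans (ler_norm_sum _ _ _) _.
  have -> : n%:R * (`|u| * `|v|) = \sum_(i < n) (`|u| * `|v|) by rewrite sumr_const card_ord mulr_natl.
  apply: ler_sum => i _; rewrite normrM; apply: ler_pM => //.
    exact: le_trans (rV_coord_le _ _) wu.
  exact: le_trans (rV_coord_le _ _) yv.
have h3 : `|u.2 * v.2| <= `|u| * `|v| by rewrite normrM; exact: ler_pM.
have := hd _ _ u1 v1; have := hd _ _ u2 v2; move: h3; rewrite /ip /hlin.
move=> h3 h2 h1; apply: le_trans (ler_normD _ _) _.
apply: (@le_trans _ _ (n%:R * (`|u| * `|v|) + n%:R * (`|u| * `|v|) + `|u| * `|v|)); last by lra.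
by apply: lerD => //; apply: le_trans (ler_normD _ _) _; exact: lerD.
Qed.

(** [delta] may depend on zeta but not on the half-space, whose normal N varies with the
    approximating exterior point. If the t-component of N is a fixed fraction of |N|, the quadratic
    bound is effective; otherwise the horizontal normal at zeta has length at least |N| / 4 and the
    linear bound is. *)
Lemma barrier_small zeta e : 0 < e -> exists2 delta, 0 < delta &
  forall (N q : H) dv, N != 0 -> `|zeta - q| < delta ->
    dv ^+ 2 * `|N.2| <= 2 * ip N (zeta - q) ->
    dv * Num.sqrt (hnormal2 N.1.1 N.1.2 N.2 zeta) <= 2 * ip N (zeta - q) -> dv <= e.
Proof.
move=> e0; pose C : R := 2 * n%:R + 1.
have C0 : 0 < C by rewrite ltr_wpDl// mulr_ge0.
(* Below this fraction the term 2 |N_t| |zeta| in the horizontal normal is at most |N| / 2. *)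
pose th : R := (4 * (1 + `|zeta|))^-1.
have th0 : 0 < th by rewrite invr_gt0 mulr_gt0// ltr_pwDl.
have thz : th * (4 * (1 + `|zeta|)) = 1 by rewrite mulVf// gt_eqF// mulr_gt0// ltr_pwDl.
exists (Num.min (e ^+ 2 * th / (2 * C)) (e / (8 * C))).
  by rewrite lt_min !(divr_gt0, mulr_gt0) ?exprn_gt0.
move=> N q dv N0; rewrite lt_min => /andP[d1 d2] h1 h2.
have M0 : 0 < `|N| by rewrite normr_gt0.
have hl : ip N (zeta - q) <= C * `|N| * `|zeta - q| := le_trans (ler_norm _) (ip_le _ _).
have [dv0|dv0] := leP dv 0; first exact: le_trans dv0 (ltW e0).
have [big|small] := leP (th * `|N|) `|N.2|.
  have : dv ^+ 2 * (th * `|N|) <= 2 * (C * `|N| * `|zeta - q|).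
    apply: le_trans (le_trans h1 _); first by rewrite ler_wpM2l ?sqr_ge0.
    by rewrite ler_wpM2l.
  move: d1; rewrite ltr_pdivlMr ?mulr_gt0// => d1 h3.
  have : dv ^+ 2 * th * `|N| <= e ^+ 2 * th * `|N|.
    apply: (@le_trans _ _ (`|zeta - q| * (2 * C) * `|N|)); first by move: h3; lra.
    by rewrite ler_wpM2r// ltW.
  rewrite ler_pM2r// ler_pM2r//.
  by rewrite ler_pXn2r// nnegrE ltW.
have hz : 2 * `|N.2| * `|zeta| <= `|N| / 2.
  have : `|N.2| * `|zeta| <= th * `|N| * `|zeta| by rewrite ler_wpM2r// ltW.
  have : th * `|N| * `|zeta| <= `|N| / 4.
    have -> : `|N| / 4 = th * `|N| * (1 + `|zeta|) by rewrite /th; field; rewrite gt_eqF// ltr_pwDl.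
    by rewrite ler_wpM2l ?mulr_ge0 ?(ltW th0)// lerDr.
  lra.
(* Some horizontal coordinate of N nearly attains the maximum norm; 3 / 4 - 1 / 2 leaves the 1 / 4
   of the next bound. *)
have [i hi] : exists i, 3 / 4 * `|N| < `|if i.2 then N.1.1 0 i.1 else N.1.2 0 i.1|.
  apply: contrapT => hn.
  have hc i : `|if i.2 then N.1.1 0 i.1 else N.1.2 0 i.1| <= 3 / 4 * `|N|.
    by rewrite leNgt; apply/negP => hi; apply: hn; exists i.
  have t34 : 0 <= 3 / 4 * `|N| by rewrite mulr_ge0// divr_ge0.
  have : `|N| <= 3 / 4 * `|N|.
    rewrite heis_norm_le; apply/and3P; split.
    - by apply/rV_norm_le => // i; exact: hc (i, true).
    - by apply/rV_norm_le => // i; exact: hc (i, false).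
    - have th1 : th <= 1 / 4.
        by have := normr_ge0 zeta; move: thz th0; set Z := `|zeta|; nra.
      apply: le_trans (ltW small) _; rewrite ler_wpM2r//; lra.
  lra.
have hs : `|N| / 4 <= Num.sqrt (hnormal2 N.1.1 N.1.2 N.2 zeta).
  have h3 : `|N| / 4 <= `|hnormal N.1.1 N.1.2 N.2 i zeta|.
    have /and3P[z1 z2 z3] : [&& `|zeta.1.1| <= `|zeta|, `|zeta.1.2| <= `|zeta| & `|zeta.2| <= `|zeta|] by rewrite -heis_norm_le.
    have hb (w : 'rV[R]_n) : `|w| <= `|zeta| -> `|2 * N.2 * w 0 i.1| <= `|N| / 2.
      move=> wz; rewrite !normrM (ger0_norm (_ : 0 <= 2))//; apply: le_trans hz.
      by rewrite ler_wpM2l ?mulr_ge0// (le_trans (rV_coord_le _ _)).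
    rewrite /hnormal; move: hi; case: ifP => _ hi.
      have := ler_normB (N.1.1 0 i.1 + 2 * N.2 * zeta.1.2 0 i.1) (2 * N.2 * zeta.1.2 0 i.1).
      by rewrite addrK; have := hb _ z2; lra.
    have := ler_normD (N.1.2 0 i.1 - 2 * N.2 * zeta.1.1 0 i.1) (2 * N.2 * zeta.1.1 0 i.1).
    by rewrite subrK; have := hb _ z1; lra.
  apply: le_trans h3 _; rewrite -sqrtr_sqr ler_wsqrtr// /hnormal2 (bigD1 i)//= lerDl.
  by apply: sumr_ge0 => j _; exact: sqr_ge0.
have : dv * (`|N| / 4) <= 2 * (C * `|N| * `|zeta - q|).
  apply: le_trans (le_trans h2 _); last by rewrite ler_wpM2l.
  by rewrite ler_wpM2l// ltW.
move: d2; rewrite ltr_pdivlMr ?mulr_gt0// => d2 h3.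
have : dv * `|N| <= e * `|N|.
  apply: (@le_trans _ _ (`|zeta - q| * (8 * C) * `|N|)); first by move: h3; lra.
  by rewrite ler_wpM2r// ltW.
by rewrite ler_pM2r.
Qed.

End convex_geometry.

Section hardy_domains.
Context {R : realType} {n : nat}.
Local Notation H := (heis R n).
Local Notation E := ('I_n * bool)%type.
Implicit Types (xi zeta : H) (D : set H).
Variable p : R.
Hypotheses (n0 : (0 < n)%N) (p1 : 1 < p).
Let p0 : 0 < p. Proof. exact: lt_trans ltr01 p1. Qed.

(** Barriers depend on eta and on the support of u, so smallness at the boundary is asked of any
    number [r] satisfying the two bounds that [exists_barrier] guarantees for all of them. *)
Lemma hardy_of_affine D (N : nat -> H) (k : nat -> R) : open D ->
  (forall j, N j != 0) ->
  (forall j xi, D xi -> 0 < haff (N j).1.1 (N j).1.2 (N j).2 (k j) xi) ->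
  (forall zeta e, boundary D zeta -> 0 < e -> exists j, forall r,
    r ^+ 2 * `|(N j).2| <= 2 * haff (N j).1.1 (N j).1.2 (N j).2 (k j) zeta ->
    r * Num.sqrt (hnormal2 (N j).1.1 (N j).1.2 (N j).2 zeta) <=
      2 * haff (N j).1.1 (N j).1.2 (N j).2 (k j) zeta -> r <= e) ->
  hardy p D (((p - 1) / p) `^ p).
Proof.
move=> oD N0 hD hbd u uD; have [su cu uK] := uD.
have x1 : (p - 1) / p < 1 by rewrite ltr_pdivrMr//; lra.
set x := (p - 1) / p in x1.
apply: (hardy_limit p1 oD uD (eta0 := (1 - x) / 2)); first by rewrite divr_gt0// subr_gt0.
move=> eta /andP[eta0 eta1].
have x0 : 0 < x by rewrite divr_gt0// subr_gt0.
have hK j xi : tsupport u xi -> 0 < haff (N j).1.1 (N j).1.2 (N j).2 (k j) xi.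
  by move=> /uK; exact: hD.
have hN j : ((N j).1.1, (N j).1.2, (N j).2) != 0 :> H.
  by have := N0 j; case: (N j) => [[]].
have [T hT] : exists T : nat -> (H -> R) * (E -> H -> R) * (E -> H -> R), forall j,
    [/\ hregular (T j).1.1 (T j).1.2 (T j).2,
        forall xi, tsupport u xi -> 0 < (T j).1.1 xi,
        forall xi, tsupport u xi -> (p - 1) * (1 - eta) <=
          - (T j).1.1 xi * \sum_e (T j).2 e xi + (p - 1) * \sum_e (T j).1.2 e xi ^+ 2,
        forall xi zeta, (((T j).1.1 xi - (T j).1.1 zeta)%:E <= ccnorm (hmul (hinv zeta) xi))%E &
        forall zeta, 0 <= haff (N j).1.1 (N j).1.2 (N j).2 (k j) zeta ->
          (T j).1.1 zeta ^+ 2 * `|(N j).2| <= 2 * haff (N j).1.1 (N j).1.2 (N j).2 (k j) zeta /\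
          (T j).1.1 zeta * Num.sqrt (hnormal2 (N j).1.1 (N j).1.2 (N j).2 zeta) <=
            2 * haff (N j).1.1 (N j).1.2 (N j).2 (k j) zeta].
  suff BT j : exists t : (H -> R) * (E -> H -> R) * (E -> H -> R),
    [/\ hregular t.1.1 t.1.2 t.2,
        forall xi, tsupport u xi -> 0 < t.1.1 xi,
        forall xi, tsupport u xi -> (p - 1) * (1 - eta) <=
          - t.1.1 xi * \sum_e t.2 e xi + (p - 1) * \sum_e t.1.2 e xi ^+ 2,
        forall xi zeta, ((t.1.1 xi - t.1.1 zeta)%:E <= ccnorm (hmul (hinv zeta) xi))%E &
        forall zeta, 0 <= haff (N j).1.1 (N j).1.2 (N j).2 (k j) zeta ->
          t.1.1 zeta ^+ 2 * `|(N j).2| <= 2 * haff (N j).1.1 (N j).1.2 (N j).2 (k j) zeta /\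
          t.1.1 zeta * Num.sqrt (hnormal2 (N j).1.1 (N j).1.2 (N j).2 zeta) <=
            2 * haff (N j).1.1 (N j).1.2 (N j).2 (k j) zeta].
    by exists (fun j => sval (cid (BT j))) => j; exact: svalP (cid (BT j)).
  have [d [d1 [d2 [h1 h2 h3 h4 h5]]]] := exists_barrier n0 (hN j) p1 eta0 cu (hK j).
  exists (d, d1, d2); split; [exact: h1| |exact: h3|exact: h4|exact: h5].
  by move=> xi /(hK j); exact: h2.
have eta01 : 0 < eta < 1 by rewrite eta0/=; lra.
have etax : (p - 1) / p <= (1 - eta) ^+ 2.
  rewrite -/x; have : 0 <= eta ^+ 2 by exact: sqr_ge0.
  by rewrite sqrrB expr1n mul1r; lra.
apply: (hardy_sequence p1 uD eta01 etax (d := fun j => (T j).1.1) (d1 := fun j => (T j).1.2)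
    (d2 := fun j => (T j).2)).
- by move=> j; have [] := hT j.
- by move=> j xi Kxi; have [_ + _ _ _] := hT j; apply.
- by move=> j xi Kxi; have [_ _ + _ _] := hT j; apply.
(* At a boundary point zeta some barrier is at most e, and it is 1-Lipschitz for the distance: d_j
   xi - d_j zeta >= r - e. *)
move=> xi r Kxi hr; apply: le_ereal_inf_tmp => _ [zeta zD <-].
apply/lee_addgt0Pr => e e0; have [j hj] := hbd zeta e zD e0.
have [_ _ _ h1 h2] := hT j.
have hz : 0 <= haff (N j).1.1 (N j).1.2 (N j).2 (k j) zeta.
  apply: (closed_closure_le (D := D)); first exact: continuous_haff.
    by move=> y /(hD j)/ltW.
  by case: zD.
have [h3 h4] := h2 zeta hz; have := hj _ h3 h4 => dze.
apply: (@le_trans _ _ (((T j).1.1 xi - (T j).1.1 zeta)%:E + e%:E)%E).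
  by rewrite -EFinD lee_fin; have := hr j; lra.
by rewrite leeD2r.
Qed.

Lemma hardy_half_space D : half_space D -> hardy p D (((p - 1) / p) `^ p).
Proof.
move=> [a [b [c [k [abc0 DE]]]]].
have DP xi : D xi <-> 0 < haff a b c k xi by rewrite DE /= /haff subr_gt0.
have oD : open D.
  rewrite (_ : D = haff a b c k @^-1` [set r | 0 < r]).
    by apply: open_comp; [move=> xi _; exact: continuous_haff|exact: open_gt].
  by apply/seteqP; split=> xi /DP.
apply: (@hardy_of_affine D (fun=> (a, b, c)) (fun=> k)) => //.
  by move=> _ xi /DP.
move=> zeta e [cz nz] e0; exists 0%N => r /=.
have -> : haff a b c k zeta = 0.
  apply/le_anti/andP; split.
    by rewrite leNgt; apply/negP => /DP; rewrite ((interior_id D).1 oD) in nz.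
  apply: (closed_closure_le (D := D)) cz; first exact: continuous_haff.
  by move=> y /DP/ltW.
(* On the boundary both bounds have right-hand side 0: the linear one settles c = 0, where N is a
   nonzero constant, the quadratic one c <> 0. *)
rewrite mulr0 => h1 h2.
have [c0|c0] := eqVneq c 0.
  have : 0 < hnormal2 a b c zeta.
    by rewrite c0 in abc0 *; rewrite (hnormal2_vert a b zeta); exact: vert_gt0.
  by rewrite -sqrtr_gt0 => s0; move: h2; rewrite pmulr_lle0// => /le_trans; apply; exact: ltW.
move: h1; rewrite pmulr_lle0 ?normr_gt0// => h1.
have : r ^+ 2 == 0 by rewrite eq_le h1 sqr_ge0.
by rewrite sqrf_eq0 => /eqP ->; exact: ltW.
Qed.

(** The j-th hyperplane passes through the exterior point [f j], so at a boundary point close to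
    [f j] the affine function is small compared with its normal. *)
Lemma hardy_convex D : domain D -> bounded_set D -> convex_set D ->
  hardy p D (((p - 1) / p) `^ p).
Proof.
move=> [oD _ D0] bD cD; have [f fD fdense] := exterior_seq bD.
have S j := separation D0 bD cD (fD j).
pose N j := sval (cid2 (S j)).
have N0 j : N j != 0 by rewrite /N; case: cid2.
have hN j w : D w -> ip (N j) (f j) < ip (N j) w by rewrite /N; case: cid2 => x /= _; apply.
have hE' j z : haff (N j).1.1 (N j).1.2 (N j).2 (ip (N j) (f j)) z = ip (N j) (z - f j).
  by rewrite /ip hlinB.
apply: (@hardy_of_affine D N (fun j => ip (N j) (f j))) => //.
  by move=> j xi /(hN j); rewrite /haff subr_gt0.
move=> zeta e zD e0; have [delta delta0 hd] := barrier_small zeta e0.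
have d20 : 0 < delta / 2 by rewrite divr_gt0.
have [z nz hz] := boundary_exterior oD cD D0 zD d20.
have [j hj] := fdense z _ nz d20.
exists j => r; rewrite hE'; apply: hd => //.
have -> : zeta - f j = (zeta - z) + (z - f j) by rewrite addrA subrK.
by apply: le_lt_trans (ler_normD _ _) _; lra.
Qed.

End hardy_domains.

(** * Sharpness in a half-space *)

Section flat_functions.
Context {R : realType}.
Implicit Types (g r : R).

(** The exponent is kept as a parameter because differentiation only shifts it: these flat functions
    span a space closed under derivatives. *)
Definition kf g r : R := if 0 < r then r `^ g * expR (- r^-1) else 0.

Lemma kf_gt0 g r : 0 < r -> 0 < kf g r.
Proof. by move=> r0; rewrite /kf r0 mulr_gt0 ?powR_gt0 ?expR_gt0. Qed.

Lemma kf_ge0 g r : 0 <= kf g r.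
Proof. by have [/(kf_gt0 g)/ltW//|r0] := ltP 0 r; rewrite /kf ltNge r0. Qed.

Lemma kf_le0 g r : r <= 0 -> kf g r = 0.
Proof. by move=> r0; rewrite /kf ltNge r0. Qed.

Lemma kf_le_powR g r : 0 <= r -> kf g r <= r `^ g.
Proof.
rewrite /kf; case: ifP => [r0 _|_ _]; last exact: powR_ge0.
by rewrite ler_piMr ?powR_ge0// -expR0 ler_expR oppr_le0 invr_ge0 ltW.
Qed.

Lemma kf_powRM g g' r : 0 < r -> kf (g + g') r = r `^ g * kf g' r.
Proof. by move=> r0; rewrite /kf r0 powRDp// mulrA. Qed.

(** exp (- 1 / r) <= (m r)^m, with m so large that g + m >= 1. It yields the derivative of [kf] at
    0. *)
Lemma kf_flat g : exists2 C, 0 <= C & forall r, r <= 1 -> kf g r <= C * `|r|.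
Proof.
pose m := (Num.bound `|1 - g|).+1.
have mg : 1 <= g + m%:R.
  have : `|1 - g| < m%:R.
    by rewrite (lt_le_trans (archi_boundP _))// ler_nat.
  by have := ler_norm (1 - g); lra.
have m0 : 0 < m%:R :> R by rewrite ltr0n.
exists (m%:R ^+ m); first by rewrite exprn_ge0// ltW.
move=> r r1; have [r0|r0] := ltP 0 r; last by rewrite kf_le0// mulr_ge0// exprn_ge0// ltW.
have e1 : expR (- r^-1) <= (m%:R * r) ^+ m.
  have x0 : 0 < (m%:R * r)^-1 by rewrite invr_gt0 mulr_gt0.
  have -> : - r^-1 = - ((m%:R * r)^-1 * m%:R).
    by congr (- _); field; rewrite !gt_eqF.
  rewrite expRN expRM_natr -exprVn lerXn2r ?nnegrE ?invr_ge0 ?expR_ge0 ?mulr_ge0 ?(ltW r0)//.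
  rewrite -[leRHS]invrK lef_pV2 ?posrE ?expR_gt0//.
  by apply: le_trans (expR_ge1Dx _); rewrite lerDr.
rewrite /kf r0 (gtr0_norm r0); apply: le_trans (ler_wpM2l (powR_ge0 _ _) e1) _.
rewrite exprMn mulrCA ler_wpM2l ?exprn_ge0 ?(ltW m0)// -powR_mulrn ?(ltW r0)// -powRDp//.
by apply: ge1r_powR => //; rewrite r0.
Qed.

Lemma is_derive_kf g r : is_derive r 1 (kf g) (g * kf (g - 1) r + kf (g - 2) r).
Proof.
have [r0|r0|->] := ltgtP r 0.
- rewrite !kf_le0 ?(ltW r0)// mulr0 addr0.
  apply: (@near_eq_is_derive _ _ _ (fun=> 0)).
  by near=> y; rewrite kf_le0// ltW//; near: y; exact: lt_nbhsl.
- apply: (@near_eq_is_derive _ _ _ (fun r => r `^ g * expR (- r^-1))).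
    by near=> y; rewrite /kf ifT//; near: y; exact: lt_nbhsr.
  have rn0 : r != 0 by rewrite gt_eqF.
  have h := isd_comp (f := fun y : R => - y^-1) (is_derive_expR (- r^-1)) (isd_opp (isd_inv rn0 (is_derive_id r 1))).
  apply: isd_eq (isd_mul (isd_powR g r0 (is_derive_id r 1)) h) _.
  rewrite /kf r0 -[2]/(2%:R) (powRDp _ (- 2%:R) r0) powR_invn ?(ltW r0)//.
  by rewrite mulr1; ring.
rewrite !kf_le0 ?lexx// mulr0 addr0.
have h : (fun h : R => h^-1 * (kf g (h * 1 + 0) - kf g 0)) @ 0^' --> (0 : R).
  have [C C0 hC] := kf_flat (g - 1).
  apply/cvgrPdist_lt => e e0.
  have d0 : 0 < Num.min 1 (e / (C + 1)) by rewrite lt_min ltr01 divr_gt0// ltr_wpDl.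
  apply/nbhs_ballP; exists (Num.min 1 (e / (C + 1))) => //= y.
  rewrite /ball /= sub0r normrN lt_min => /andP[y1 y2] y0.
  rewrite mulr1 addr0 (@kf_le0 g 0)// subr0 sub0r normrN.
  have [yp|yn] := ltP 0 y; last by rewrite kf_le0// mulr0 normr0.
  have -> : y^-1 * kf g y = kf (g - 1) y.
    by rewrite addrC kf_powRM// powR_inv1// ltW.
  rewrite ger0_norm ?kf_ge0//; apply: le_lt_trans (hC y _) _.
    by rewrite (le_trans (ler_norm _))// ltW.
  move: y2; rewrite ltr_pdivlMr ?ltr_wpDl// => y2.
  by have := normr_ge0 y; move: y2; lra.
apply: DeriveDef; first by apply/cvg_ex; exists 0.
exact: cvg_lim.
Unshelve. all: by end_near. Qed.

Lemma continuous_kf g : continuous (kf g).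
Proof. by move=> r; exact: isd_continuous (is_derive_kf g r). Qed.

End flat_functions.

Section smooth_class.
Context {R : realType} {n : nat}.
Local Notation H := (heis R n).

Definition affine_on (f : H -> R) := continuous f /\
  exists L : H -> R, forall xi v (s : R), f (xi + s *: v) = f xi + s * L v.

(** A class of functions closed under every directional derivative, which turns the quantification
    over all lists of directions in [smooth] into an induction. *)
Inductive sclass : (H -> R) -> Prop :=
| sclass_cst c : sclass (fun=> c)
| sclass_kf g f : affine_on f -> sclass (fun xi => kf g (f xi))
| sclass_add f g : sclass f -> sclass g -> sclass (fun xi => f xi + g xi)
| sclass_mul f g : sclass f -> sclass g -> sclass (fun xi => f xi * g xi).

Lemma sclass_continuous f : sclass f -> continuous f.
Proof.
elim=> [c|g f0 [cf _]|f0 g _ cf _ cg|f0 g _ cf _ cg] xi.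
- exact: cvg_cst.
- apply: (@continuous_comp _ _ _ f0 (kf g)); [exact: cf|exact: continuous_kf].
- by apply: cvgD; [exact: cf|exact: cg].
- by apply: cvgM; [exact: cf|exact: cg].
Qed.

Lemma sclass_derive f v : sclass f -> exists2 f', sclass f' & forall xi, is_derive xi v f (f' xi).
Proof.
elim=> [c|g f0 [cf [L hL]]|f0 g sf [f' sf' df] sg [g' sg' dg]|f0 g sf [f' sf' df] sg [g' sg' dg]].
- by exists (fun=> 0); [exact: sclass_cst|move=> xi; exact: isd_cst].
- exists (fun xi => (g * kf (g - 1) (f0 xi) + kf (g - 2) (f0 xi)) * L v).
    apply: sclass_mul; last exact: sclass_cst.
    apply: sclass_add; last by apply: sclass_kf; split => //; exists L.
    by apply: sclass_mul; [exact: sclass_cst|apply: sclass_kf; split => //; exists L].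
  move=> xi; apply: isd_comp; first exact: is_derive_kf.
  by apply: is_derive_affine => s; exact: hL.
- exists (fun xi => f' xi + g' xi); first exact: sclass_add.
  by move=> xi; exact: isd_add.
- exists (fun xi => f' xi * g xi + f0 xi * g' xi).
    by apply: sclass_add; exact: sclass_mul.
  by move=> xi; exact: isd_mul.
Qed.

Lemma sclass_D f v : sclass f -> sclass (fun xi => 'D_v f xi).
Proof.
move=> /(sclass_derive v)[f' sf' df].
by rewrite (_ : (fun xi => _) = f')//; apply/funext => xi; have [_ ->] := df xi.
Qed.

Lemma sclass_smooth f : sclass f -> smooth f.
Proof.
move=> sf vs /=; have sw : sclass (foldr (fun v f xi => 'D_v f xi) f vs).
  by elim: vs => //= v vs; exact: sclass_D.
split; first exact: sclass_continuous.
by move=> xi v; have [f' _ /(_ xi)[]] := sclass_derive v sw.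
Qed.

Lemma sclass_prod (I : Type) (s : seq I) (f : I -> H -> R) :
  (forall i, sclass (f i)) -> sclass (fun xi => \prod_(i <- s) f i xi).
Proof.
move=> sf; elim: s => [|i s IH].
  by rewrite (_ : (fun xi => _) = fun=> 1); [exact: sclass_cst|apply/funext => xi; rewrite big_nil].
rewrite (_ : (fun xi => _) = (fun xi => f i xi * \prod_(j <- s) f j xi)); first exact: sclass_mul.
by apply/funext => xi; rewrite big_cons.
Qed.

Lemma affine_haff (a b : 'rV[R]_n) c k : affine_on (haff a b c k).
Proof. by split; [exact: continuous_haff|exists (hlin a b c) => xi v s; exact: haff_line]. Qed.

Lemma affine_lin (f : H -> R) (r k : R) : affine_on f -> affine_on (fun xi => r * f xi + k).
Proof.
move=> [cf [L hL]]; split.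
  move=> xi; apply: cvgD; last exact: cvg_cst.
  by apply: cvgM; [exact: cvg_cst|exact: cf].
by exists (fun v => r * L v) => xi v s; rewrite hL; ring.
Qed.

Lemma affineD (f g : H -> R) : affine_on f -> affine_on g -> affine_on (fun xi => f xi + g xi).
Proof.
move=> [cf [L hL]] [cg [M hM]]; split.
  by move=> xi; apply: cvgD; [exact: cf|exact: cg].
by exists (fun v => L v + M v) => xi v s; rewrite hL hM; ring.
Qed.

End smooth_class.

(** * The boundary distance of a half-space from above *)

Section boundary_distance.
Context {R : realType} {n : nat}.
Local Notation H := (heis R n).
Local Notation E := ('I_n * bool)%type.
Implicit Types (xi zeta : H).

Lemma horizontal_pairE (a b : 'rV[R]_n) xi :
  \sum_(i < n) (a 0 i *: hX i xi + b 0 i *: hY i xi) =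
  (a, b, 2 * (dotv a xi.1.2 - dotv b xi.1.1)).
Proof.
pose F (i : 'I_n) : H := a 0 i *: hX i xi + b 0 i *: hY i xi.
rewrite -[LHS]/(\sum_i F i).
have -> : \sum_i F i = (\sum_i (F i).1.1, \sum_i (F i).1.2, \sum_i (F i).2).
  rewrite [LHS]surjective_pairing [(\sum_i F i).1]surjective_pairing; congr (_, _, _).
  - exact: (big_morph (fun z : H => z.1.1)).
  - exact: (big_morph (fun z : H => z.1.2)).
  - exact: (big_morph (fun z : H => z.2)).
congr (_, _, _).
- rewrite [RHS]row_sum_delta; apply: eq_bigr => i _.
  by rewrite /F /= scaler0 addr0.
- rewrite [RHS]row_sum_delta; apply: eq_bigr => i _.
  by rewrite /F /= scaler0 add0r.
- rewrite /dotv -sumrB mulr_sumr; apply: eq_bigr => i _.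
  by rewrite /F /= /GRing.scale /=; ring.
Qed.

Lemma is_derive_segment (V : normedModType R) (v : V) (s : R) :
  is_derive s 1 (fun s : R => (1 - s) *: v) (- v).
Proof.
have h : (fun h : R => h^-1 *: ((1 - (h * 1 + s)) *: v - (1 - s) *: v)) @ 0^' --> - v.
  apply/cvgrPdist_lt => e e0; near=> h.
  have h0 : h != 0 by near: h; exact: nbhs_dnbhs_neq.
  rewrite -scalerBl scalerA.
  have -> : h^-1 * (1 - (h * 1 + s) - (1 - s)) = -1 by field.
  by rewrite scaleN1r subrr normr0.
apply: DeriveDef; first by apply/cvg_ex; exists (- v).
exact: cvg_lim.
Unshelve. all: by end_near. Qed.

(** The straight segment to the origin is horizontal: the t-component 2 (a . y - b . x) of the
    velocity vanishes along multiples of (a, b). *)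
Lemma ccnorm_le (a b : 'rV[R]_n) : (ccnorm (a, b, 0%R : R) <= (hnorm (a, b))%:E)%E.
Proof.
set v : H := (a, b, 0).
apply: ge_ereal_inf; exists (hnorm (a, b))%:E => //.
exists (fun s => (1 - s) *: v), (fun=> - a), (fun=> - b); split.
- split.
    move=> e e0; exists (e / (`|v| + 1)); first by rewrite divr_gt0// ltr_wpDl.
    move=> I /allP hI _ sI.
    have -> : \sum_(i <- I) `|(1 - i.2) *: v - (1 - i.1) *: v| = (\sum_(i <- I) (i.2 - i.1)) * `|v|.
      rewrite mulr_suml big_seq [RHS]big_seq; apply: eq_bigr => i /hI /= /andP[/andP[_ i12] _].
      rewrite -scalerBl normrZ; congr (_ * _).
      have -> : 1 - i.2 - (1 - i.1) = - (i.2 - i.1) by ring.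
      by rewrite normrN ger0_norm// subr_ge0.
    move: sI; rewrite ltr_pdivlMr ?ltr_wpDl// mulrDr mulr1; apply: le_lt_trans.
    rewrite lerDl big_seq; apply: sumr_ge0 => i /hI /= /andP[/andP[_ i12] _].
    by rewrite subr_ge0.
  apply: aeW => s _; rewrite horizontal_pairE.
  have -> : (- a, - b, 2 * (dotv (- a) ((1 - s) *: v).1.2 - dotv (- b) ((1 - s) *: v).1.1)) = - v.
    congr (_, _, _) => /=; rewrite !dotvNl !dotvZr (dotvC b) oppr0 subrr mulr0//.
  exact: is_derive_segment.
- by rewrite subr0 scale1r.
- by rewrite subrr scale0r.
rewrite /hlength integral_cst//= lebesgue_measure_itv/= lte_fin ltr01 oppr0 adde0 mule1.
by congr (_%:E); rewrite /hnorm; congr (Num.sqrt _); apply: eq_bigr => i _ /=; rewrite !mxE !sqrrN.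
Qed.

Lemma hmul_hinv_mulr xi w : hmul (hinv (hmul xi w)) xi = hinv w.
Proof.
case: xi w => [[x y] t] [[x' y'] t']; rewrite /hinv /= !dotvNl !dotvDl.
rewrite (dotvC y x) (dotvC y' x) (dotvC x' y); congr (_, _, _).
- by rewrite opprD addrC addrA subrr add0r.
- by rewrite opprD addrC addrA subrr add0r.
- by rewrite /=; ring.
Qed.

Section half_space_distance.
Variables (a b : 'rV[R]_n) (c k : R) (D : set H).
Hypothesis DP : forall xi, D xi <-> 0 < haff a b c k xi.

Lemma half_space_open : open D.
Proof.
rewrite (_ : D = haff a b c k @^-1` [set r | 0 < r]).
  by apply: open_comp; [move=> xi _; exact: continuous_haff|exact: open_gt].
by apply/seteqP; split=> xi /DP.
Qed.

Lemma half_space_boundary zeta v : hlin a b c v != 0 -> haff a b c k zeta = 0 -> boundary D zeta.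
Proof.
move=> v0 z0; split; last first.
  by rewrite ((interior_id D).1 half_space_open) => /DP; rewrite z0 ltxx.
apply/closure_ballP => e e0.
pose s := Num.sg (hlin a b c v) * (e / 2 / (1 + `|v|)).
have d0 : 0 < 1 + `|v| by rewrite ltr_pwDl.
exists (zeta + s *: v).
  apply/DP; rewrite haff_line z0 add0r /s mulrAC -normrEsg mulr_gt0 ?normr_gt0//.
  by rewrite !divr_gt0.
rewrite opprD addrA subrr add0r normrN normrZ /s normrM normr_sg v0 mul1r gtr0_norm; last first.
  by rewrite !divr_gt0.
rewrite mulrAC ltr_pdivrMr//; have := normr_ge0 v; nra.
Qed.

(** Right multiplication by the horizontal vector - (l / |N|^2) N follows a horizontal line from xi
    along which l decreases linearly to 0; its length is l / |N|. *)
Lemma bdist_le xi : D xi -> 0 < hnormal2 a b c xi ->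
  (bdist D xi <= (haff a b c k xi / Num.sqrt (hnormal2 a b c xi))%:E)%E.
Proof.
move=> /DP l0 N0; set N2 := hnormal2 a b c xi in N0 *; set l := haff a b c k xi in l0 *.
pose wx := \row_i (- (l / N2) * hnormal a b c (i, true) xi).
pose wy := \row_i (- (l / N2) * hnormal a b c (i, false) xi).
have lE : hmul xi (wx, wy, 0) = xi + 1 *: \sum_(i < n) (wx 0 i *: hX i xi + wy 0 i *: hY i xi).
  rewrite horizontal_pairE scale1r; case: (xi) => [[x y] t] /=; congr (_, _, _).
  by rewrite addr0 (dotvC y) (dotvC x).
have hw : hlin a b c (\sum_(i < n) (wx 0 i *: hX i xi + wy 0 i *: hY i xi)) = - l.
  rewrite horizontal_sumE hlin_sum.
  transitivity (- (l / N2) * \sum_e hnormal a b c e xi ^+ 2).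
    rewrite mulr_sumr; apply: eq_bigr => -[i []] _; rewrite /= mxE expr2 mulrA//.
  by rewrite -/(hnormal2 a b c xi) -/N2 mulNr divfK// gt_eqF.
apply: ge_ereal_inf; exists (ccnorm (hmul (hinv (hmul xi (wx, wy, 0))) xi)).
  exists (hmul xi (wx, wy, 0)) => //.
  apply: (@half_space_boundary _ (\sum_(i < n) (wx 0 i *: hX i xi + wy 0 i *: hY i xi))).
    by rewrite hw oppr_eq0 gt_eqF.
  by rewrite lE haff_line hw mul1r subrr.
rewrite hmul_hinv_mulr.
have -> : hinv (wx, wy, 0 : R) = (- wx, - wy, 0) by rewrite /hinv; congr (_, _, _); rewrite oppr0.
apply: le_trans (ccnorm_le _ _) _; rewrite lee_fin hnormE.
have -> : \sum_(e : E) (if e.2 then (- wx) 0 e.1 else (- wy) 0 e.1) ^+ 2 = (l / Num.sqrt N2) ^+ 2.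
  transitivity ((l / N2) ^+ 2 * hnormal2 a b c xi).
    by rewrite mulr_sumr; apply: eq_bigr => -[i []] _; rewrite /= !mxE -mulNr opprK exprMn.
  rewrite -/N2 !expr_div_n sqr_sqrtr ?(ltW N0)//; field.
  by rewrite gt_eqF.
by rewrite sqrtr_sqr ger0_norm// divr_ge0 ?sqrtr_ge0// ltW.
Qed.

End half_space_distance.
End boundary_distance.

(** * One-variable profiles of the test functions *)

Section radial_cutoff.
Context {R : realType}.
Implicit Types (s r y g Y : R).
Variables (p th : R).
Hypotheses (p1 : 1 < p) (th0 : 0 < th).
Let b : R := (p - 1) / p.
Let p0 : 0 < p. Proof. exact: lt_trans ltr01 p1. Qed.
Let b0 : 0 < b. Proof. by rewrite divr_gt0// subr_gt0. Qed.
Let bp : (b - 1) * p = -1. Proof. by rewrite /b; field; rewrite gt_eqF. Qed.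

Definition kf1 (g y : R) := g * kf (g - 1) y + kf (g - 2) y.

Lemma kf1_ge0 g y : 0 <= g -> 0 <= kf1 g y.
Proof. by move=> g0; rewrite addr_ge0 ?mulr_ge0 ?kf_ge0. Qed.

(* Smooth, supported in [r >= s] and equivalent to [r^b] for large [r / s]. *)
Definition rad (s r : R) := s `^ b * kf b (s^-1 * r - 1).
Definition rad1 (s r : R) := s `^ b * (s^-1 * kf1 b (s^-1 * r - 1)).
Definition cut (s r : R) := rad s r * kf 0 (2 - r).
Definition cut1 (s r : R) := rad1 s r * kf 0 (2 - r) - rad s r * kf1 0 (2 - r).

Lemma is_derive_cut (s r : R) : is_derive r 1 (cut s) (cut1 s r).
Proof.
have h1 : is_derive r 1 (fun r => s^-1 * r - 1) s^-1.
  apply: isd_eq (isd_sub (isd_mul (isd_cst s^-1 r 1) (is_derive_id r 1)) (isd_cst 1 r 1)) _.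
  by rewrite mul0r add0r mulr1 subr0.
have h2 : is_derive r 1 (fun r : R => 2 - r) (-1).
  by apply: isd_eq (isd_sub (isd_cst 2 r 1) (is_derive_id r 1)) _; rewrite sub0r.
have h3 := isd_mul (isd_cst (s `^ b) r 1) (isd_comp (f := fun r => s^-1 * r - 1) (is_derive_kf b (s^-1 * r - 1)) h1).
apply: isd_eq (isd_mul h3 (isd_comp (f := fun r => 2 - r) (is_derive_kf 0 (2 - r)) h2)) _.
by rewrite /cut1 /rad /rad1 /kf1; ring.
Qed.

Lemma cut_ge0 s r : 0 <= cut s r.
Proof. by rewrite !mulr_ge0 ?powR_ge0 ?kf_ge0. Qed.

Lemma kf0_le1 y : kf 0 y <= 1 :> R.
Proof.
have [y0|y0] := leP y 0; first by rewrite kf_le0.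
by apply: le_trans (kf_le_powR 0 (ltW y0)) _; rewrite powRr0.
Qed.

Lemma kf_bounded g Y : exists2 C, 0 <= C & forall y, y <= Y -> kf g y <= C.
Proof.
have [Y0|Y0] := leP Y 0.
  by exists 0 => // y yY; rewrite kf_le0// (le_trans yY).
have [c _ hc] : exists2 c, c \in `[0, Y]%R & forall t, t \in `[0, Y]%R -> kf g t <= kf g c.
  by apply: EVT_max; [exact: ltW|apply: continuous_subspaceT; exact: continuous_kf].
exists (kf g c); first exact: kf_ge0.
move=> y yY; have [y0|y0] := leP y 0; first by rewrite kf_le0// kf_ge0.
by apply: hc; rewrite in_itv /= yY ltW.
Qed.

Lemma rad_le s r : 0 < s -> 0 < r -> rad s r <= r `^ b.
Proof.
move=> s0 r0; rewrite /rad; set y := s^-1 * r - 1.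
have sr : 0 < s^-1 * r by rewrite mulr_gt0 ?invr_gt0.
have -> : r `^ b = s `^ b * (s^-1 * r) `^ b.
  by rewrite -powRM ?(ltW s0) ?(ltW sr)// mulrA divff ?mul1r// gt_eqF.
rewrite ler_wpM2l ?powR_ge0//; have [y0|y0] := leP y 0; first by rewrite kf_le0// powR_ge0.
apply: le_trans (kf_le_powR _ (ltW y0)) _.
apply: ge0_ler_powR; rewrite ?nnegrE ?(ltW b0) ?(ltW y0) ?(ltW sr)//.
by rewrite /y lerBlDr lerDl.
Qed.

(** For y = r / s - 1 this bounds r times the derivative of the profile by (b + th) times the
    profile: the logarithmic derivative approaches that of r^b, and the threshold on y absorbs the
    lower-order terms in [th]. *)
Lemma kf1_le y : Num.max 1 ((b + 2) / th) <= y -> kf1 b y * (y + 1) <= (b + th) * kf b y.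
Proof.
rewrite ge_max => /andP[y1]; rewrite ler_pdivrMr// => y2.
have y0 : 0 < y by lra.
have -> : kf1 b y = (b / y + y^-2) * kf b y.
  rewrite /kf1 [b - 1]addrC [b - 2]addrC !kf_powRM// powR_inv1 ?(ltW y0)//.
  by rewrite -[2]/(2%:R) powR_invn ?(ltW y0)//; ring.
rewrite mulrAC ler_wpM2r ?kf_ge0//.
have -> : (b / y + y^-2) * (y + 1) = b + ((b + 1) + y^-1) / y by field; rewrite gt_eqF.
rewrite lerD2l ler_pdivrMr//; have : y^-1 <= 1 by rewrite invf_le1.
by move: y2; lra.
Qed.

(* [M0] is independent of [s]: it bounds the contribution of the cut-off at
   [r = 2], the last term the one of the cut-off at [r = s]. *)
Lemma cut1_le : exists2 MY : R * R, 0 <= MY.1 & forall s r, 0 < s -> 0 < r ->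
  `|cut1 s r| <= (b + th) * (cut s r / r) + MY.1 +
     (if r <= MY.2 * s then MY.1 * s `^ (b - 1) else 0).
Proof.
have [K0 K00 hK0] := kf_bounded (0 - 2) 2.
pose Y := Num.max 1 ((b + 2) / th).
have [K1 K10 hK1] := kf_bounded (b - 1) Y; have [K2 K20 hK2] := kf_bounded (b - 2) Y.
(* The first summand bounds the derivative of the cut-off at 2, the second the derivative of the
   profile for y <= Y. *)
pose M := 2 `^ b * K0 + (b * K1 + K2).
have M1 : 2 `^ b * K0 <= M by rewrite lerDl addr_ge0// mulr_ge0// ltW.
have M2 : b * K1 + K2 <= M by rewrite lerDr mulr_ge0// powR_ge0.
have M0 : 0 <= M by apply: le_trans M1; rewrite mulr_ge0// powR_ge0.
exists (M, Y + 1) => //= s r s0 r0.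
have bth : 0 <= b + th by rewrite addr_ge0 ?ltW.
have Fr : 0 <= (b + th) * (cut s r / r) by rewrite mulr_ge0// divr_ge0 ?cut_ge0 ?(ltW r0).
have [r2|r2] := leP 2 r.
  have -> : cut1 s r = 0 by rewrite /cut1 /kf1 !kf_le0 ?subr_le0// !(mul0r, mulr0, addr0, subr0).
  rewrite normr0; apply: addr_ge0; first exact: addr_ge0.
  by case: (r <= _) => //; rewrite mulr_ge0// powR_ge0.
have rad0 : 0 <= rad s r by rewrite mulr_ge0 ?powR_ge0 ?kf_ge0.
have rad10 : 0 <= rad1 s r.
  rewrite mulr_ge0 ?powR_ge0// mulr_ge0 ?invr_ge0 ?(ltW s0)//.
  by apply: kf1_ge0; exact: ltW.
have h2 : `|rad s r * kf1 0 (2 - r)| <= M.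
  rewrite /kf1 mul0r add0r ger0_norm; last by rewrite mulr_ge0 ?kf_ge0.
  apply: le_trans M1.
  apply: ler_pM; rewrite ?kf_ge0//.
    apply: le_trans (rad_le s0 r0) _; apply: ge0_ler_powR; rewrite ?nnegrE ?(ltW b0) ?(ltW r0) ?(ltW r2)//.
  by apply: hK0; rewrite gerBl ltW.
apply: le_trans (ler_normB _ _) _.
have -> : `|rad1 s r * kf 0 (2 - r)| = rad1 s r * kf 0 (2 - r) by rewrite ger0_norm// mulr_ge0 ?kf_ge0.
have sb : s `^ b * s^-1 = s `^ (b - 1) by rewrite powRDp// powR_inv1// ltW.
set y := s^-1 * r - 1.
have [yY|yY] := leP Y y.
  suff h1 : rad1 s r * kf 0 (2 - r) <= (b + th) * (cut s r / r).
    have : 0 <= (if r <= (Y + 1) * s then M * s `^ (b - 1) else 0).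
      by case: (r <= _) => //; rewrite mulr_ge0// powR_ge0.
    move=> hi; rewrite -[leRHS]addrA; apply: lerD => //; apply: le_trans h2 _.
    by rewrite lerDl.
  have -> : (b + th) * (cut s r / r) = (b + th) * (rad s r / r) * kf 0 (2 - r) by rewrite /cut; ring.
  rewrite ler_wpM2r ?kf_ge0// mulrA ler_pdivlMr//.
  have -> : rad1 s r * r = s `^ b * (kf1 b y * (y + 1)) by rewrite /rad1 /y; field; rewrite gt_eqF.
  have -> : (b + th) * rad s r = s `^ b * ((b + th) * kf b y) by rewrite /rad -/y; ring.
  by rewrite ler_wpM2l ?powR_ge0// kf1_le.
have -> : r <= (Y + 1) * s.
  by move: yY; rewrite /y ltrBlDr mulrC ltr_pdivrMr// => /ltW.
suff h1 : rad1 s r * kf 0 (2 - r) <= M * s `^ (b - 1) by lra.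
rewrite /rad1 mulrA sb -mulrA [M * _]mulrC ler_wpM2l ?powR_ge0//.
have k1 : kf1 b (s^-1 * r - 1) <= M.
  apply: le_trans M2; rewrite /kf1 -/y; apply: lerD; last by apply: hK2; exact: ltW.
  by rewrite ler_wpM2l ?(ltW b0)//; apply: hK1; exact: ltW.
apply: le_trans k1; rewrite ler_piMr ?kf0_le1//.
by apply: kf1_ge0; exact: ltW.
Qed.

(** Between 2 s and 1 both exponential factors are at least exp (-1), as r / s - 1 >= 1 and 2 - r >=
    1; also r / s - 1 >= r / (2 s). The exponent (b - 1) p = -1 then makes (r^b / r)^p equal to 1 /
    r, the source of the logarithm. *)
Lemma cut_ge : exists2 m, 0 < m & forall s r, 0 < s -> 2 * s <= r -> r <= 1 ->
  m / r <= (cut s r / r) `^ p.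
Proof.
pose m0 : R := 2 `^ (- b) * expR (-1) * expR (-1).
have m00 : 0 < m0 by rewrite !mulr_gt0 ?powR_gt0 ?expR_gt0.
exists (m0 `^ p); first by rewrite powR_gt0.
move=> s r s0 sr r1; have r0 : 0 < r by apply: lt_le_trans sr; rewrite mulr_gt0.
have h : m0 * r `^ b <= cut s r.
  have y2 : 2 <= s^-1 * r by rewrite mulrC ler_pdivlMr.
  have y1 : 1 <= s^-1 * r - 1 by lra.
  have y0 : 0 < s^-1 * r - 1 by lra.
  have kb : s `^ b * kf b (s^-1 * r - 1) >= 2 `^ (- b) * expR (-1) * r `^ b.
    have -> : r `^ b = s `^ b * (s^-1 * r) `^ b.
      by rewrite -powRM ?(ltW s0) ?mulr_ge0 ?invr_ge0 ?(ltW s0) ?(ltW r0)// mulrA divff ?mul1r// gt_eqF.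
    rewrite mulrCA ler_wpM2l ?powR_ge0// /kf y0 mulrAC.
    apply: ler_pM; rewrite ?mulr_ge0 ?powR_ge0 ?expR_ge0//.
      have -> : 2 `^ (- b) = 2^-1 `^ b by rewrite -[2^-1]powR_inv1// -powRrM mulN1r.
      rewrite -powRM ?invr_ge0//; last by lra.
      by apply: ge0_ler_powR; rewrite ?nnegrE ?(ltW b0)//; lra.
    by rewrite ler_expR lerN2 invf_le1.
  have k0 : expR (-1) <= kf 0 (2 - r).
    have r20 : 0 < 2 - r by lra.
    rewrite /kf r20 powRr0 mul1r ler_expR lerN2 invf_le1//; lra.
  rewrite /cut /rad /m0 mulrAC.
  by apply: ler_pM; rewrite ?mulr_ge0 ?powR_ge0 ?expR_ge0.
have -> : m0 `^ p / r = (m0 * r `^ b / r) `^ p.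
  rewrite -mulrA powRM ?(ltW m00) ?mulr_ge0 ?powR_ge0 ?invr_ge0 ?(ltW r0)//; congr (_ * _).
  rewrite -[r^-1]powR_inv1 ?(ltW r0)// -powRDp// -powRrM bp//.
apply: ge0_ler_powR; rewrite ?nnegrE ?(ltW p0) ?mulr_ge0 ?powR_ge0 ?invr_ge0 ?kf_ge0 ?(ltW r0) ?(ltW m00)//.
by rewrite ler_wpM2r// invr_ge0 ltW.
Qed.

End radial_cutoff.

(** * Coordinates adapted to the hyperplane *)

Section half_space_coordinates.
Context {R : realType} {n : nat}.
Local Notation H := (heis R n).
Local Notation E := ('I_n * bool)%type.
Implicit Types (xi zeta v : H).

Lemma integral_translate (f : H -> \bar R) v :
  measurable_fun [set: heism R n] (f : heism R n -> \bar R) -> (forall xi, (0 <= f xi)%E) ->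
  (\int[volume]_(xi in [set: heism R n]) f (xi + v)%R =
   \int[volume]_(xi in [set: heism R n]) f xi)%E.
Proof.
move=> mf f0.
pose Phi : heism R n -> heism R n :=
  fun z => (z.1.1 + v.1.1, z.1.2 + v.1.2, (z.2 + v.2 : measurableTypeR R)).
have mPhi : measurable_fun setT Phi.
  apply: measurable_fun_pair => /=; last by apply: measurable_funD.
  apply: measurable_fun_pair => /=.
    apply: (measurableT_comp (measurable_addrV v.1.1)).
    exact: (measurableT_comp measurable_fst measurable_fst).
  apply: (measurableT_comp (measurable_addrV v.1.2)).
  exact: (measurableT_comp measurable_snd measurable_fst).
have fE : (fun xi : heism R n => f (xi + v)) = f \o Phi by apply/funext.
transitivity (\int[pushforward volume Phi]_(y in setT) f y)%E; last first.
  apply: eq_measure_integral => A mA _.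
  exact: (@volume_shear R n v.1.1 v.1.2 (fun=> v.2) (measurable_cst _) A mA).
by rewrite (ge0_integral_pushforward mPhi)// preimage_setT -fE.
Qed.

Lemma volume_ball_gt0 xi (r : R) : 0 < r ->
  (0 < volume ([set zeta : H | (`|zeta - xi| <= r)%R] : set (heism R n)))%E.
Proof.
move=> r0.
pose I (s : R) : set R := `[s - r, s + r]%classic.
have mI s : measurable (I s) by exact: measurable_itv.
have iff_I (s t : R) : I s t <-> `|t - s| <= r.
  by rewrite /I /= in_itv /= ler_distl.
pose B (x : 'rV[R]_n) : set 'rV[R]_n := [set y | forall i, I (x 0 i) (y 0 i)].
have mB x : measurable (B x) by apply: (@measurable_box R n (fun i => I (x 0 i))).
have -> : ([set zeta : H | (`|zeta - xi| <= r)%R] : set (heism R n)) =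
    B xi.1.1 `*` B xi.1.2 `*` (I xi.2 : set (measurableTypeR R)).
  have iff_B (x y : 'rV[R]_n) : B x y <-> `|y - x| <= r.
    rewrite rV_norm_le ?(ltW r0)//; split => h i; have := h i; rewrite ?iff_I !mxE//.
  apply/seteqP; split => zeta /=.
    by rewrite heis_norm_le => /and3P[/= h1 h2 h3]; split; [split|]; [exact/iff_B|exact/iff_B|exact/iff_I].
  move=> [[/iff_B h1 /iff_B h2] /iff_I h3]; rewrite heis_norm_le; apply/and3P; split => //.
have lI s : (0 < lebesgue_measure (I s))%E.
  rewrite /I lebesgue_measure_itv/= lte_fin ifT; last by lra.
  by rewrite -EFinB lte_fin; lra.
have lB x : (0 < lebesgue_rV n (B x))%E.
  rewrite (@lebesgue_rV_box R n (fun i => I (x 0 i)))//.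
  by elim/big_ind : _ => // y z; exact: mule_gt0.
rewrite volume_box; [|exact: mB|exact: mB|exact: mI].
by apply: mule_gt0; [apply: mule_gt0; exact: lB|exact: lI].
Qed.

Variables (a b : 'rV[R]_n) (c k : R).
Hypothesis abc0 : (a, b, c) != 0 :> H.
Local Notation l := (haff a b c k).
Local Notation N2 := (hnormal2 a b c).

(** N depends on x and y only, so the t-direction works when c <> 0; when c = 0 the field N is
    constant and the Euclidean normal works. *)
Lemma exists_transversal : exists w : H, hlin a b c w = 1 /\ forall e, hnormal_lin c e w = 0.
Proof.
have [c0|c0] := eqVneq c 0; last first.
  exists (0, 0, c^-1); split.
    by rewrite /hlin /= !dotv0 !add0r divff.
  by move=> [i []]; rewrite /hnormal_lin /= mxE mulr0 ?oppr0.
have q0 : 0 < sqn (a, b, c) by exact: sqn_gt0.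
exists ((sqn (a, b, c))^-1 *: (a, b, c)); split.
  by rewrite hlinZ -[hlin _ _ _ _]/(ip (a, b, c) (a, b, c)) ip_sqn mulVf// gt_eqF.
by move=> [i []]; rewrite /hnormal_lin c0 /= mulr0 mul0r ?oppr0.
Qed.

Lemma exists_hnormal2_gt0 : (0 < n)%N -> exists xi : H, 0 < N2 xi.
Proof.
move=> n0; have [c0|c0] := eqVneq c 0.
  by exists 0; rewrite c0; apply: vert_gt0; rewrite -c0.
pose i : 'I_n := Ordinal n0.
have [t ht] : exists t : R, a 0 i + 2 * c * t != 0.
  have [h|h] := eqVneq (a 0 i) 0; last by exists 0; rewrite mulr0 addr0.
  by exists 1; rewrite h add0r mulr1 mulf_neq0.
exists (0, t *: delta_mx 0 i, 0).
rewrite /hnormal2 (bigD1 (i, true))//= ltr_pwDl//; last by apply: sumr_ge0 => e _; exact: sqr_ge0.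
rewrite /hnormal /= !mxE !eqxx mulr1 lt_neqAle sqr_ge0 andbT eq_sym sqrf_eq0//.
Qed.

Definition hcoord (o : option E) v : R :=
  if o is Some e then if e.2 then v.1.1 0 e.1 else v.1.2 0 e.1 else v.2.

Lemma hcoord_line o xi v s : hcoord o (xi + s *: v) = hcoord o xi + s * hcoord o v.
Proof. by case: o => [[i []]|] /=; rewrite ?mxE// !mxE. Qed.

Lemma hcoord_norm v M : 0 <= M -> (`|v| <= M) <-> (forall o, `|hcoord o v| <= M).
Proof.
move=> M0; rewrite heis_norm_le; split.
  move=> /and3P[/rV_norm_le h1 /rV_norm_le h2 h3] [[i []]|] //=.
    exact: h1.
  exact: h2.
move=> h; apply/and3P; split.
- by apply/rV_norm_le => // i; exact: h (Some (i, true)).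
- by apply/rV_norm_le => // i; exact: h (Some (i, false)).
- exact: h None.
Qed.

Lemma continuous_hcoord o : continuous (hcoord o).
Proof.
case: o => [[i []]|].
- exact: continuous_coordx.
- exact: continuous_coordy.
- exact: continuous_coordt.
Qed.

Variable w : H.
Hypotheses (w1 : hlin a b c w = 1) (wN : forall e, hnormal_lin c e w = 0).

(** Coordinates of the projection along [w] onto the kernel of [hlin]; [None] denotes the
    t-coordinate. *)
Definition hproj o xi : R := hcoord o xi + (- hcoord o w) * hlin a b c xi.

Lemma affine_hproj o : affine_on (hproj o).
Proof.
apply: affineD.
  by split; [exact: continuous_hcoord|exists (hcoord o) => xi v s; exact: hcoord_line].
have := affine_lin (- hcoord o w) 0 (affine_haff a b c 0).
rewrite (_ : (fun xi => _ + 0) = (fun xi => - hcoord o w * hlin a b c xi))//.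
by apply/funext => xi; rewrite /haff subr0 addr0.
Qed.

Lemma hproj_transl o xi s : hproj o (xi + s *: w) = hproj o xi.
Proof. by rewrite /hproj hcoord_line hlinD hlinZ w1; ring. Qed.

Lemma haff_transl xi s : l (xi + s *: w) = l xi + s.
Proof. by rewrite haff_line w1 mulr1. Qed.

Lemma hnormal2_transl xi s : N2 (xi + s *: w) = N2 xi.
Proof. by apply: eq_bigr => e _; rewrite hnormal_line wN mulr0 addr0. Qed.

Variable rho : R.
Hypothesis rho0 : 0 <= rho.

(** A bump in the coordinates [hproj], hence invariant along [w]. Its support is unbounded in that
    direction; a bound on l makes it bounded, see [hproj_box]. *)
Definition hcut xi : R := \prod_(o : option E) (kf 0 (rho - hproj o xi) * kf 0 (rho + hproj o xi)).

Lemma sclass_hcut : sclass hcut.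
Proof.
apply: sclass_prod => o; apply: sclass_mul; apply: sclass_kf.
  have := affine_lin (-1) rho (affine_hproj o).
  by rewrite (_ : (fun xi => _) = (fun xi => rho - hproj o xi))//; apply/funext => xi; ring.
have := affine_lin 1 rho (affine_hproj o).
by rewrite (_ : (fun xi => _) = (fun xi => rho + hproj o xi))//; apply/funext => xi; ring.
Qed.

Lemma hcut_ge0 xi : 0 <= hcut xi.
Proof. by apply: prodr_ge0 => o _; rewrite mulr_ge0 ?kf_ge0. Qed.

Lemma hcut_gt0 xi : (forall o, `|hproj o xi| < rho) -> 0 < hcut xi.
Proof.
move=> h; apply: prodr_gt0 => o _; have := h o; rewrite ltr_norml => /andP[h1 h2].
by rewrite mulr_gt0// kf_gt0//; lra.
Qed.

Lemma hcut_neq0 xi : hcut xi != 0 -> forall o, `|hproj o xi| <= rho.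
Proof.
move=> h o; rewrite leNgt; apply: contra_neqN h => h.
rewrite /hcut (bigD1 o)//=; suff -> : kf 0 (rho - hproj o xi) * kf 0 (rho + hproj o xi) = 0 by rewrite mul0r.
move: h; rewrite lter_normr => /orP[h|h].
  by rewrite kf_le0 ?mul0r//; lra.
by rewrite [X in _ * X]kf_le0 ?mulr0//; lra.
Qed.

Lemma hcut_transl xi s : hcut (xi + s *: w) = hcut xi.
Proof. by apply: eq_bigr => o _; rewrite hproj_transl. Qed.

(** From xi = projection + (hlin xi) w, where |hlin xi| <= 2 + |k| as soon as |l xi| <= 2. *)
Definition hbox : R := rho + (2 + `|k|) * `|w|.

Lemma hproj_box xi : (forall o, `|hproj o xi| <= rho) -> `|l xi| <= 2 -> `|xi| <= hbox.
Proof.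
move=> h1 h2.
have b0 : 0 <= hbox by rewrite addr_ge0// mulr_ge0// addr_ge0.
apply/(hcoord_norm _ b0) => o.
have -> : hcoord o xi = hproj o xi + hlin a b c xi * hcoord o w by rewrite /hproj; ring.
apply: le_trans (ler_normD _ _) _; apply: lerD => //; rewrite normrM; apply: ler_pM => //.
  have -> : hlin a b c xi = l xi + k by rewrite /haff subrK.
  by apply: le_trans (ler_normD _ _) _; rewrite lerD2r.
by have /(hcoord_norm _ (normr_ge0 w)) := lexx `|w|; apply.
Qed.

End half_space_coordinates.

(** * Weighted mass of strips parallel to the hyperplane *)

Section strips.
Context {R : realType} {n : nat}.
Local Notation H := (heis R n).
Local Notation E := ('I_n * bool)%type.
Implicit Types (xi zeta v : H).
Variables (a b : 'rV[R]_n) (c k p rho : R) (w : H).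
Hypotheses (w1 : hlin a b c w = 1) (wN : forall e, hnormal_lin c e w = 0).
Hypotheses (p0 : 0 < p) (rho0 : 0 <= rho).
Local Notation l := (haff a b c k).

Definition strip_weight xi : R := Num.sqrt (hnormal2 a b c xi) * hcut a b c w rho xi.
Local Notation g := strip_weight.

Definition strip (s t : R) : set (heism R n) := [set xi : H | s < l xi <= t].

Definition strip_mass (s t : R) : \bar R :=
  (\int[volume]_(xi in strip s t) (g xi `^ p)%:E)%E.

Lemma strip_weight_ge0 xi : 0 <= g xi.
Proof. by rewrite mulr_ge0 ?sqrtr_ge0 ?hcut_ge0. Qed.

Lemma strip_weight_transl xi r : g (xi + r *: w) = g xi.
Proof. by rewrite /strip_weight hnormal2_transl// hcut_transl. Qed.

Lemma continuous_strip_weight : continuous g.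
Proof.
move=> xi; apply: cvgM; last exact: sclass_continuous (sclass_hcut a b c w rho) xi.
apply: (@continuous_comp _ _ _ (hnormal2 a b c) (@Num.sqrt R)); last exact: sqrt_continuous.
exact: continuous_hnormal2.
Qed.

Lemma continuous_strip_weight_powR : continuous (fun xi => g xi `^ p).
Proof.
have -> : (fun xi => g xi `^ p) = (fun xi => `|g xi| `^ p).
  by apply/funext => xi; rewrite ger0_norm ?strip_weight_ge0.
move=> xi; apply: (@continuous_comp _ _ _ g (fun r => `|r| `^ p)).
  exact: continuous_strip_weight.
exact: continuous_normpow.
Qed.

Lemma measurable_strip s t : measurable (strip s t).
Proof.
have ml : measurable_fun [set: heism R n] (l : heism R n -> R).
  by apply: continuous_measurable_heis; exact: continuous_haff.
have -> : strip s t = [set: heism R n] `&` (l : heism R n -> R) @^-1` `]s, t]%classic.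
  by rewrite setTI; apply/seteqP; split => xi; rewrite /strip /= in_itv.
exact: ml.
Qed.

Lemma measurable_strip_weight : measurable_fun [set: heism R n] (fun xi : heism R n => (g xi `^ p)%:E).
Proof.
apply/measurable_EFinP; apply: continuous_measurable_heis.
exact: continuous_strip_weight_powR.
Qed.

Lemma strip_mass_ge0 s t : (0 <= strip_mass s t)%E.
Proof. by apply: integral_ge0 => xi _; rewrite lee_fin powR_ge0. Qed.

(** Translation by r w raises l by r and preserves volume, |N| and the cut-off. The mass therefore
    depends only on the width of a strip, and halving gives it on dyadic strips. *)
Lemma strip_mass_transl s t r : strip_mass (s + r) (t + r) = strip_mass s t.
Proof.
rewrite /strip_mass integral_mkcond [RHS]integral_mkcond.
have mf : measurable_fun [set: heism R n] ((fun xi : heism R n => (g xi `^ p)%:E) \_ (strip (s + r) (t + r))).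
  apply/(measurable_restrictT _ (measurable_strip _ _)).
  exact: measurable_funS measurable_strip_weight.
rewrite -[LHS](integral_translate (r *: w) mf); last first.
  by move=> xi; apply: erestrict_ge0 => ? _; rewrite lee_fin powR_ge0.
apply: eq_integral => xi _; rewrite !patchE.
have -> : (xi + r *: w \in strip (s + r) (t + r)) = (xi \in strip s t).
  by apply/idP/idP; rewrite !inE /strip /= haff_transl// ltrD2r lerD2r.
by have -> : g (xi + r *: w) = g xi := strip_weight_transl xi r.
Qed.

Lemma strip_mass_add s t r : s <= t -> t <= r ->
  strip_mass s r = (strip_mass s t + strip_mass t r)%E.
Proof.
move=> st tr; rewrite /strip_mass.
have -> : strip s r = strip s t `|` strip t r.
  apply/seteqP; split => xi; rewrite /strip /=.
    by move=> /andP[h1 h2]; have [h|h] := leP (l xi) t; [left|right]; apply/andP.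
  by case=> /andP[h1 h2]; apply/andP; split => //; [exact: le_trans tr|exact: le_lt_trans h1].
apply: ge0_integral_setU.
- exact: measurable_strip.
- exact: measurable_strip.
- exact: measurable_funS measurable_strip_weight.
- by move=> xi _; rewrite lee_fin powR_ge0.
- apply/disj_setPS => xi [] /andP[_ h1] /andP[h2 _].
  by move: (lt_le_trans h2 h1); rewrite ltxx.
Qed.

Lemma strip_box xi : g xi != 0 -> `|l xi| <= 2 -> `|xi| <= hbox k w rho.
Proof.
move=> g0; apply: hproj_box => //; apply: hcut_neq0.
by apply: contra_neq g0 => h; rewrite /g h mulr0.
Qed.

Lemma strip_mass_fin : (strip_mass 0 1 < +oo)%E.
Proof.
have [C C0 hC] := continuous_bounded (hbox k w rho) continuous_strip_weight_powR.
pose BX : set (heism R n) := [set xi : H | `|xi| <= hbox k w rho].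
apply: (@le_lt_trans _ _ (C%:E * volume BX)%E); last first.
  by rewrite lte_mul_pinfty// volume_box_fin.
have mB : measurable BX := @measurable_heis_box R n (hbox k w rho).
have hv : (\int[volume]_(x in setT) (\1_BX x)%:E = volume BX)%E by rewrite integral_indic// setIT.
rewrite -hv -ge0_integralZl//; last first.
  by apply/measurable_EFinP; exact: measurable_indic.
rewrite /strip_mass [leLHS]integral_mkcond; apply: ge0_le_integral_nm => xi _.
  by apply: erestrict_ge0 => ? _; rewrite lee_fin powR_ge0.
rewrite patchE; case: ifPn => [|_]; last by rewrite -EFinM lee_fin mulr_ge0.
rewrite inE => /andP[l0 l1]; rewrite -EFinM lee_fin.
have [->|g0] := eqVneq (g xi) 0; first by rewrite powR0 ?gt_eqF// mulr_ge0.
have hx : `|xi| <= hbox k w rho.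
  by apply: strip_box => //; rewrite gtr0_norm//; lra.
rewrite indicE mem_set//= mulr1; apply: le_trans (hC xi hx).
exact: ler_norm.
Qed.

Lemma strip_mass_gt0 xi0 : 0 < g xi0 -> (0 < strip_mass 0 1)%E.
Proof.
(* The weight does not change along [w], so the point can be moved into the middle of the strip. *)
move=> g0; pose xi := xi0 + (1 / 2 - l xi0) *: w.
have lx : l xi = 1 / 2 by rewrite /xi haff_transl//; ring.
have gx : 0 < g xi by rewrite /xi strip_weight_transl.
have gp : 0 < g xi `^ p / 2 by rewrite divr_gt0// powR_gt0.
have [r r0 hr] : exists2 r, 0 < r & forall zeta, `|zeta - xi| <= r ->
    0 < l zeta <= 1 /\ g xi `^ p / 2 <= g zeta `^ p.
  have := @continuous_strip_weight_powR xi => /cvgrPdist_lt /(_ _ gp) h1.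
  have h20 : 0 < 1 / 2 :> R by rewrite divr_gt0.
  have := @continuous_haff R n a b c k xi => /cvgrPdist_lt /(_ _ h20) h2.
  have /nbhs_ballP[r1 /= r10 hr1] := h1; have /nbhs_ballP[r2 /= r20 hr2] := h2.
  have r0 : 0 < Num.min r1 r2 by rewrite lt_min r10.
  exists (Num.min r1 r2 / 2); first by rewrite divr_gt0.
  move=> zeta hz.
  have : `|zeta - xi| < Num.min r1 r2.
    by apply: le_lt_trans hz _; rewrite ltr_pdivrMr//; lra.
  rewrite lt_min distrC => /andP[z1 z2].
  have := hr1 zeta; rewrite -ball_normE /= => /(_ z1).
  have := hr2 zeta; rewrite -ball_normE /= => /(_ z2).
  rewrite lx; move: (l zeta) (g zeta `^ p) (g xi `^ p) => L G0 G1.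
  rewrite !ltr_norml => {hr1 hr2 h1 h2 hz z1 z2} /andP[h4 h5] /andP[_ h3]; split; last by lra.
  by apply/andP; split; lra.
pose BX : set (heism R n) := [set zeta : H | `|zeta - xi| <= r].
have mB : measurable BX.
  rewrite (_ : BX = (fun zeta : heism R n => `|zeta - xi|) @^-1` `]-oo, r]%classic).
    rewrite -[X in measurable X]setTI.
    have mf : measurable_fun [set: heism R n] (fun zeta : heism R n => `|zeta - xi|).
      apply: continuous_measurable_heis => y; apply: (@continuous_comp _ _ _ (fun z : H => z - xi) (fun z => `|z|)).
        by apply: cvgB; [exact: cvg_id|exact: cvg_cst].
      exact: norm_continuous.
    exact: mf.
  by apply/seteqP; split => y; rewrite /= in_itv.
apply: (@lt_le_trans _ _ ((g xi `^ p / 2)%:E * volume BX)%E).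
  by rewrite mule_gt0// volume_ball_gt0.
have hv : (\int[volume]_(x in setT) (\1_BX x)%:E = volume BX)%E by rewrite integral_indic// setIT.
rewrite -hv -ge0_integralZl//; last 2 first.
- by apply/measurable_EFinP; exact: measurable_indic.
- by rewrite lee_fin ltW.
rewrite /strip_mass [leRHS]integral_mkcond; apply: ge0_le_integral_nm => zeta _.
  by rewrite -EFinM lee_fin mulr_ge0// ltW.
rewrite indicE -EFinM; have [hz|hz] := boolP (zeta \in _); last first.
  by rewrite mulr0; apply: erestrict_ge0 => ? _; rewrite lee_fin powR_ge0.
move: hz; rewrite inE => /hr[h1 h2]; rewrite mulr1 patchE mem_set// lee_fin//.
Qed.

Lemma strip_mass_double s : 0 <= s -> strip_mass 0 (s + s) = (strip_mass 0 s + strip_mass 0 s)%E.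
Proof.
move=> s0; rewrite (@strip_mass_add 0 s (s + s)) ?lerDl//; congr (_ + _)%E.
by have := strip_mass_transl 0 s s; rewrite add0r.
Qed.

Lemma strip_mass_dyadic (m : R) j : strip_mass 0 1 = m%:E -> strip_mass 0 (2^-1 ^+ j) = (2^-1 ^+ j * m)%:E.
Proof.
move=> hm; elim: j => [|j IH]; first by rewrite expr0 mul1r.
have h0 : 0 <= 2^-1 ^+ j.+1 :> R by rewrite exprn_ge0// invr_ge0.
have := strip_mass_double h0.
have -> : 2^-1 ^+ j.+1 + 2^-1 ^+ j.+1 = 2^-1 ^+ j :> R by rewrite exprS; field.
rewrite IH; have := strip_mass_ge0 0 (2^-1 ^+ j.+1).
case: (strip_mass 0 _) => [x| |]// _; rewrite -EFinD => -[hx]; congr (_%:E).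
by rewrite exprS -mulrA hx; field.
Qed.

Lemma strip_mass_shell (m : R) j : strip_mass 0 1 = m%:E ->
  strip_mass (2^-1 ^+ j.+1) (2^-1 ^+ j) = (2^-1 ^+ j.+1 * m)%:E.
Proof.
move=> hm; rewrite -(strip_mass_dyadic j.+1 hm).
have -> : 2^-1 ^+ j = 2^-1 ^+ j.+1 + 2^-1 ^+ j.+1 :> R by rewrite exprS; field.
by have := strip_mass_transl 0 (2^-1 ^+ j.+1) (2^-1 ^+ j.+1); rewrite add0r.
Qed.

End strips.

Section power_splitting.
Context {R : realType}.

(** According to whether Q <= th Z: the main term keeps a constant close to al^p, and the whole cost
    goes to the error term Q. *)
Lemma powRD_split (p al th Z Q : R) : 0 < p -> 0 <= al -> 0 < th -> 0 <= Z -> 0 <= Q ->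
  ((al + th) * Z + Q) `^ p <= (al + 2 * th) `^ p * Z `^ p + ((al + th) / th + 1) `^ p * Q `^ p.
Proof.
move=> p0 al0 th0 Z0 Q0; have c0 : 0 <= (al + th) / th + 1 by rewrite addr_ge0// divr_ge0 ?addr_ge0// ltW.
have P0 : 0 <= (al + th) * Z + Q by rewrite addr_ge0// mulr_ge0// addr_ge0// ltW.
have c1 : 0 <= al + 2 * th by rewrite addr_ge0// mulr_ge0// ltW.
have [h|h] := leP Q (th * Z).
  apply: (@le_trans _ _ ((al + 2 * th) `^ p * Z `^ p)); last by rewrite lerDl mulr_ge0 ?powR_ge0.
  rewrite -powRM//; apply: ge0_ler_powR; rewrite ?nnegrE ?(ltW p0) ?mulr_ge0//; lra.
apply: (@le_trans _ _ (((al + th) / th + 1) `^ p * Q `^ p)); last by rewrite lerDr mulr_ge0 ?powR_ge0.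
rewrite -powRM//; apply: ge0_ler_powR; rewrite ?nnegrE ?(ltW p0) ?mulr_ge0//.
rewrite [leRHS]mulrDl mul1r lerD2r mulrAC ler_pdivlMr//.
have := ler_wpM2l (addr_ge0 al0 (ltW th0)) (ltW h); lra.
Qed.

Lemma powRD_le2 (p x y : R) : 0 < p -> 0 <= x -> 0 <= y ->
  (x + y) `^ p <= 2 `^ p * (x `^ p + y `^ p).
Proof.
move=> p0; wlog xy : x y / x <= y => [h x0 y0|x0 y0].
  by have [xy|/ltW xy] := leP x y; [exact: h|rewrite addrC [_ `^ p + _]addrC; exact: h].
apply: (@le_trans _ _ (2 `^ p * y `^ p)); last by rewrite ler_wpM2l ?powR_ge0// lerDr powR_ge0.
rewrite -powRM//; apply: ge0_ler_powR; rewrite ?nnegrE ?(ltW p0) ?mulr_ge0 ?addr_ge0//; lra.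
Qed.

Lemma minkowski2 (I : finType) (al be : R) (x y : I -> R) :
  Num.sqrt (\sum_i (al * x i + be * y i) ^+ 2) <=
  `|al| * Num.sqrt (\sum_i x i ^+ 2) + `|be| * Num.sqrt (\sum_i y i ^+ 2).
Proof.
have X0 : 0 <= \sum_i x i ^+ 2 by apply: sumr_ge0 => i _; exact: sqr_ge0.
have Y0 : 0 <= \sum_i y i ^+ 2 by apply: sumr_ge0 => i _; exact: sqr_ge0.
set X := \sum_i x i ^+ 2 in X0 *; set Y := \sum_i y i ^+ 2 in Y0 *.
have D0 : 0 <= `|al| * Num.sqrt X + `|be| * Num.sqrt Y by rewrite addr_ge0// mulr_ge0 ?sqrtr_ge0.
rewrite -[leRHS](ger0_norm D0) -sqrtr_sqr ler_wsqrtr//.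
have -> : \sum_i (al * x i + be * y i) ^+ 2 = al ^+ 2 * X + 2 * (al * be) * \sum_i x i * y i + be ^+ 2 * Y.
  rewrite !mulr_sumr -!big_split /=; apply: eq_bigr => i _; ring.
rewrite sqrrD !exprMn !sqr_sqrtr// !real_normK ?num_real//.
have h : al * be * (\sum_i x i * y i) <= `|al| * Num.sqrt X * (`|be| * Num.sqrt Y).
  apply: le_trans (ler_norm _) _; rewrite !normrM mulrACA ler_wpM2l ?mulr_ge0//.
  by rewrite -sqrtrM// -sqrtr_sqr ler_wsqrtr// cauchy_schwarz.
rewrite lerD2r lerD2l mulr2n; move: h; set T := `|al| * _ * _; set S := \sum_i _.
lra.
Qed.

Lemma div_poweR_ge (a r p : R) (y : \bar R) : 0 <= a -> 0 < r -> 0 < p -> (0 <= y)%E ->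
  (y <= r%:E)%E -> ((a * r `^ (- p))%:E <= a%:E / y `^ p)%E.
Proof.
move=> a0 r0 p0; case: y => [y| |//]; last by rewrite leye_eq.
rewrite !lee_fin => y0 yr; rewrite poweR_EFin inver.
have [y00|y00] := eqVneq (y `^ p) 0.
  (* At distance 0 the quotient is +oo for a > 0, and 0 for a = 0. *)
  move: a0; rewrite le_eqVlt => /predU1P[<-|a0]; first by rewrite mul0e mul0r.
  by rewrite gt0_muley ?lte_fin// leey.
have yp : 0 < y `^ p by rewrite lt_neqAle eq_sym y00 powR_ge0.
rewrite -EFinM lee_fin ler_wpM2l// powRN lef_pV2 ?posrE ?powR_gt0//.
  by apply: ge0_ler_powR; rewrite ?nnegrE ?(ltW p0) ?(ltW r0).
rewrite lt_neqAle y0 andbT eq_sym; apply: contra_neq y00 => ->.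
by rewrite powR0// gt_eqF.
Qed.

End power_splitting.

Section nonnegativity.
Context {R : realType} {n : nat}.
Local Notation H := (heis R n).

Lemma ccnorm_ge0 (xi : H) : (0 <= ccnorm xi)%E.
Proof.
apply: le_ereal_inf_tmp => _ [g [a [b [_ _ _ ->]]]].
by apply: integral_ge0 => s _; rewrite lee_fin sqrtr_ge0.
Qed.

Lemma bdist_ge0 (D : set H) (xi : H) : (0 <= bdist D xi)%E.
Proof. by apply: le_ereal_inf_tmp => _ [zeta _ <-]; exact: ccnorm_ge0. Qed.

End nonnegativity.

(** * Test functions *)

Section sharpness.
Context {R : realType} {n : nat}.
Local Notation H := (heis R n).
Local Notation E := ('I_n * bool)%type.
Implicit Types (xi zeta v : H).
Variables (a b : 'rV[R]_n) (c k p rho : R) (w : H) (D : set H).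
Hypothesis DP : forall xi, D xi <-> 0 < haff a b c k xi.
Hypotheses (w1 : hlin a b c w = 1) (wN : forall e, hnormal_lin c e w = 0).
Hypotheses (p1 : 1 < p) (rho0 : 0 <= rho).
Local Notation l := (haff a b c k).
Local Notation g := (strip_weight a b c rho w).
Local Notation psi := (hcut a b c w rho).
Local Notation be := ((p - 1) / p).
Let p0 : 0 < p. Proof. exact: lt_trans ltr01 p1. Qed.
Let b0 : 0 < be. Proof. by rewrite divr_gt0// subr_gt0. Qed.

Definition tfun (s : R) xi : R := cut p s (l xi) * psi xi.
(* [tfun s xi] divided by [l / |N|], an upper bound for the distance to the boundary. *)
Definition tquot (s : R) xi : R := cut p s (l xi) / l xi * g xi.

Lemma cut_eq0 s r : 0 < s -> r <= s -> cut p s r = 0.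
Proof.
move=> s0 rs; rewrite /cut /rad [kf _ (s^-1 * r - 1)]kf_le0 ?mulr0 ?mul0r//.
by rewrite subr_le0 mulrC ler_pdivrMr// mul1r.
Qed.

Lemma cut_eq0r s r : 2 <= r -> cut p s r = 0.
Proof. by move=> r2; rewrite /cut [kf 0 _]kf_le0 ?mulr0// subr_le0. Qed.

Lemma cut_le s r : 0 < s -> cut p s r <= 2 `^ be.
Proof.
move=> s0; have [r2|r2] := leP 2 r; first by rewrite cut_eq0r// powR_ge0.
have [rs|sr] := leP r s; first by rewrite cut_eq0// powR_ge0.
have r0 : 0 < r by exact: lt_trans sr.
apply: (@le_trans _ _ (rad p s r)).
  by rewrite /cut ler_piMr ?kf0_le1// mulr_ge0 ?powR_ge0 ?kf_ge0.
apply: le_trans (rad_le p1 s0 r0) _.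
by apply: ge0_ler_powR; rewrite ?nnegrE ?(ltW b0) ?(ltW r0) ?(ltW r2).
Qed.

Lemma sclass_tfun s : sclass (tfun s).
Proof.
apply: sclass_mul; last exact: sclass_hcut.
apply: sclass_mul; last first.
  apply: sclass_kf; have := affine_lin (-1) 2 (affine_haff a b c k).
  by rewrite (_ : (fun xi => _) = (fun xi => 2 - l xi))//; apply/funext => xi; ring.
apply: sclass_mul; first exact: sclass_cst.
by apply: sclass_kf; exact: (affine_lin s^-1 (-1) (affine_haff a b c k)).
Qed.

Lemma tfun_ge0 s xi : 0 <= tfun s xi.
Proof. by rewrite mulr_ge0 ?hcut_ge0 ?cut_ge0. Qed.

(** Closed, and contained in [D] for s > 0, so that it also accommodates the closure taken in
    [tsupport]. *)
Definition tregion (s : R) : set H := [set xi | s <= l xi <= 2 /\ `|xi| <= hbox k w rho].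

Lemma tfun_supp s xi : 0 < s -> tfun s xi != 0 -> tregion s xi.
Proof.
move=> s0; rewrite mulf_eq0 negb_or => /andP[h1 h2].
have ls : s < l xi by rewrite ltNge; apply: contra_neqN h1 => h; rewrite cut_eq0.
have l2 : l xi < 2 by rewrite ltNge; apply: contra_neqN h1 => h; rewrite cut_eq0r.
split; first by rewrite (ltW ls) ltW.
apply: hproj_box => //; first exact: (hcut_neq0 h2).
by rewrite gtr0_norm ?(ltW l2)// (lt_trans s0).
Qed.

Lemma closed_tregion s : closed (tregion s).
Proof.
have -> : tregion s = l @^-1` [set r | s <= r] `&` l @^-1` [set r | r <= 2]
    `&` (fun xi : H => `|xi|) @^-1` [set r | r <= hbox k w rho].
  apply/seteqP; split => xi; rewrite /tregion /=.
    by move=> [/andP[h1 h2] h3].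
  by move=> [[h1 h2] h3]; rewrite h1 h2.
apply: closedI; first apply: closedI.
- by apply: closed_comp => [xi _|]; [exact: continuous_haff|exact: closed_ge].
- by apply: closed_comp => [xi _|]; [exact: continuous_haff|exact: closed_le].
- by apply: closed_comp => [xi _|]; [exact: norm_continuous|exact: closed_le].
Qed.

Lemma tsupport_tfun s : 0 < s -> tsupport (tfun s) `<=` tregion s.
Proof.
move=> s0; rewrite /tsupport [X in _ `<=` X](iffLR (closure_id _) (@closed_tregion s)).
by apply: closureS => xi; exact: tfun_supp.
Qed.

Lemma tfun_Ccinfty s : 0 < s -> Ccinfty D (tfun s).
Proof.
move=> s0; have h := tsupport_tfun s0; split.
- exact: sclass_smooth (sclass_tfun s).
- apply: (@subclosed_compact _ _ [set xi : H | `|xi| <= hbox k w rho]).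
  + exact: closed_closure.
  + exact: compact_heis_box.
  + by move=> xi /h[].
- by move=> xi /h[/andP[h1 _] _]; apply/DP; exact: lt_le_trans h1.
Qed.

Lemma hder_tfun s e xi :
  hder (tfun s) e xi = cut1 p s (l xi) * psi xi * hnormal a b c e xi + cut p s (l xi) * hder psi e xi.
Proof.
have h1 := isd_comp (is_derive_cut p s (l xi)) (is_derive_haff a b c k e xi).
have h2 := isd_mul h1 (is_derive_hder (sclass_smooth (sclass_hcut a b c w rho)) e xi).
transitivity (cut1 p s (l xi) * hnormal a b c e xi * psi xi + cut p s (l xi) * hder psi e xi).
  by have [_] := h2.
by ring.
Qed.

Lemma tquot_ge0 s xi : 0 < s -> 0 <= tquot s xi.
Proof.
move=> s0; rewrite /tquot; have [h|h] := leP (l xi) s; first by rewrite cut_eq0// !mul0r.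
by rewrite mulr_ge0 ?strip_weight_ge0// divr_ge0 ?cut_ge0// ltW// (lt_trans s0).
Qed.

Lemma tquot_supp s xi : 0 < s -> ~ tregion s xi -> tquot s xi = 0.
Proof.
move=> s0 h; have : tfun s xi = 0 by apply: contra_notP h => /eqP; exact: tfun_supp.
rewrite /tfun /tquot /strip_weight => /eqP; rewrite mulf_eq0 => /orP[/eqP ->|/eqP ->].
  by rewrite !mul0r.
by rewrite !mulr0.
Qed.

Lemma continuous_tquot s : 0 < s -> continuous (fun xi => tquot s xi `^ p).
Proof.
move=> s0; apply: (continuous_supp (@closed_tregion s)) => xi; last first.
  by move=> h; rewrite tquot_supp// powR0// gt_eqF.
move=> [/andP[h1 _] _]; have l0 : 0 < l xi by exact: lt_le_trans h1.
have -> : (fun xi => tquot s xi `^ p) = (fun xi => `|tquot s xi| `^ p).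
  by apply/funext => y; rewrite ger0_norm ?tquot_ge0.
apply: (@continuous_comp _ _ _ (tquot s) (fun r => `|r| `^ p)); last exact: continuous_normpow.
apply: cvgM; last exact: continuous_strip_weight.
apply: cvgM.
  apply: (@continuous_comp _ _ _ l (cut p s)); first exact: continuous_haff.
  exact: isd_continuous (is_derive_cut p s (l xi)).
by apply: cvgV; [rewrite gt_eqF|exact: continuous_haff].
Qed.

(** Where N vanishes or l <= s the left side is 0; elsewhere [bdist_le] bounds the distance by l /
    |N|. *)
Lemma tquot_le s xi : 0 < s ->
  ((tquot s xi `^ p)%:E <= (`|tfun s xi| `^ p)%:E / bdist D xi `^ p)%E.
Proof.
move=> s0; have [Z0|Z0] := eqVneq (tquot s xi) 0.
  by rewrite Z0 powR0 ?gt_eqF// div_poweR_ge0// powR_ge0.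
have ls : s < l xi.
  by rewrite ltNge; apply: contra_neqN Z0 => h; rewrite /tquot cut_eq0// !mul0r.
have l0 : 0 < l xi by exact: lt_trans ls.
have N0 : 0 < hnormal2 a b c xi.
  rewrite lt_neqAle hnormal2_ge0 andbT; apply: contra_neq Z0 => N0.
  by rewrite /tquot /strip_weight -N0 sqrtr0 mul0r mulr0.
have r0 : 0 < l xi / Num.sqrt (hnormal2 a b c xi) by rewrite divr_gt0// sqrtr_gt0.
have Dxi : D xi by apply/DP.
apply: le_trans (div_poweR_ge (powR_ge0 _ _) r0 p0 (bdist_ge0 D xi) (bdist_le DP Dxi N0)).
rewrite (ger0_norm (tfun_ge0 _ _)) lee_fin le_eqVlt; apply/orP; left; apply/eqP.
have -> : tquot s xi = tfun s xi * (l xi / Num.sqrt (hnormal2 a b c xi))^-1.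
  by rewrite /tquot /tfun /strip_weight invf_div; ring.
rewrite powRM ?tfun_ge0 ?invr_ge0 ?(ltW r0)// -[(_ / _)^-1]powR_inv1 ?(ltW r0)// -powRrM.
by rewrite mulN1r.
Qed.

End sharpness.

Section sharp_constant.
Context {R : realType} {n : nat}.
Local Notation H := (heis R n).
Local Notation E := ('I_n * bool)%type.
Implicit Types (xi zeta v : H).
Variables (a b : 'rV[R]_n) (c k p rho : R) (w : H).
Hypotheses (w1 : hlin a b c w = 1) (wN : forall e, hnormal_lin c e w = 0).
Hypotheses (p1 : 1 < p) (rho0 : 0 <= rho).
Local Notation l := (haff a b c k).
Local Notation g := (strip_weight a b c rho w).
Local Notation psi := (hcut a b c w rho).
Local Notation Z := (tquot a b c k p rho w).
Local Notation be := ((p - 1) / p).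
Local Notation mass := (strip_mass a b c k p rho w).
Let p0 : 0 < p. Proof. exact: lt_trans ltr01 p1. Qed.
Let b0 : 0 < be. Proof. by rewrite divr_gt0// subr_gt0. Qed.

Lemma measurable_tquot s : 0 < s ->
  measurable_fun [set: heism R n] (fun xi : heism R n => (Z s xi `^ p)%:E).
Proof.
move=> s0; apply/measurable_EFinP; apply: continuous_measurable_heis.
exact: continuous_tquot.
Qed.

(** On the shell 2^-(i+1) < l <= 2^-i the p-th power of the profile quotient is at least mc 2^i and
    the weighted mass is 2^-(i+1) m: every shell contributes mc m / 2, and about log (1 / s) shells
    fit above 2 s. *)
Lemma tquot_mass (mc m : R) : 0 < mc -> mass 0 1 = m%:E ->
  (forall s r, 0 < s -> 2 * s <= r -> r <= 1 -> mc / r <= (cut p s r / r) `^ p) ->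
  forall s j, 0 < s -> 2 * s <= 2^-1 ^+ j ->
  ((j%:R * (mc * m / 2))%:E <=
   \int[volume]_(xi in strip a b c k (2^-1 ^+ j) 1) (Z s xi `^ p)%:E)%E.
Proof.
move=> mc0 hm hmc s j s0; elim: j => [_|j IH sj].
  by rewrite mul0r; apply: integral_ge0 => xi _; rewrite lee_fin powR_ge0.
have h2 : 0 < 2^-1 ^+ j :> R by rewrite exprn_gt0// invr_gt0.
have h21 : 2^-1 ^+ j <= 1 :> R by rewrite exprn_ile1// ?invr_ge0// invf_le1// ler1n.
have hS : 2^-1 ^+ j.+1 <= 2^-1 ^+ j :> R by rewrite exprS ler_piMl ?(ltW h2)// invf_le1// ler1n.
have hS0 : 0 < 2^-1 ^+ j.+1 :> R by rewrite exprn_gt0// invr_gt0.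
have -> : strip a b c k (2^-1 ^+ j.+1) 1 =
    strip a b c k (2^-1 ^+ j.+1) (2^-1 ^+ j) `|` strip a b c k (2^-1 ^+ j) 1.
  apply/seteqP; split => xi; rewrite /strip /=.
    by move=> /andP[h3 h4]; have [h|h] := leP (l xi) (2^-1 ^+ j); [left|right]; apply/andP.
  by case=> /andP[h3 h4]; apply/andP; split => //; [exact: le_trans h21|exact: le_lt_trans h3].
rewrite ge0_integral_setU; last 5 first.
- exact: measurable_strip.
- exact: measurable_strip.
- exact: measurable_funS (measurable_tquot s0).
- by move=> xi _; rewrite lee_fin powR_ge0.
- apply/disj_setPS => xi [] /andP[_ h3] /andP[h4 _].
  by move: (lt_le_trans h4 h3); rewrite ltxx.
rewrite -natr1 mulrDl mul1r addrC EFinD; apply: leeD; last by apply: IH; exact: le_trans sj hS.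
have -> : (mc * m / 2)%:E = ((mc / 2^-1 ^+ j)%:E * mass (2^-1 ^+ j.+1) (2^-1 ^+ j))%E.
  rewrite (strip_mass_shell w1 wN p0 j hm) -EFinM; congr (_%:E).
  by rewrite exprS; field; rewrite expf_neq0.
have cj0 : 0 <= mc / 2^-1 ^+ j by rewrite divr_ge0 ?(ltW mc0) ?(ltW h2).
rewrite /strip_mass -ge0_integralZl//; last 3 first.
- exact: measurable_strip.
- exact: measurable_funS (measurable_strip_weight _ _ _ _ _ p0).
- by move=> xi _; rewrite lee_fin powR_ge0.
apply: ge0_le_integral_nm => xi.
  by move=> _; rewrite -EFinM lee_fin mulr_ge0// powR_ge0.
move=> /andP[l1 l2]; have l0 : 0 < l xi by exact: lt_trans l1.
rewrite -EFinM lee_fin /tquot powRM ?strip_weight_ge0 ?divr_ge0 ?cut_ge0 ?(ltW l0)//.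
rewrite ler_wpM2r ?powR_ge0//; apply: le_trans (hmc s (l xi) s0 _ _).
- by rewrite ler_wpM2l ?(ltW mc0)// lef_pV2 ?posrE.
- exact: le_trans sj (ltW l1).
- exact: le_trans l2 h21.
Qed.

Variable th : R.
Hypothesis th0 : 0 < th.

(** The first term is the extremal one up to [th]. The second collects the derivatives of both
    cut-offs and is bounded on a fixed box. The third is the layer where the profile starts: its
    derivative there is of order s^(be - 1), whose p-th power is 1 / s, on a strip of width of order
    s. *)
Lemma tfun_energy : exists K : R * R, [/\ 0 <= K.1, 0 <= K.2 & forall s xi, 0 < s ->
    hnorm (hgrad (tfun a b c k p rho w s) xi) `^ p <=
      (be + 2 * th) `^ p * Z s xi `^ p + K.1 * \1_[set xi : H | `|xi| <= hbox k w rho] xi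
      + K.1 * s^-1 * (g xi `^ p * \1_(strip a b c k 0 (K.2 * s) : set H) xi)].
Proof.
have [[M Y] /= M0 hM] := cut1_le p1 th0.
have [Cg Cg0 hCg] := continuous_bounded (hbox k w rho) (@continuous_strip_weight R n a b c rho w).
have spsi : smooth psi by exact: sclass_smooth (sclass_hcut a b c w rho).
have cd : continuous (fun xi => Num.sqrt (\sum_e hder psi e xi ^+ 2)).
  move=> xi; apply: (@continuous_comp _ _ _ (fun xi => \sum_e hder psi e xi ^+ 2) (@Num.sqrt R)); last exact: sqrt_continuous.
  by apply: continuous_sum => e; apply: continuous_sqr; exact: continuous_hder.
have [Cd Cd0 hCd] := continuous_bounded (hbox k w rho) cd.
pose K1 := M * Cg + 2 `^ be * Cd.
have K10 : 0 <= K1 by rewrite addr_ge0// mulr_ge0// powR_ge0.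
pose c1 := ((be + th) / th + 1) `^ p; have c10 : 0 <= c1 by exact: powR_ge0.
pose c2 := c1 * 2 `^ p; have c20 : 0 <= c2 by rewrite mulr_ge0// powR_ge0.
have cK : 0 <= c2 * K1 `^ p by rewrite mulr_ge0// powR_ge0.
have cM : 0 <= c2 * M `^ p by rewrite mulr_ge0// powR_ge0.
exists (c2 * K1 `^ p + c2 * M `^ p, Num.max 0 Y); split => /=.
- exact: addr_ge0.
- by rewrite le_max lexx.
move=> s xi s0.
have T1 : 0 <= (be + 2 * th) `^ p * Z s xi `^ p by rewrite mulr_ge0 ?powR_ge0.
have T3 (A : set H) : 0 <= g xi `^ p * \1_A xi :> R by rewrite mulr_ge0// powR_ge0.
have [Kxi|nK] := pselect (tsupport (tfun a b c k p rho w s) xi); last first.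
  rewrite hgradE big1 ?sqrtr0 ?powR0 ?gt_eqF//; last first.
    by move=> e _; rewrite hder_supp// expr0n.
  by rewrite !addr_ge0// mulr_ge0// ?mulr_ge0 ?addr_ge0 ?invr_ge0 ?(ltW s0).
have [/andP[sl l2] xB] := tsupport_tfun rho0 s0 Kxi.
have l0 : 0 < l xi by exact: lt_le_trans sl.
have -> : \1_[set xi : H | `|xi| <= hbox k w rho] xi = 1 :> R by rewrite indicE mem_set.
pose ind := if l xi <= Y * s then M * s `^ (be - 1) else 0.
have ind0 : 0 <= ind by rewrite /ind; case: ifP => // _; rewrite mulr_ge0// powR_ge0.
have g0 := strip_weight_ge0 a b c rho w xi.
have Z0 := tquot_ge0 a b c k p rho w xi s0.
have gle : g xi <= Cg by apply: le_trans (hCg xi xB); exact: ler_norm.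
have hn : hnorm (hgrad (tfun a b c k p rho w s) xi) <= (be + th) * Z s xi + (K1 + ind * g xi).
  rewrite hgradE.
  have -> : \sum_e hder (tfun a b c k p rho w s) e xi ^+ 2 =
      \sum_e (cut1 p s (l xi) * psi xi * hnormal a b c e xi + cut p s (l xi) * hder psi e xi) ^+ 2.
    by apply: eq_bigr => e _; rewrite hder_tfun.
  apply: le_trans (minkowski2 _ _ _ _) _.
  have -> : `|cut1 p s (l xi) * psi xi| * Num.sqrt (\sum_e hnormal a b c e xi ^+ 2) = `|cut1 p s (l xi)| * g xi.
    by rewrite normrM (ger0_norm (hcut_ge0 _ _ _ _ _ _)) /strip_weight; ring.
  have h1 : `|cut p s (l xi)| * Num.sqrt (\sum_e hder psi e xi ^+ 2) <= 2 `^ be * Cd.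
    apply: ler_pM => //; first by rewrite ger0_norm ?cut_ge0// (cut_le p1).
    by apply: le_trans (hCd xi xB); exact: ler_norm.
  have h2 := ler_wpM2r g0 (hM s (l xi) s0 l0).
  have h3 : M * g xi <= M * Cg by rewrite ler_wpM2l.
  have h4 : (be + th) * Z s xi = (be + th) * (cut p s (l xi) / l xi) * g xi by rewrite /tquot; ring.
  rewrite -/ind mulrDl [(_ + M) * _]mulrDl -h4 in h2.
  by rewrite /K1; move: h1 h2 h3; lra.
have H0 : 0 <= hnorm (hgrad (tfun a b c k p rho w s) xi) by exact: sqrtr_ge0.
have Q0 : 0 <= K1 + ind * g xi by rewrite addr_ge0// mulr_ge0.
apply: (@le_trans _ _ (((be + th) * Z s xi + (K1 + ind * g xi)) `^ p)).
  apply: ge0_ler_powR; rewrite ?nnegrE ?(ltW p0)//.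
  by rewrite addr_ge0// mulr_ge0// addr_ge0 ?ltW.
apply: le_trans (powRD_split p0 (ltW b0) th0 Z0 Q0) _.
rewrite -[leRHS]addrA lerD2l -/c1; apply: le_trans (ler_wpM2l c10 (powRD_le2 p0 K10 (mulr_ge0 ind0 g0))) _.
rewrite [leLHS]mulrA -/c2 [_ * 1]mulr1 [leLHS]mulrDr; apply: lerD; first by rewrite lerDl.
rewrite /ind; case: ifP => [lY|_]; last first.
  by rewrite mul0r powR0 ?gt_eqF// mulr0 mulr_ge0 ?T3// mulr_ge0 ?addr_ge0 ?invr_ge0 ?(ltW s0).
have -> : \1_(strip a b c k 0 (Num.max 0 Y * s) : set H) xi = 1 :> R.
  rewrite indicE mem_set//; rewrite /strip /= l0 (le_trans lY)// ler_wpM2r ?(ltW s0)//.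
  by rewrite le_max lexx orbT.
have Ms : 0 <= M * s `^ (be - 1) by rewrite mulr_ge0// powR_ge0.
rewrite mulr1 (powRM _ Ms g0) (powRM _ M0 (powR_ge0 _ _)) -powRrM.
have -> : (be - 1) * p = -1 by field; rewrite gt_eqF.
rewrite (powR_inv1 (ltW s0)) !mulrA ler_wpM2r ?powR_ge0// ler_wpM2r ?invr_ge0 ?(ltW s0)//.
by rewrite lerDr.
Qed.

End sharp_constant.

Lemma half_space_sharp (R : realType) (n : nat) (p : R) (D : set (heis R n)) (C : R) :
  (0 < n)%N -> 1 < p -> half_space D -> ((p - 1) / p) `^ p < C -> ~ hardy p D C.
Proof.
move=> n0 p1 [a [b [c [k [abc0 DE]]]]] hC hH.
have DP xi : D xi <-> 0 < haff a b c k xi by rewrite DE /= /haff subr_gt0.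
have oD : open D := half_space_open DP.
have p0 : 0 < p by exact: lt_trans ltr01 p1.
set be := (p - 1) / p in hC; have b0 : 0 < be by rewrite divr_gt0// subr_gt0.
have [w [w1 wN]] := exists_transversal abc0.
have [xi1 N1] := exists_hnormal2_gt0 abc0 n0.
(* Large enough for the cut-off to be positive at [xi1], a point where N does not vanish; so the
   strips have positive mass. *)
pose rho := 1 + \sum_o `|hproj a b c w o xi1|.
have rho0 : 0 <= rho by rewrite addr_ge0// sumr_ge0.
have g1 : 0 < strip_weight a b c rho w xi1.
  rewrite mulr_gt0 ?sqrtr_gt0//; apply: hcut_gt0 => o.
  by rewrite /rho (bigD1 o)//= addrCA ltrDl ltr_pwDl// sumr_ge0.
have := strip_mass_gt0 k w1 wN p0 g1; have := strip_mass_fin a b c k w p0 rho0.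
case hm : (strip_mass a b c k p rho w 0 1) => [m| |]// _; rewrite lte_fin => m0.
have C0 : 0 < C by apply: le_lt_trans hC; exact: powR_ge0.
have beC : be < C `^ p^-1.
  have -> : be = (be `^ p) `^ p^-1 by rewrite -powRrM divff ?powRr1 ?gt_eqF// ltW.
  by apply: gt0_ltr_powR; rewrite ?invr_gt0// nnegrE ?powR_ge0// ltW.
(* A third of the gap, so that be + 2 th stays below C^(1/p). *)
pose th := (C `^ p^-1 - be) / 3; have th0 : 0 < th by rewrite divr_gt0// subr_gt0.
have BC : (be + 2 * th) `^ p < C.
  have CE : C = (C `^ p^-1) `^ p by rewrite -powRrM mulVf ?powRr1 ?gt_eqF// ltW.
  rewrite [ltRHS]CE.
  apply: gt0_ltr_powR; rewrite // ?nnegrE ?powR_ge0//; last by rewrite /th; lra.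
  by rewrite addr_ge0 ?(ltW b0)// mulr_ge0// ltW.
set B := (be + 2 * th) `^ p in BC.
have [mc mc0 hmc] := cut_ge p1.
have [[K Y] /= [K0 Y0 hK]] := tfun_energy a b c k w p1 rho0 th0.
pose BX : set (heism R n) := [set xi : heis R n | `|xi| <= hbox k w rho].
have mBX : measurable BX := @measurable_heis_box R n (hbox k w rho).
have volfin := @volume_box_fin R n (hbox k w rho).
case hV : (volume BX) => [vol| |]; last 2 first.
- by move: volfin; rewrite -/BX hV.
- by have : (0 <= volume BX)%E by []; rewrite hV.
have vol0 : 0 <= vol by rewrite -lee_fin -hV.
(* 2^M is at least the width factor Y of the layer, so the layer of height Y s fits into 0 < l <=
   2^-j for s = 2^-(j+M); the successor ensures M >= 1, hence 2 s <= 2^-j. *)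
pose M := (Num.bound Y).+1; have YM : Y <= 2 ^+ M.
  apply: le_trans (_ : M%:R <= _).
    by apply: le_trans (ltW (archi_boundP Y0)) _; rewrite ler_nat.
  by rewrite -natrX ler_nat; apply/ltnW/ltn_expl.
(* Independent of j: the layer term is (K / s) 2^-j m = K 2^M m. *)
pose T := K * vol + K * 2 ^+ M * m.
(* The left-hand side grows linearly in the number j of dyadic shells, while T is fixed. *)
suff key j : (C - B) * (j%:R * (mc * m / 2)) <= T.
  have d0 : 0 < (C - B) * (mc * m / 2) by rewrite mulr_gt0 ?subr_gt0// divr_gt0// mulr_gt0.
  have T0 : 0 <= T.
    exact: addr_ge0 (mulr_ge0 K0 vol0) (mulr_ge0 (mulr_ge0 K0 (exprn_ge0 M (ler0n _ 2))) (ltW m0)).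
  have := archi_boundP (divr_ge0 T0 (ltW d0)); set j := Num.bound _.
  rewrite ltr_pdivrMr// ltNge => /negP; apply.
  by rewrite mulrCA; exact: key.
pose s : R := 2^-1 ^+ (j + M); have s0 : 0 < s by rewrite exprn_gt0// invr_gt0.
pose Z := tquot a b c k p rho w s.
pose A := (\int[volume]_(xi in [set: heism R n]) (Z xi `^ p)%:E)%E.
have mZ := measurable_tquot a b c k w p1 rho0 s0.
have Alow : ((j%:R * (mc * m / 2))%:E <= A)%E.
  have s2 : 2 * s <= 2^-1 ^+ j.
    rewrite /s exprD mulrCA ler_piMr ?exprn_ge0 ?invr_ge0//.
    by rewrite /M exprS mulrA divff// mul1r exprn_ile1// ?invr_ge0// invf_le1// ler1n.
  apply: le_trans (tquot_mass w1 wN p1 rho0 mc0 hm hmc s0 s2) _.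
  apply: ge0_subset_integral => //; first exact: measurable_strip.
  by move=> xi _; rewrite lee_fin powR_ge0.
(* Finiteness allows B A to be subtracted from C A in the end. *)
have Afin : (A < +oo)%E.
  have iZ : volume.-integrable [set: heism R n] (EFin \o (fun xi : heis R n => Z xi `^ p)).
    apply: (@integrable_compact_support R n _ (hbox k w rho)); first exact: continuous_tquot.
    move=> xi hx; rewrite /Z tquot_supp// ?powR0 ?gt_eqF// => -[_].
    by rewrite leNgt hx.
  have := integrable_fin_num measurableT iZ.
  by rewrite ge0_fin_numE//; apply: integral_ge0 => xi _; rewrite lee_fin powR_ge0.
have A0 : (0 <= A)%E by apply: integral_ge0 => xi _; rewrite lee_fin powR_ge0.
have ms : measurable (strip a b c k 0 (Y * s)) by exact: measurable_strip.
have mg := measurable_strip_weight a b c rho w p0.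
have hstrip : (strip_mass a b c k p rho w 0 (Y * s) <= (2^-1 ^+ j * m)%:E)%E.
  rewrite -(strip_mass_dyadic w1 wN p0 j hm).
  apply: ge0_subset_integral => //.
  - exact: measurable_strip.
  - exact: measurable_funS mg.
  - by move=> xi _; rewrite lee_fin powR_ge0.
  move=> xi /andP[h1 h2]; apply/andP; split => //; apply: le_trans h2 _.
  rewrite /s exprD mulrCA ler_piMr ?exprn_ge0 ?invr_ge0//.
  by rewrite exprVn ler_pdivrMr ?exprn_gt0// mul1r.
have up : (\int[volume]_(xi in [set: heism R n])
    (hnorm (hgrad (tfun a b c k p rho w s) xi) `^ p)%:E <= B%:E * A + T%:E)%E.
  pose f1 xi : \bar R := (B%:E * (Z xi `^ p)%:E)%E.
  pose f2 (xi : heism R n) : \bar R := (K%:E * (\1_BX xi)%:E)%E.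
  pose f3 (xi : heism R n) : \bar R := ((K * s^-1)%:E * ((strip_weight a b c rho w xi `^ p)%:E * (\1_(strip a b c k 0 (Y * s)) xi)%:E))%E.
  have KS0 : 0 <= K * s^-1 by rewrite mulr_ge0// invr_ge0 ltW.
  have f10 xi : (0 <= f1 xi)%E by rewrite /f1 -EFinM lee_fin mulr_ge0// powR_ge0.
  have f20 xi : (0 <= f2 xi)%E by rewrite /f2 -EFinM lee_fin mulr_ge0.
  have f30 xi : (0 <= f3 xi)%E.
    by rewrite /f3 -!EFinM lee_fin mulr_ge0// mulr_ge0// powR_ge0.
  have mind (S : set (heism R n)) : measurable S ->
      measurable_fun [set: heism R n] (fun xi : heism R n => (\1_S xi : R)%:E).
    by move=> mS; apply/measurable_EFinP; exact: measurable_indic.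
  have mf1 : measurable_fun [set: heism R n] (f1 : heism R n -> \bar R) by apply: measurable_funeM.
  have mf2 : measurable_fun [set: heism R n] f2 by apply: measurable_funeM; exact: mind.
  have mf4 : measurable_fun [set: heism R n] (fun xi : heism R n =>
      ((strip_weight a b c rho w xi `^ p)%:E * (\1_(strip a b c k 0 (Y * s)) xi)%:E)%E).
    by apply: emeasurable_funM => //; exact: mind.
  have mf3 : measurable_fun [set: heism R n] f3 by apply: measurable_funeM.
  have I1 : (\int[volume]_(xi in [set: heism R n]) f1 xi = B%:E * A)%E.
    by rewrite ge0_integralZl// => [xi _|]; rewrite lee_fin powR_ge0.
  have I2 : (\int[volume]_(xi in [set: heism R n]) f2 xi = (K * vol)%:E)%E.
    rewrite ge0_integralZl ?lee_fin//; last exact: mind.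
    rewrite integral_indic// setIT.
    by transitivity (K%:E * volume BX)%E => //; rewrite hV.
  have I3 : (\int[volume]_(xi in [set: heism R n]) f3 xi <= (K * 2 ^+ M * m)%:E)%E.
    rewrite ge0_integralZl//; last first.
      by move=> xi _; rewrite -EFinM lee_fin mulr_ge0// powR_ge0.
    have -> : (\int[volume]_(xi in [set: heism R n])
        ((strip_weight a b c rho w xi `^ p)%:E * (\1_(strip a b c k 0 (Y * s)) xi)%:E) =
        strip_mass a b c k p rho w 0 (Y * s))%E.
      rewrite /strip_mass [RHS]integral_mkcond; apply: eq_integral => xi _.
      by rewrite patchE indicE; case: ifP => _; rewrite ?mule1 ?mule0.
    apply: le_trans (lee_wpmul2l _ hstrip) _; first by rewrite lee_fin.
    rewrite -EFinM lee_fin le_eqVlt; apply/orP; left; apply/eqP.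
    rewrite /s exprD !exprVn; field.
    by rewrite !expf_neq0.
  apply: (@le_trans _ _ (\int[volume]_(xi in [set: heism R n]) (f1 xi + f2 xi + f3 xi))%E).
    apply: ge0_le_integral_nm => xi _; first by rewrite lee_fin powR_ge0.
    rewrite /f1 /f2 /f3 -!EFinM -!EFinD lee_fin; exact: hK.
  rewrite ge0_integralD//; last 2 first.
  - by move=> xi _; rewrite adde_ge0.
  - exact: emeasurable_funD.
  rewrite ge0_integralD// I1 I2.
  have -> : (B%:E * A + T%:E = B%:E * A + (K * vol)%:E + (K * 2 ^+ M * m)%:E)%E by rewrite -addeA -EFinD.
  exact: leeD2l.
have tC : Ccinfty D (tfun a b c k p rho w s) by exact: tfun_Ccinfty.
have KD : tsupport (tfun a b c k p rho w s) `<=` D by case: tC.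
have := hH _ tC.
rewrite integral_supp//; last first.
  move=> xi nD; rewrite supp_eq0 => [|/KD//].
  by rewrite normr0 powR0 ?gt_eqF// mul0e.
rewrite [X in (_ <= X)%E -> _]integral_supp//; last first.
  move=> xi nD; rewrite hgradE big1 ?sqrtr0 ?powR0 ?gt_eqF// => e _.
  by rewrite hder_supp ?expr0n// => /KD.
move=> /le_trans/(_ up) h.
have : (C%:E * A <= B%:E * A + T%:E)%E.
  apply: le_trans h; rewrite lee_wpmul2l ?lee_fin ?(ltW C0)//.
  apply: ge0_le_integral_nm => xi _; first by rewrite lee_fin powR_ge0.
  exact: tquot_le.
clear up h; move: A0 Afin Alow; case: A => [A| |]// _ _; rewrite lee_fin -!EFinM -EFinD lee_fin => Alow hA.
apply: le_trans (ler_wpM2l _ Alow) _; first by rewrite subr_ge0 ltW.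
by rewrite mulrBl lerBlDl.
Qed.

Theorem theoremC (R : realType) (n : nat) (p : R) (D : set (heis R n)) :
  (0 < n)%N -> 1 < p ->
  ([/\ domain D, bounded_set D & convex_set D] \/ half_space D ->
    hardy p D (((p - 1) / p) `^ p)) /\
  (half_space D ->
    forall C : R, ((p - 1) / p) `^ p < C -> ~ hardy p D C).
Proof.
move=> n0 p1; split; last by move=> hD C; exact: half_space_sharp.
by case=> [[dD bD cD]|hD]; [exact: hardy_convex|exact: hardy_half_space].
Qed.
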